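(* Let $b$ be a finite Blaschke product of degree $M$, let $e_1,\ldots,e_M$ be an orthonormal basis of $\mathscr H(b)=\mathbf H_2\ominus b\mathbf H_2$, and let $H\in\mathbf H_2^{p\times q}$. Then the following are equivalent: (1) $[H,H]\le I_q$. (2) There exists a Schur function $\sigma\in\mathscr S^{(Mp+q)\times q}$, partitioned as $$\sigma=\begin{pmatrix}\sigma_{11}\\ \vdots\\ \sigma_{1M}\\ \sigma_2\end{pmatrix}$$ with $\sigma_{11},\ldots,\sigma_{1M}$ being $\mathbb C^{p\times q}$-valued and $\sigma_2$ being $\mathbb C^{q\times q}$-valued, such that for all $z\in\mathbb D$ $$H(z)=\left(\sum_{j=1}^M e_j(z)\sigma_{1j}(b(z))\right)\bigl(I_q-b(z)\sigma_2(b(z))\bigr)^{-1}.$$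
   Context: $\mathbb D$ is the open unit disk and $\mathbf H_2$ is the Hardy space of $\mathbb D$: functions $f(z)=\sum_{n\ge 0}f_nz^n$ with $\|f\|_2^2=\sum_{n\ge0}|f_n|^2<\infty$, with the corresponding inner product. The superscript $*$ denotes complex conjugate (of a number) or conjugate transpose (of a matrix). A finite Blaschke product of degree $M\ge 1$ is a function $b(z)=c\prod_{\ell=1}^M\frac{z-a_\ell}{1-za_\ell^*}$ with $|c|=1$ and $a_1,\ldots,a_M\in\mathbb D$ (not necessarily distinct). The space $\mathscr H(b)=\mathbf H_2\ominus b\mathbf H_2$ is the orthogonal complement of $b\mathbf H_2$ in $\mathbf H_2$; it has dimension $M$. Let $p,q\ge1$ be integers. For a $\mathbb C^{p\times q}$-valued power series $f(z)=\sum_{n\ge0}f_nz^n$, one sets $[f,f]=\sum_{n=0}^\infty f_n^*f_n=\frac1{2\pi}\int_0^{2\pi}f(e^{it})^*f(e^{it})\,dt\in\mathbb C^{q\times q}$. The space $\mathbf H_2^{p\times q}$ consists of those $f$ for which $\mathrm{Tr}\,[f,f]<\infty$. The inequality $[H,H]\le I_q$ is in the sense of Hermitian matrices (positive semidefinite order). A Schur function in $\mathscr S^{r\times q}$ is a $\mathbb C^{r\times q}$-valued function that is analytic and contractive (operator norm at most $1$) in $\mathbb D$. *)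

(* Defs.v *)
From HB Require Import structures.
From mathcomp Require Import all_boot all_order all_algebra.
From mathcomp Require Import complex.
From mathcomp Require Import all_classical all_reals all_analysis.

Set Implicit Arguments.
Unset Strict Implicit.
Unset Printing Implicit Defensive.

Import Order.TTheory GRing.Theory Num.Theory numFieldNormedType.Exports.

Local Open Scope ring_scope.
Local Open Scope sesquilinear_scope.
Local Open Scope classical_set_scope.

(* [R[i]] alone does not trigger the canonical topology of numeric fields;
   its [numClosedFieldType] structure does. *)
Definition Cplx (R : realType) : numClosedFieldType := complex R.

Section HardySpace.
Variable R : realType.
Local Notation C := (Cplx R).

Definition unit_disk : set C := [set z | `|z| < 1].

(* A power series is represented by its coefficients; [ps_eval] and
   [mxps_eval] give the analytic function on the disk it defines.  Both
   [limn]s converge on the disk for elements of the Hardy spaces. *)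
Definition ps_eval (f : nat -> C) (z : C) : C :=
  limn (series (fun n => f n * z ^+ n)).

Definition hardy (f : nat -> C) : Prop :=
  cvgn (series (fun n => `|f n| ^+ 2)).

Definition hardy_dot (f g : nat -> C) : C :=
  limn (series (fun n => f n * (g n)^*)).

Definition mxps_eval p q (f : nat -> 'M[C]_(p, q)) (z : C) : 'M[C]_(p, q) :=
  limn (series (fun n => z ^+ n *: f n)).

Definition gram p q (f : nat -> 'M[C]_(p, q)) : 'M[C]_q :=
  limn (series (fun n => (f n)^t* *m f n)).

(* The terms have nonnegative trace, so convergence means Tr [f, f] < oo. *)
Definition mxhardy p q (f : nat -> 'M[C]_(p, q)) : Prop :=
  cvgn (series (fun n => \tr ((f n)^t* *m f n))).

Definition finite_blaschke (M : nat) (b : C -> C) : Prop :=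
  exists (c : C) (a : 'I_M -> C),
    [/\ `|c| = 1,
        forall l, unit_disk (a l) &
        forall z, unit_disk z ->
          b z = c * \prod_(l < M) ((z - a l) / (1 - z * (a l)^*))].

Definition mul_hardy (b : C -> C) : set (nat -> C) :=
  [set h | hardy h /\
     exists2 g, hardy g &
       forall z, unit_disk z -> ps_eval h z = b z * ps_eval g z].

Definition model_space (b : C -> C) : set (nat -> C) :=
  [set f | hardy f /\ forall h, mul_hardy b h -> hardy_dot f h = 0].

Definition orthonormal_basis (M : nat) (V : set (nat -> C))
    (e : 'I_M -> nat -> C) : Prop :=
  [/\ forall j, V (e j),
      forall i j, hardy_dot (e i) (e j) = (i == j)%:R &
      forall f, V f ->
        exists c : 'I_M -> C, forall n, f n = \sum_(j < M) c j * e j n].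

Definition analytic_at (f : C -> C) (z0 : C) : Prop :=
  exists r : C, 0 < r /\
    exists a : nat -> C, forall z, `|z - z0| < r ->
      series (fun n => a n * (z - z0) ^+ n) @ \oo --> f z.

Definition cvnorm n (x : 'cV[C]_n) : C := sqrtC (\sum_(i < n) `|x i 0| ^+ 2).

Definition contractive r q (A : 'M[C]_(r, q)) : Prop :=
  forall x : 'cV[C]_q, cvnorm (A *m x) <= cvnorm x.

Definition schur_function r q (s : C -> 'M[C]_(r, q)) : Prop :=
  forall z, unit_disk z ->
    (forall i j, analytic_at (fun w => s w i j) z) /\ contractive (s z).

(* In [C], [0 <= w] says that [w] is real and nonnegative. *)
Definition psd n (A : 'M[C]_n) : Prop :=
  A \is hermsymmx /\ forall x : 'cV[C]_n, 0 <= (x^t* *m A *m x) 0 0.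

Definition loewner_le n (A B : 'M[C]_n) : Prop := psd (B - A).

(* [mxvec_index j i] is row-major, of value [j * p + i]: [top_block s j] is
   the [j]-th of the [M] consecutive [p x q] blocks on top of [s]. *)
Definition top_block M p q (s : 'M[C]_(M * p + q, q)) (j : 'I_M) :
    'M[C]_(p, q) :=
  \matrix_(i < p, k < q) usubmx s (mxvec_index j i) k.

Definition bottom_block M p q (s : 'M[C]_(M * p + q, q)) : 'M[C]_q :=
  dsubmx s.

End HardySpace.

(* Main.v *)
Require Import Defs.
From HB Require Import structures.
From mathcomp Require Import all_boot all_order all_algebra.
From mathcomp Require Import cyclic separable cyclotomic complex.
From mathcomp Require Import all_classical all_reals all_analysis.
From mathcomp Require Import ring lra.
Set Implicit Arguments.
Unset Strict Implicit.
Unset Printing Implicit Defensive.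
Import Order.TTheory GRing.Theory Num.Theory numFieldNormedType.Exports.
Local Open Scope ring_scope.
Local Open Scope sesquilinear_scope.
Local Open Scope classical_set_scope.

(* Iterating the splitting [H2 = H(b) + b H2] turns [(e_j b^n)] into an
   orthonormal basis, so that [H(z) = sum_j e_j(z) K_j(b(z))] with
   [[H, H] = sum_j [K_j, K_j]].  This reduces the theorem to [b(z) = z]: a
   power series [K] satisfies [[K, K] <= 1] iff [K (1 - z s_2) = s_1] for a
   Schur function [(s_1; s_2)].

   Given [K], regard it as a contraction from C^q to [l2] and let [B] be the
   backward shift; then [s_1] and [s_2] have the coefficients [E A^n K] and
   [K^* B A^n K], where [E] is evaluation at 0 and [A = (1 - K K^* ) B].
   Conversely a Schur function [s] acts contractively on [l2] by truncated
   convolution.  Applying this to the power series [u = (1 - z s_2)^-1 x], for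
   which [|s u|^2 = |K x|^2 + |u|^2 - |x|^2], gives [|K x| <= |x|].

   Schur functions are only assumed to be locally power series; that their
   Taylor series at 0 represents them on the whole disk, and that it acts
   contractively, is derived from the maximum principle and averages over
   roots of unity, without integration. *)

(** * Complex numbers and limits *)

(** Completeness of the functions [e_j b^n] is never stated in norm. Splitting [N] times leaves a
    remainder [b^N v] with [|v| <= |u|], which vanishes at each point because [|b(z)| < 1]; norms
    are recovered from values by passing to the coefficients of power series.

    The operator [A] is forced by the equation [K = s_1 + z K s_2]: the coefficients of [K] are
    [E B^n K], and [B = A + K K^* B] peels off one product with some [K^* B A^m K] at a time.
    Contractivity of [s] is an energy balance for the state [X = (1 - z A)^-1 K x], written as
    [X = z B X + K (x - z K^* B X)].

    In the converse, [s u] has the components [K x] and [(u - x) / z], whence the formula for its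
    norm. As [u] is not known to be square summable, the formula is used on truncated sums, where
    the surplus term [|u_N|^2] has the favourable sign. *)

Section ComplexNumbers.
Variable R : realType.
Local Notation C := (Cplx R).
Implicit Types (x y : R) (z w : C).

Definition toC x : C := real_complex R x.
Definition re z : R := complex.Re z.
Definition im z : R := complex.Im z.
Definition nrm z : R := complex.Re (`|z| : R[i]).

Lemma nrmE z : `|z| = toC (nrm z).
Proof.
rewrite /nrm /toC; case: z => a b.
by rewrite -[`|_|](esym (@normc_def _ (Complex a b))).
Qed.

Lemma toC0 : toC 0 = 0. Proof. by []. Qed.
Lemma toC1 : toC 1 = 1. Proof. by []. Qed.
Lemma toCD x y : toC (x + y) = toC x + toC y.
Proof. exact: (rmorphD (real_complex R)). Qed.
Lemma toCN x : toC (- x) = - toC x.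
Proof. exact: (rmorphN (real_complex R)). Qed.
Lemma toCM x y : toC (x * y) = toC x * toC y.
Proof. exact: (rmorphM (real_complex R)). Qed.
Lemma toCX x n : toC (x ^+ n) = toC x ^+ n.
Proof. exact: (rmorphXn (real_complex R)). Qed.
Lemma toC_nat n : toC n%:R = n%:R.
Proof. exact: (rmorph_nat (real_complex R)). Qed.
Lemma toC_inj : injective toC. Proof. by move=> x y []. Qed.
Lemma toC_le x y : (toC x <= toC y) = (x <= y). Proof. exact: lecR. Qed.
Lemma toC_lt x y : (toC x < toC y) = (x < y). Proof. exact: ltcR. Qed.
Lemma toC_sum I (s : seq I) (P : pred I) (F : I -> R) :
  toC (\sum_(i <- s | P i) F i) = \sum_(i <- s | P i) toC (F i).
Proof. by apply: big_morph; [exact: toCD | exact: toC0]. Qed.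
Lemma re_toC x : re (toC x) = x. Proof. by []. Qed.
Lemma reD z w : re (z + w) = re z + re w. Proof. by case: z w => [a b] [c d]. Qed.
Lemma reN z : re (- z) = - re z. Proof. by case: z. Qed.
Lemma reB z w : re (z - w) = re z - re w. Proof. by rewrite reD reN. Qed.
Lemma re0 : re 0 = 0. Proof. by []. Qed.
Lemma re_conj z : re z^* = re z. Proof. by case: z. Qed.
Lemma imD z w : im (z + w) = im z + im w. Proof. by case: z w => [a b] [c d]. Qed.
Lemma imN z : im (- z) = - im z. Proof. by case: z. Qed.
Lemma im0 : im 0 = 0. Proof. by []. Qed.
Lemma re_sum I (s : seq I) (P : pred I) (F : I -> C) :
  re (\sum_(i <- s | P i) F i) = \sum_(i <- s | P i) re (F i).
Proof. by apply: big_morph; [exact: reD | exact: re0]. Qed.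
Lemma im_sum I (s : seq I) (P : pred I) (F : I -> C) :
  im (\sum_(i <- s | P i) F i) = \sum_(i <- s | P i) im (F i).
Proof. by apply: big_morph; [exact: imD | exact: im0]. Qed.
Lemma reM_toC x z : re (toC x * z) = x * re z.
Proof. by case: z => a b; rewrite /re /= mul0r subr0. Qed.
Lemma nrm_ge0 z : 0 <= nrm z.
Proof. by rewrite -toC_le -nrmE toC0. Qed.
Lemma nrm0 : nrm 0 = 0. Proof. by apply: toC_inj; rewrite -nrmE normr0. Qed.
Lemma nrm1 : nrm 1 = 1. Proof. by apply: toC_inj; rewrite -nrmE normr1. Qed.
Lemma nrmN z : nrm (- z) = nrm z.
Proof. by apply: toC_inj; rewrite -!nrmE normrN. Qed.
Lemma nrmM z w : nrm (z * w) = nrm z * nrm w.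
Proof. by apply: toC_inj; rewrite toCM -!nrmE normrM. Qed.
Lemma nrmX z n : nrm (z ^+ n) = nrm z ^+ n.
Proof. by apply: toC_inj; rewrite toCX -!nrmE normrX. Qed.
Lemma nrmV z : nrm z^-1 = (nrm z)^-1.
Proof.
have [->|z0] := eqVneq z 0; first by rewrite invr0 nrm0 invr0.
have nz : nrm z != 0 by rewrite -(inj_eq toC_inj) -nrmE normr_eq0.
by apply: (mulfI nz); rewrite -nrmM !divff // nrm1.
Qed.
Lemma nrmD z w : nrm (z + w) <= nrm z + nrm w.
Proof. by rewrite -toC_le toCD -!nrmE ler_normD. Qed.
Lemma nrmB z w : nrm (z - w) <= nrm z + nrm w.
Proof. by rewrite -(nrmN w) nrmD. Qed.
Lemma nrmC z w : nrm (z - w) = nrm (w - z).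
Proof. by rewrite -nrmN opprB. Qed.
Lemma nrm_conj z : nrm z^* = nrm z.
Proof. by apply: toC_inj; rewrite -!nrmE norm_conjC. Qed.
Lemma nrm_eq0 z : (nrm z == 0) = (z == 0).
Proof. by rewrite -(inj_eq toC_inj) -nrmE normr_eq0. Qed.
Lemma nrm_gt0 z : (0 < nrm z) = (z != 0).
Proof. by rewrite lt0r nrm_eq0 nrm_ge0 andbT. Qed.
Lemma nrm_toC x : nrm (toC x) = `|x|.
Proof. by rewrite /nrm -[`|_|](esym (@normc_def _ (Complex x 0))) /= expr0n /= addr0 sqrtr_sqr. Qed.
Lemma nrm_sum I (s : seq I) (P : pred I) (F : I -> C) :
  nrm (\sum_(i <- s | P i) F i) <= \sum_(i <- s | P i) nrm (F i).
Proof.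
elim/big_ind2: _ => [|z x w y zx wy|//]; first by rewrite nrm0.
exact: le_trans (nrmD _ _) (lerD zx wy).
Qed.
Lemma mul_conj z : z * z^* = toC (nrm z ^+ 2).
Proof. by rewrite toCX -nrmE normCK. Qed.
Lemma nrm_sqr z : nrm z ^+ 2 = re z ^+ 2 + im z ^+ 2.
Proof.
apply: toC_inj; rewrite toCX -nrmE; case: z => a b.
exact: esym (@add_Re2_Im2 _ (Complex a b)).
Qed.
Lemma re_le_nrm z : `|re z| <= nrm z.
Proof.
rewrite -(@ler_pXn2r _ 2) ?nnegrE ?nrm_ge0 ?normr_ge0 //.
by rewrite nrm_sqr real_normK ?num_real // lerDl sqr_ge0.
Qed.
Lemma im_le_nrm z : `|im z| <= nrm z.
Proof.
rewrite -(@ler_pXn2r _ 2) ?nnegrE ?nrm_ge0 ?normr_ge0 //.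
by rewrite nrm_sqr real_normK ?num_real // lerDr sqr_ge0.
Qed.
Lemma nrm_le_re_im z : nrm z <= `|re z| + `|im z|.
Proof.
rewrite -(@ler_pXn2r _ 2) ?nnegrE ?nrm_ge0 ?addr_ge0 ?normr_ge0 //.
rewrite nrm_sqr sqrrD !real_normK ?num_real //.
have := mulr_ge0 (normr_ge0 (re z)) (normr_ge0 (im z)); lra.
Qed.
Lemma nrm_sqrD z w : nrm (z + w) ^+ 2 = nrm z ^+ 2 + nrm w ^+ 2 + 2 * re (z * w^*).
Proof.
rewrite !nrm_sqr reD imD; case: z w => [a b] [c d]; rewrite /re /im /=; ring.
Qed.
Lemma re_mul_conj_le z w : 2 * re (z * w^*) <= nrm z ^+ 2 + nrm w ^+ 2.
Proof.
have := sqr_ge0 (nrm (z - w)); rewrite nrm_sqrD nrmN rmorphN mulrN reN.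
lra.
Qed.
Lemma nrm_lt1 z : (`|z| < 1) = (nrm z < 1).
Proof. by rewrite nrmE -toC1 toC_lt. Qed.
Lemma ge0_toC z : 0 <= z -> z = toC (re z).
Proof. by move=> z0; rewrite -[z in LHS]ger0_norm // -[z in RHS]ger0_norm // nrmE. Qed.
(** Weighted Cauchy-Schwarz: the defect is the square exhibited in the proof. The free weight lets
    recursions [u = a v + f] with [|a| < 1] be absorbed into summability bounds. *)
Lemma nrm_convex z w x : 0 < x < 1 ->
  nrm (z + w) ^+ 2 <= nrm z ^+ 2 / x + nrm w ^+ 2 / (1 - x).
Proof.
move=> /andP[x0 x1].
have h : nrm (z + w) ^+ 2 <= (nrm z + nrm w) ^+ 2.
  by rewrite ler_pXn2r ?nnegrE ?addr_ge0 ?nrm_ge0 ?nrmD.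
apply: le_trans h _.
move: (nrm z) (nrm w) => a b.
have -> : a ^+ 2 / x + b ^+ 2 / (1 - x) =
    (a + b) ^+ 2 + ((1 - x) * a - x * b) ^+ 2 / (x * (1 - x)).
  by field; rewrite (gt_eqF x0) /=; lra.
by rewrite lerDl divr_ge0 ?sqr_ge0 // mulr_ge0 ?(ltW x0) // subr_ge0 ltW.
Qed.
End ComplexNumbers.

Section Convergence.
Variable R : realType.
Local Notation C := (Cplx R).

Lemma cvgC_nrm (u : nat -> C) (l : C) :
  (fun n => nrm (u n - l)) @ \oo --> (0 : R) -> u @ \oo --> l.
Proof.
move=> h; apply/cvgrPdist_lt => e e0.
have ee : e = toC (re e) by exact: ge0_toC (ltW e0).
have e0' : 0 < re e by rewrite -toC_lt -ee.
move/cvgrPdist_lt: h => /(_ _ e0'); apply: filterS => n.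
by rewrite sub0r normrN ger0_norm ?nrm_ge0 // => h; rewrite nrmE ee toC_lt nrmC.
Qed.

Lemma nrm_cvgC (u : nat -> C) (l : C) :
  u @ \oo --> l -> (fun n => nrm (u n - l)) @ \oo --> (0 : R).
Proof.
move/cvgrPdist_lt => h; apply/cvgrPdist_lt => e e0.
have /h : 0 < toC e by rewrite -toC0 toC_lt.
apply: filterS => n.
by rewrite nrmE toC_lt sub0r normrN ger0_norm ?nrm_ge0 // nrmC.
Qed.

Lemma squeeze0 (u v : nat -> R) :
  (forall n, 0 <= u n <= v n) -> v @ \oo --> (0 : R) -> u @ \oo --> (0 : R).
Proof.
move=> uv v0; apply: (@squeeze_cvgr _ _ _ _ (fun=> 0) v); [|exact: cvg_cst|exact: v0].
by apply: nearW => n; exact: uv.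
Qed.

Lemma cvg_re (u : nat -> C) (l : C) :
  u @ \oo --> l -> (fun n => re (u n)) @ \oo --> re l.
Proof.
move=> /nrm_cvgC h; apply/cvgrPdist_lt => e e0.
move/cvgrPdist_lt: h => /(_ _ e0); apply: filterS => n.
rewrite sub0r normrN ger0_norm ?nrm_ge0 //; apply: le_lt_trans.
by rewrite -reB nrmC re_le_nrm.
Qed.

Lemma cvg_nrm (u : nat -> C) (l : C) :
  u @ \oo --> l -> (fun n => nrm (u n)) @ \oo --> nrm l.
Proof.
move=> /nrm_cvgC h; apply/cvgrPdist_lt => e e0.
move/cvgrPdist_lt: h => /(_ _ e0); apply: filterS => n.
rewrite sub0r normrN ger0_norm ?nrm_ge0 //; apply: le_lt_trans.
have h1 := nrmD (l - u n) (u n); have h2 := nrmD (u n - l) l.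
rewrite !subrK in h1 h2; rewrite ler_norml; apply/andP; split.
  by lra.
by rewrite nrmC; lra.
Qed.

Lemma cvg_conj (u : nat -> C) (l : C) :
  u @ \oo --> l -> (fun n => (u n)^*) @ \oo --> l^*.
Proof.
move=> /nrm_cvgC h; apply: cvgC_nrm.
by under eq_fun do rewrite -rmorphB nrm_conj.
Qed.

Lemma cvg_distR (u : nat -> R) (l : R) :
  u @ \oo --> l -> (fun n => `|u n - l|) @ \oo --> (0 : R).
Proof.
move/cvgrPdist_lt => h; apply/cvgrPdist_lt => e /h; apply: filterS => n.
by rewrite sub0r normrN normr_id distrC.
Qed.

Lemma cvgC_re_im (u : nat -> C) (l : C) :
  (fun n => re (u n)) @ \oo --> re l -> (fun n => im (u n)) @ \oo --> im l ->
  u @ \oo --> l.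
Proof.
move=> hr hi; apply: cvgC_nrm.
have h0 : (fun n => `|re (u n) - re l| + `|im (u n) - im l|) @ \oo --> (0 : R).
  by rewrite -[0]addr0; apply: cvgD; exact: cvg_distR.
apply: squeeze0 h0 => n; rewrite nrm_ge0 /=.
apply: le_trans (nrm_le_re_im _) _.
by rewrite reB imD imN.
Qed.

Lemma limC (u : nat -> C) (l : C) : u @ \oo --> l -> limn u = l.
Proof. exact: (cvg_lim (@norm_hausdorff _ _)). Qed.

Lemma limC_unique (u : nat -> C) (l m : C) : u @ \oo --> l -> u @ \oo --> m -> l = m.
Proof. by move=> /limC <- /limC <-. Qed.

Lemma seriesE (V : zmodType) (f : nat -> V) n : series f n = \sum_(i < n) f i.
Proof. by rewrite /series /= big_mkord. Qed.

(** Reduction to real series: real and imaginary parts are dominated by the moduli. *)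
Lemma abs_cvg (f : nat -> C) (B : R) :
  (forall N, \sum_(n < N) nrm (f n) <= B) -> cvgn (series f).
Proof.
move=> hB.
have aux (g : nat -> R) : (forall n, `|g n| <= nrm (f n)) -> cvgn (series g).
  move=> hg; apply: normed_cvg; apply: nondecreasing_is_cvgn.
    by apply: nondecreasing_series => n _ _; exact: normr_ge0.
  exists B => _ [N _ <-] /=; rewrite seriesEord /=; apply: le_trans (hB N).
  by apply: ler_sum => i _; exact: hg.
have ha := aux (fun n => re (f n)) (fun n => re_le_nrm _).
have hb := aux (fun n => im (f n)) (fun n => im_le_nrm _).
set a := limn _ in ha; set b := limn _ in hb.
apply: (cvgP (Complex a b : C)); apply: cvgC_re_im.
  suff -> : (fun n => re (series f n)) = series (fun n => re (f n)) by [].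
  by apply/funext => n; rewrite !seriesE re_sum.
suff -> : (fun n => im (series f n)) = series (fun n => im (f n)) by [].
by apply/funext => n; rewrite !seriesE im_sum.
Qed.

Lemma cvgn_le_cst (u : nat -> R) (l B : R) :
  u @ \oo --> l -> (\forall n \near \oo, u n <= B) -> l <= B.
Proof.
move=> ul [N _ uB]; rewrite leNgt; apply/negP => lB.
have e0 : 0 < l - B by rewrite subr_gt0.
move/cvgrPdist_lt: ul => /(_ _ e0)[N' _ hN].
have := hN (maxn N N') (leq_maxr _ _); have := uB (maxn N N') (leq_maxl _ _) => /=.
by rewrite ltr_norml => h1 /andP[_ h2]; lra.
Qed.

Lemma cvg_geom (t : R) : 0 <= t < 1 -> (fun n => t ^+ n) @ \oo --> (0 : R).
Proof. by move=> /andP[t0 t1]; apply: cvg_expr; rewrite ger0_norm. Qed.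

Lemma bernoulli (d : R) n : 0 <= d -> 1 + n%:R * d <= (1 + d) ^+ n.
Proof.
move=> d0; elim: n => [|n ih]; first by rewrite mul0r addr0 expr0.
rewrite exprS; apply: le_trans (_ : (1 + d) * (1 + n%:R * d) <= _).
  rewrite -natr1; have : 0 <= n%:R * d * d by rewrite !mulr_ge0.
  by nra.
by rewrite ler_wpM2l // addr_ge0.
Qed.

(* [n t^n = (n s^n) s^n] with [s = sqrt t], and [n s^n] is bounded by
   Bernoulli's inequality. *)
Lemma cvg_mul_geom (t : R) : 0 <= t < 1 -> (fun n => n%:R * t ^+ n) @ \oo --> (0 : R).
Proof.
move=> /andP[t0 t1]; have [->|tn0] := eqVneq t 0.
  apply: cvg_near_cst; near=> n.
  have n0 : (0 < n)%N by near: n; exists 1%N.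
  by rewrite expr0n (gtn_eqF n0) mulr0.
have tp : 0 < t by rewrite lt0r tn0.
set s := Num.sqrt t; have s0 : 0 < s by rewrite sqrtr_gt0.
have st : s ^+ 2 = t by rewrite sqr_sqrtr.
have s1 : s < 1 by rewrite -(@ltr_pXn2r _ 2) ?nnegrE ?(ltW s0) // st expr1n.
have hb n : n%:R * s ^+ n <= (s^-1 - 1)^-1.
  have d0 : 0 < s^-1 - 1 by rewrite subr_gt0 invf_gt1.
  have := bernoulli n (ltW d0); rewrite (addrC 1 (s^-1 - 1)) subrK exprVn => h.
  have sn : 0 < s ^+ n by rewrite exprn_gt0.
  rewrite -[leRHS]mul1r ler_pdivlMr //.
  have h2 : n%:R * (s^-1 - 1) <= (s ^+ n)^-1 by lra.
  have := ler_wpM2r (ltW sn) h2; rewrite mulVf ?gt_eqF //.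
  by rewrite mulrAC.
have hv : (fun n => (s^-1 - 1)^-1 * s ^+ n) @ \oo --> (0 : R).
  rewrite -(mulr0 (s^-1 - 1)^-1); apply: cvgMr; apply: cvg_geom.
  by rewrite ltW.
apply: squeeze0 hv => n; rewrite mulr_ge0 ?exprn_ge0 //=.
rewrite -st exprAC expr2 mulrA ler_wpM2r ?hb // ?exprn_ge0 // ltW //.
Unshelve. all: by end_near.
Qed.

Lemma cvg_cstC (l : C) : (fun=> l) @ \oo --> l.
Proof. exact: cvg_cst. Qed.

Lemma cvgCD (u v : nat -> C) (l m : C) : u @ \oo --> l -> v @ \oo --> m ->
  (fun n => u n + v n) @ \oo --> l + m.
Proof. by move=> hu hv; apply: (cvgD hu hv). Qed.

Lemma cvgCM (u v : nat -> C) (l m : C) : u @ \oo --> l -> v @ \oo --> m ->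
  (fun n => u n * v n) @ \oo --> l * m.
Proof. by move=> hu hv; apply: (cvgM hu hv). Qed.

Lemma cvgCZ (u : nat -> C) (l a : C) : u @ \oo --> l ->
  (fun n => a * u n) @ \oo --> a * l.
Proof. by move=> hu; apply: (cvgM (cvg_cst a) hu). Qed.

Lemma cvgCB (u v : nat -> C) (l m : C) : u @ \oo --> l -> v @ \oo --> m ->
  (fun n => u n - v n) @ \oo --> l - m.
Proof. by move=> hu hv; apply: (cvgB hu hv). Qed.

Lemma cvg_sum I (r : seq I) (u : I -> nat -> C) (l : I -> C) :
  (forall i, u i @ \oo --> l i) ->
  (fun n => \sum_(i <- r) u i n) @ \oo --> \sum_(i <- r) l i.
Proof.
move=> h; elim: r => [|i r ih].
  by under eq_fun do rewrite big_nil; rewrite big_nil; exact: cvg_cst.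
under eq_fun do rewrite big_cons; rewrite big_cons; apply: (cvgCD (h i) ih).
Qed.

Lemma cvg_sumR I (r : seq I) (u : I -> nat -> R) (l : I -> R) :
  (forall i, u i @ \oo --> l i) ->
  (fun n => \sum_(i <- r) u i n) @ \oo --> \sum_(i <- r) l i.
Proof.
move=> h; elim: r => [|i r ih].
  by under eq_fun do rewrite big_nil; rewrite big_nil; exact: cvg_cst.
under eq_fun do rewrite big_cons; rewrite big_cons; apply: (cvgD (h i) ih).
Qed.

(** If [l > c], then [s] eventually drops by at least [(l - c) / 2] at every step and becomes
    negative. With [s] the stored energy of a system, this bounds the limiting output without any
    convergence of the states. *)
Lemma telescope_limit (a s : nat -> R) (c l : R) :
  (forall n, 0 <= s n) -> (forall n, a n <= c + s n - s n.+1) ->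
  a @ \oo --> l -> l <= c.
Proof.
move=> s0 h al; rewrite leNgt; apply/negP => cl.
have e0 : 0 < (l - c) / 2 by rewrite divr_gt0 // subr_gt0.
move/cvgrPdist_lt: al => /(_ _ e0)[N _ hN].
have key n : s (N + n)%N <= s N - n%:R * ((l - c) / 2).
  elim: n => [|n ih]; first by rewrite addn0 mul0r subr0.
  have := hN (N + n)%N (leq_addr _ _) => /=; rewrite ltr_norml => /andP[_ h1].
  have := h (N + n)%N; rewrite addnS -natr1; lra.
have [n hn] : exists n : nat, s N < n%:R * ((l - c) / 2).
  exists (Num.truncn (s N / ((l - c) / 2))).+1.
  by rewrite -ltr_pdivrMr // truncnS_gt.
by have := s0 (N + n)%N; have := key n; lra.
Qed.
End Convergence.

(** * Power series with bounded coefficients *)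

Section PowerSeries.
Variable R : realType.
Local Notation C := (Cplx R).
Implicit Types (f g : nat -> C) (z w : C).

Definition bounded_seq f (B : R) := forall n, nrm (f n) <= B.
Definition back f n := f n.+1.

Lemma geom_sum_le (t : R) N : 0 <= t < 1 -> \sum_(n < N) t ^+ n <= (1 - t)^-1.
Proof.
move=> /andP[t0 t1]; have d0 : 0 < 1 - t by rewrite subr_gt0.
rewrite -[leRHS]mul1r ler_pdivlMr // mulrC -opprB mulNr -subrX1 opprB.
by rewrite lerBlDr lerDl exprn_ge0.
Qed.

Lemma bounded_seq_ge0 f B : bounded_seq f B -> 0 <= B.
Proof. by move=> /(_ 0%N); apply: le_trans (nrm_ge0 _). Qed.

Lemma ps_abs_sum f B z N : bounded_seq f B -> nrm z < 1 ->
  \sum_(n < N) nrm (f n * z ^+ n) <= B / (1 - nrm z).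
Proof.
move=> fB z1; have B0 := bounded_seq_ge0 fB.
apply: (@le_trans _ _ (\sum_(n < N) B * nrm z ^+ n)).
  apply: ler_sum => i _; rewrite nrmM nrmX ler_wpM2r ?exprn_ge0 ?nrm_ge0 //.
by rewrite -mulr_sumr ler_wpM2l // geom_sum_le // nrm_ge0.
Qed.

Lemma ps_cvg f B z : bounded_seq f B -> nrm z < 1 ->
  (fun N => \sum_(n < N) f n * z ^+ n) @ \oo --> ps_eval f z.
Proof.
move=> fB z1; have h := @abs_cvg _ (fun n => f n * z ^+ n) _ (fun N => ps_abs_sum N fB z1).
suff -> : (fun N => \sum_(n < N) f n * z ^+ n) = series (fun n => f n * z ^+ n) by exact: h.
by apply/funext => N; rewrite seriesE.
Qed.

Lemma ps_lim f z l : (fun N => \sum_(n < N) f n * z ^+ n) @ \oo --> l -> ps_eval f z = l.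
Proof.
move=> h; apply: limC.
suff -> : series (fun n => f n * z ^+ n) = (fun N => \sum_(n < N) f n * z ^+ n) by exact: h.
by apply/funext => N; rewrite seriesE.
Qed.

Lemma ps_bound f B z : bounded_seq f B -> nrm z < 1 ->
  nrm (ps_eval f z) <= B / (1 - nrm z).
Proof.
move=> fB z1; apply: (cvgn_le_cst (cvg_nrm (ps_cvg fB z1))).
by apply: nearW => N; apply: le_trans (nrm_sum _ _ _) (ps_abs_sum N fB z1).
Qed.

Lemma bounded_back f B k : bounded_seq f B -> bounded_seq (fun n => f (k + n)%N) B.
Proof. by move=> fB n; exact: fB. Qed.

Lemma ps_evalS f B z : bounded_seq f B -> nrm z < 1 ->
  ps_eval f z = f 0%N + z * ps_eval (back f) z.
Proof.
move=> fB z1; have bB : bounded_seq (back f) B by move=> n; exact: fB.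
have h := cvgCD (cvg_cst (f 0%N)) (cvgCZ (a := z) (ps_cvg bB z1)).
have := ps_cvg fB z1; rewrite -(cvg_shiftS (fun N => \sum_(n < N) f n * z ^+ n)) => h'.
apply: limC_unique h' _.
suff -> : (fun N => \sum_(n < N.+1) f n * z ^+ n) =
  (fun n => f 0%N + z * \sum_(n0 < n) back f n0 * z ^+ n0) by exact: h.
apply/funext => n; rewrite big_ord_recl expr0 mulr1 mulr_sumr; congr (_ + _).
by apply: eq_bigr => i _; rewrite exprS /back mulrCA.
Qed.

Lemma ps_eval_take f B z N : bounded_seq f B -> nrm z < 1 ->
  ps_eval f z = \sum_(k < N) f k * z ^+ k + z ^+ N * ps_eval (fun n => f (N + n)%N) z.
Proof.
move=> fB z1; elim: N => [|N ->].
  by rewrite big_ord0 add0r expr0 mul1r; congr ps_eval; apply/funext.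
rewrite big_ord_recr /= (ps_evalS (bounded_back N fB) z1) addn0.
have -> : back (fun n => f (N + n)%N) = (fun n => f (N.+1 + n)%N).
  by apply/funext => n; rewrite /back addSnnS.
by rewrite exprS; ring.
Qed.

Lemma ps_evalD f g Bf Bg z : bounded_seq f Bf -> bounded_seq g Bg -> nrm z < 1 ->
  ps_eval (fun n => f n + g n) z = ps_eval f z + ps_eval g z.
Proof.
move=> fB gB z1; apply: ps_lim.
under eq_fun do under eq_bigr do rewrite mulrDl.
under eq_fun do rewrite big_split /=.
exact: cvgCD (ps_cvg fB z1) (ps_cvg gB z1).
Qed.

Lemma ps_evalZ f B a z : bounded_seq f B -> nrm z < 1 ->
  ps_eval (fun n => a * f n) z = a * ps_eval f z.
Proof.
move=> fB z1; apply: ps_lim.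
under eq_fun do under eq_bigr do rewrite -mulrA.
under eq_fun do rewrite -mulr_sumr.
exact: cvgCZ (ps_cvg fB z1).
Qed.

(* Near the origin [h_N(z) - h_N(0)] is small uniformly in [N]. *)
Lemma coef0_cvg (h : nat -> nat -> C) g B :
  (forall N, bounded_seq (h N) B) -> bounded_seq g B ->
  (forall z, 0 < nrm z < 1 -> (fun N => ps_eval (h N) z) @ \oo --> ps_eval g z) ->
  (fun N => h N 0%N) @ \oo --> g 0%N.
Proof.
move=> hB gB cv.
apply: cvgC_nrm; apply/cvgrPdist_lt => e e0.
have B0 := bounded_seq_ge0 gB.
(* At [|z| = t <= 1/2] each tail [z * ps_eval (back f) z] is at most [2 B t], and the two tails
   together may cost [e / 2]. *)
have [t /andP[t0 t1] ht] : exists2 t : R, 0 < t <= 1 / 2 & 4 * B * t <= e / 2.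
  have d0 : 0 < 8 * B + 2 * e by lra.
  exists (e / (8 * B + 2 * e)).
    by rewrite divr_gt0 //= ler_pdivrMr //; lra.
  rewrite mulrA ler_pdivrMr //; have : 0 <= e * e by rewrite mulr_ge0 // ltW.
  by lra.
have nt : nrm (toC t) = t by rewrite nrm_toC gtr0_norm.
have zt : 0 < nrm (toC t) < 1 by rewrite nt t0 /=; lra.
have z1 : nrm (toC t) < 1 by case/andP: zt.
have /cvgrPdist_lt := nrm_cvgC (cv _ zt).
have e20 : 0 < e / 2 by rewrite divr_gt0.
move=> /(_ _ e20); apply: filterS => N.
rewrite !sub0r !normrN !ger0_norm ?nrm_ge0 //.
rewrite (ps_evalS (hB N) z1) (ps_evalS gB z1) => hN.
have b1 f : bounded_seq f B -> nrm (toC t * ps_eval (back f) (toC t)) <= 2 * B * t.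
  move=> fB; rewrite nrmM nt mulrC ler_wpM2r ?(ltW t0) //.
  have fB' : bounded_seq (back f) B by move=> k; exact: fB.
  apply: le_trans (ps_bound fB' z1) _; rewrite nt.
  by rewrite ler_pdivrMr; [nra|lra].
have := nrmD (h N 0%N + toC t * ps_eval (back (h N)) (toC t) -
   (g 0%N + toC t * ps_eval (back g) (toC t)))
   (toC t * ps_eval (back g) (toC t) - toC t * ps_eval (back (h N)) (toC t)).
have -> : h N 0%N + toC t * ps_eval (back (h N)) (toC t) -
   (g 0%N + toC t * ps_eval (back g) (toC t)) +
   (toC t * ps_eval (back g) (toC t) - toC t * ps_eval (back (h N)) (toC t)) =
   h N 0%N - g 0%N by ring.
have := nrmB (toC t * ps_eval (back g) (toC t)) (toC t * ps_eval (back (h N)) (toC t)).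
by have := b1 _ gB; have := b1 _ (hB N); lra.
Qed.

(** Induction on [n], replacing each series [f] by [(f - f 0) / z]. The division by [z] is why
    convergence is assumed on the punctured disk. *)
Lemma coef_cvg (h : nat -> nat -> C) g B :
  (forall N, bounded_seq (h N) B) -> bounded_seq g B ->
  (forall z, 0 < nrm z < 1 -> (fun N => ps_eval (h N) z) @ \oo --> ps_eval g z) ->
  forall n, (fun N => h N n) @ \oo --> g n.
Proof.
move=> hB gB cv n; elim: n h g hB gB cv => [|n ih] h g hB gB cv.
  exact: coef0_cvg cv.
apply: (ih (fun N => back (h N)) (back g)) => [N k|k|z zz].
- exact: hB.
- exact: gB.
have /andP[z0 z1] := zz.
have zn0 : z != 0 by rewrite -nrm_gt0.
have c0 := coef0_cvg hB gB cv.
have backE f : bounded_seq f B -> ps_eval (back f) z = z^-1 * (ps_eval f z - f 0%N).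
  by move=> fB; rewrite (ps_evalS fB z1) addrC addKr mulKf.
under eq_fun do rewrite (backE _ (hB _)).
by rewrite (backE _ gB); apply: cvgCZ; exact: cvgCB (cv _ zz) c0.
Qed.
(** The identity theorem, as [coef_cvg] for a constant sequence of series. *)
Lemma ps_inj f g Bf Bg : bounded_seq f Bf -> bounded_seq g Bg ->
  (forall z, nrm z < 1 -> ps_eval f z = ps_eval g z) -> f = g.
Proof.
move=> fB gB fg; apply/funext => n; pose B := Bf + Bg.
have f0 := bounded_seq_ge0 fB; have g0 := bounded_seq_ge0 gB.
have fB' : bounded_seq f B by move=> k; apply: le_trans (fB k) _; rewrite /B; lra.
have gB' : bounded_seq g B by move=> k; apply: le_trans (gB k) _; rewrite /B; lra.
have := @coef_cvg (fun=> f) g B (fun=> fB') gB' _ n.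
move=> h; apply: (limC_unique (cvg_cst (f n))); apply: h => z /andP[_ z1].
by rewrite (fg z z1); exact: cvg_cst.
Qed.

(* The coefficients of [w |-> (f w - f z) / (w - z)]. *)
Definition diff_quot z f m := ps_eval (fun n => f (m + n).+1) z.

Lemma diff_quot_bounded f B z : bounded_seq f B -> nrm z < 1 ->
  bounded_seq (diff_quot z f) (B / (1 - nrm z)).
Proof. by move=> fB z1 m; apply: ps_bound => // n; exact: fB. Qed.

(** The coefficients [g] of the quotient satisfy [back f = g - z * back g]; summing this relation at
    [w] gives the claim. *)
Lemma diff_quotE f B z w : bounded_seq f B -> nrm z < 1 -> nrm w < 1 ->
  ps_eval f w = ps_eval f z + (w - z) * ps_eval (diff_quot z f) w.
Proof.
move=> fB z1 w1; have gB := diff_quot_bounded fB z1; set g := diff_quot z f in gB *.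
have bgB : bounded_seq (back g) (B / (1 - nrm z)) by move=> n; exact: gB.
have bB : bounded_seq (back f) B by move=> n; exact: fB.
have fE : back f = (fun m => g m + - z * back g m).
  apply/funext => m; rewrite /g /back /diff_quot.
  have mB : bounded_seq (fun n => f (m + n).+1) B by move=> n; exact: fB.
  rewrite (ps_evalS mB z1).
  have -> : back (fun n => f (m + n).+1) = (fun n => f (m.+1 + n).+1).
    by apply/funext => n; rewrite /back addSnnS.
  rewrite addn0 -/(diff_quot z f m.+1); ring.
have g0 : g 0%N = ps_eval (back f) z by [].
have zgB : bounded_seq (fun m => - z * back g m) (nrm z * (B / (1 - nrm z))).
  by move=> n; rewrite nrmM nrmN ler_wpM2l ?nrm_ge0.
rewrite (ps_evalS fB w1) (ps_evalS fB z1) -g0 fE (ps_evalD gB zgB w1).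
rewrite (ps_evalZ _ bgB w1).
have := ps_evalS gB w1; move: (ps_eval g w) (ps_eval (back g) w) => x y ->.
by ring.
Qed.

(** The Taylor coefficients at [z] come from iterating the difference quotient. The [n]-th iterate
    is bounded by [B / (1 - |z|)^n], so the remainder after [N] steps is a constant times
    [(|w - z| / (1 - |z|))^N]. *)
Lemma ps_analytic f B z : bounded_seq f B -> nrm z < 1 -> analytic_at (ps_eval f) z.
Proof.
move=> fB z1; set d := 1 - nrm z.
have d0 : 0 < d by rewrite /d subr_gt0.
exists (toC d); split; first by rewrite -toC0 toC_lt.
exists (fun n => ps_eval (iter n (diff_quot z) f) z) => w wz.
have {}wz : nrm (w - z) < d by move: wz; rewrite nrmE toC_lt.
have w1 : nrm w < 1.
  by have := nrmD (w - z) z; rewrite subrK /d in wz *; lra.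
have itB n : bounded_seq (iter n (diff_quot z) f) (B / d ^+ n).
  elim: n => [|n ih]; first by rewrite expr0 divr1.
  have := diff_quot_bounded ih z1; rewrite -/d exprSr invfM mulrA.
  by rewrite /=.
have e N : ps_eval f w = \sum_(n < N) ps_eval (iter n (diff_quot z) f) z * (w - z) ^+ n
    + (w - z) ^+ N * ps_eval (iter N (diff_quot z) f) w.
  elim: N => [|N ->]; first by rewrite big_ord0 add0r expr0 mul1r.
  rewrite big_ord_recr /= (diff_quotE (itB N) z1 w1) exprS.
  move: (ps_eval _ z) (ps_eval _ w) (\sum_(n < N) _) => x y s; ring.
apply: cvgC_nrm.
have h0 : (fun N => B / (1 - nrm w) * (nrm (w - z) / d) ^+ N) @ \oo --> (0 : R).
  rewrite -(mulr0 (B / (1 - nrm w))); apply: cvgMr; apply: cvg_geom.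
  by rewrite divr_ge0 ?nrm_ge0 ?(ltW d0) //= ltr_pdivrMr // mul1r.
apply: squeeze0 h0 => N; rewrite nrm_ge0 seriesE (e N) nrmC addrC addKr nrmM nrmX /=.
rewrite expr_div_n mulrC; apply: le_trans (ler_wpM2r _ (ps_bound (itB N) w1)) _.
  by rewrite exprn_ge0 ?nrm_ge0.
by rewrite le_eqVlt; apply/orP; left; apply/eqP; ring.
Qed.

Definition conv f g n := \sum_(i < n.+1) f i * g (n - i)%N.

(** The partial sum of the product runs over the triangle [i + j < N]. Completing the inner sum over
    [j < N - i] costs a constant times [|z|^N] for each [i], hence [N |z|^N] in all, which tends to
    0. *)
Lemma conv_cvg f g Bf Bg z : bounded_seq f Bf -> bounded_seq g Bg -> nrm z < 1 ->
  (fun N => \sum_(n < N) conv f g n * z ^+ n) @ \oo --> ps_eval f z * ps_eval g z.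
Proof.
move=> fB gB z1.
have f0 := bounded_seq_ge0 fB; have g0 := bounded_seq_ge0 gB.
have fin N : \sum_(n < N) conv f g n * z ^+ n =
   \sum_(i < N) f i * z ^+ i * \sum_(j < N - i) g j * z ^+ j.
  elim: N => [|N ih]; first by rewrite !big_ord0.
  rewrite big_ord_recr ih [RHS]big_ord_recr /= subSnn big_ord1 expr0 mulr1.
  rewrite /conv big_ord_recr /= subnn mulrDl addrA; congr (_ + _); last by ring.
  rewrite mulr_suml -big_split /=; apply: eq_bigr => i _.
  rewrite subSn; last exact: ltnW (ltn_ord i).
  rewrite big_ord_recr /= mulrDr; congr (_ + _).
  by rewrite -[in z ^+ N](subnKC (ltnW (ltn_ord i))) exprD; ring.
have h1 := cvgCM (ps_cvg fB z1) (@cvg_cstC _ (ps_eval g z)).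
have h2 : (fun N => \sum_(i < N) f i * z ^+ i * ps_eval g z - \sum_(n < N) conv f g n * z ^+ n)
   @ \oo --> (0 : C).
  apply: cvgC_nrm.
  have h0 : (fun N => Bf * (Bg / (1 - nrm z)) * (N%:R * nrm z ^+ N)) @ \oo --> (0 : R).
    rewrite -(mulr0 (Bf * (Bg / (1 - nrm z)))); apply: cvgMr; apply: cvg_mul_geom.
    by rewrite nrm_ge0.
  apply: squeeze0 h0 => N; rewrite nrm_ge0 subr0 /= fin -sumrB.
  apply: le_trans (nrm_sum _ _ _) _.
  apply: (@le_trans _ _ (\sum_(i < N) Bf * (Bg / (1 - nrm z)) * nrm z ^+ N)).
    apply: ler_sum => i _; rewrite (ps_eval_take (N - i) gB z1) -mulrBr addrC addKr.
    rewrite -[leRHS]mulrA !nrmM !nrmX -mulrA ler_pM ?mulr_ge0 ?nrm_ge0 ?exprn_ge0 ?nrm_ge0 //.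
    rewrite mulrA -exprD subnKC; last exact: ltnW (ltn_ord i).
    by rewrite mulrC ler_wpM2r ?exprn_ge0 ?nrm_ge0 // (ps_bound (bounded_back _ gB)).
  by rewrite sumr_const card_ord -[leLHS]mulr_natl [leLHS]mulrCA.
have := cvgCB h1 h2; rewrite subr0 => h3.
suff -> : (fun N => \sum_(n < N) conv f g n * z ^+ n) = (fun N =>
  (\sum_(n < N) f n * z ^+ n) * ps_eval g z -
  (\sum_(i < N) f i * z ^+ i * ps_eval g z - \sum_(n < N) conv f g n * z ^+ n)) by exact: h3.
by apply/funext => N; rewrite mulr_suml subKr.
Qed.
End PowerSeries.

(** * The Hardy space *)

Section InnerProduct.
Variables (R : realType) (V : lmodType (Cplx R)).
Local Notation C := (Cplx R).

(** Shared by three spaces: [H2], the columns over C, and the finite families of elements of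
    [H2]. *)
Record inner_product (dot : V -> V -> C) : Prop := InnerProduct {
  inner_linear : forall a u v w, dot (a *: u + v) w = a * dot u w + dot v w;
  inner_sym : forall u v, dot v u = (dot u v)^*;
  inner_ge0 : forall u, 0 <= dot u u }.

Variables (dot : V -> V -> C) (ip : inner_product dot).
Local Notation sqn u := (re (dot u u)).

Lemma inner0l u : dot 0 u = 0.
Proof.
have := inner_linear ip 1 0 0 u; rewrite scaler0 addr0 mul1r => /eqP.
by rewrite -subr_eq0 opprD addrA subrr sub0r oppr_eq0 => /eqP.
Qed.
Lemma innerDl u v w : dot (u + v) w = dot u w + dot v w.
Proof. by rewrite -[u]scale1r (inner_linear ip) mul1r scale1r. Qed.
Lemma innerZl a u w : dot (a *: u) w = a * dot u w.
Proof. by rewrite -[a *: u]addr0 (inner_linear ip) inner0l addr0. Qed.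
Lemma innerNl u w : dot (- u) w = - dot u w.
Proof. by rewrite -scaleN1r innerZl mulN1r. Qed.
Lemma innerBl u v w : dot (u - v) w = dot u w - dot v w.
Proof. by rewrite innerDl innerNl. Qed.
Lemma inner0r u : dot u 0 = 0.
Proof. by rewrite (inner_sym ip) inner0l conjC0. Qed.
Lemma innerDr u v w : dot w (u + v) = dot w u + dot w v.
Proof. by rewrite (inner_sym ip) innerDl rmorphD /= -!(inner_sym ip). Qed.
Lemma innerZr a u w : dot w (a *: u) = a^* * dot w u.
Proof. by rewrite (inner_sym ip) innerZl rmorphM /= -!(inner_sym ip). Qed.
Lemma innerNr u w : dot w (- u) = - dot w u.
Proof. by rewrite (inner_sym ip) innerNl rmorphN /= -(inner_sym ip). Qed.
Lemma innerBr u v w : dot w (u - v) = dot w u - dot w v.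
Proof. by rewrite innerDr innerNr. Qed.
Lemma inner_suml I (r : seq I) (P : pred I) (F : I -> V) w :
  dot (\sum_(i <- r | P i) F i) w = \sum_(i <- r | P i) dot (F i) w.
Proof. by apply: (big_morph (dot^~ w)) => [u v|]; [exact: innerDl|exact: inner0l]. Qed.
Lemma inner_sumr I (r : seq I) (P : pred I) (F : I -> V) w :
  dot w (\sum_(i <- r | P i) F i) = \sum_(i <- r | P i) dot w (F i).
Proof. by apply: (big_morph (dot w)) => [u v|]; [exact: innerDr|exact: inner0r]. Qed.

Lemma inner_sqn u : dot u u = toC (sqn u).
Proof. exact: ge0_toC (inner_ge0 ip u). Qed.
Lemma sqn_ge0 u : 0 <= sqn u.
Proof. by rewrite -toC_le toC0 -inner_sqn (inner_ge0 ip). Qed.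
Lemma sqnD u v : sqn (u + v) = sqn u + sqn v + 2 * re (dot u v).
Proof.
rewrite innerDl !innerDr !reD [dot v u](inner_sym ip) re_conj; ring.
Qed.
Lemma sqnZ a u : sqn (a *: u) = nrm a ^+ 2 * sqn u.
Proof. by rewrite innerZl innerZr mulrA mul_conj reM_toC. Qed.
Lemma sqnN u : sqn (- u) = sqn u.
Proof. by rewrite innerNl innerNr opprK. Qed.
End InnerProduct.

Section Hardy.
Variable R : realType.
Local Notation C := (Cplx R).
Implicit Types (z w : C) (f g : nat -> C).

Definition sq_summable f B := forall N, \sum_(n < N) nrm (f n) ^+ 2 <= B :> R.

Lemma sq_sum_mono f (m n : nat) : (m <= n)%N ->
  \sum_(i < m) nrm (f i) ^+ 2 <= \sum_(i < n) nrm (f i) ^+ 2 :> R.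
Proof.
elim: n => [|n ih]; first by rewrite leqn0 => /eqP->.
rewrite leq_eqVlt ltnS => /predU1P[->//|/ih].
by rewrite big_ord_recr /= => h; rewrite (le_trans h) // lerDl sqr_ge0.
Qed.

Lemma hardyP f : hardy f <-> exists B, sq_summable f B.
Proof.
have nE n : `|f n| ^+ 2 = toC (nrm (f n) ^+ 2) by rewrite nrmE toCX.
split=> [hf|[B hB]].
  have := cvg_re hf; set l := re _ => hl; exists l => N.
  have h : (fun n => \sum_(i < n) nrm (f i) ^+ 2) @ \oo --> l.
    suff -> : (fun n => \sum_(i < n) nrm (f i) ^+ 2) =
        (fun n => re (series (fun n => `|f n| ^+ 2) n)) by exact: hl.
    by apply/funext => n; rewrite seriesE re_sum; apply: eq_bigr => i _; rewrite nE.
  have ch : cvgn (fun n => \sum_(i < n) nrm (f i) ^+ 2 : R) by apply: cvgP h.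
  rewrite -(cvg_lim (@Rhausdorff R) h); apply: nondecreasing_cvgn_le => //.
  exact: sq_sum_mono.
apply: (@abs_cvg _ _ B) => N; apply: le_trans (hB N).
by apply: ler_sum => i _; rewrite nE nrm_toC ger0_norm ?sqr_ge0.
Qed.

Lemma hardy_submod : submod_closed (fun f => `[< hardy f >] : bool).
Proof.
split; first by apply/asboolP/hardyP; exists 0 => N; rewrite big1 // => i _; rewrite nrm0 expr0n.
move=> a f g /asboolP/hardyP[B hB] /asboolP/hardyP[D hD]; apply/asboolP/hardyP.
exists (2 * nrm a ^+ 2 * B + 2 * D) => N.
apply: (@le_trans _ _ (\sum_(n < N) (2 * nrm a ^+ 2 * nrm (f n) ^+ 2 + 2 * nrm (g n) ^+ 2))).
  apply: ler_sum => i _.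
  have -> : (a *: f + g) i = a * f i + g i by [].
  rewrite nrm_sqrD; have := re_mul_conj_le (a * f i) (g i).
  by rewrite nrmM exprMn; lra.
rewrite big_split /= -!mulr_sumr; apply: lerD; apply: ler_wpM2l.
- by rewrite mulr_ge0 ?sqr_ge0.
- exact: hB.
- by [].
- exact: hD.
Qed.

Definition hardy_pred : {pred (nat -> C)} := fun f => `[< hardy f >].
(** Bundled as a submodule of the sequences, so that linear combinations stay inside and the generic
    inner product lemmas apply to [dot]. *)
Record H2 := MkH2 { h2seq :> nat -> C; _ : h2seq \in hardy_pred }.
HB.instance Definition _ := [isSub for h2seq].
HB.instance Definition _ := [Choice of H2 by <:].
HB.instance Definition _ :=
  GRing.isSubmodClosed.Build C (nat -> C) hardy_pred hardy_submod.
HB.instance Definition _ := [SubChoice_isSubLmodule of H2 by <:].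

Implicit Types (u v : H2).

Lemma H2P u : hardy u.
Proof. exact/asboolP/(valP u). Qed.
Arguments H2P : clear implicits.

Definition toH2 f (hf : hardy f) : H2 := MkH2 (asboolT hf).

Lemma H2_eq u v : u =1 v -> u = v.
Proof. by move=> uv; apply/val_inj/funext. Qed.

Definition dot u v : C := hardy_dot u v.
Local Notation sqn u := (re (dot u u)).

Lemma dot_cvg u v : (fun N => \sum_(n < N) u n * (v n)^*) @ \oo --> dot u v.
Proof.
have /hardyP[B hB] := H2P u; have /hardyP[D hD] := H2P v.
suff h : cvgn (series (fun n => u n * (v n)^*)).
  suff -> : (fun N => \sum_(n < N) u n * (v n)^*) = series (fun n => u n * (v n)^*) by exact: h.
  by apply/funext => N; rewrite seriesE.
apply: (@abs_cvg _ _ (B + D)) => N; apply: le_trans (lerD (hB N) (hD N)).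
rewrite -big_split /=; apply: ler_sum => i _; rewrite nrmM nrm_conj.
by have := sqr_ge0 (nrm (u i) - nrm (v i)); have := nrm_ge0 (u i); have := nrm_ge0 (v i); nra.
Qed.
Arguments dot_cvg : clear implicits.

Lemma dot_lim u v l : (fun N => \sum_(n < N) u n * (v n)^*) @ \oo --> l -> dot u v = l.
Proof. exact: limC_unique (dot_cvg u v). Qed.

Lemma sqn_cvg u : (fun N => \sum_(n < N) nrm (u n) ^+ 2) @ \oo --> sqn u.
Proof.
have := cvg_re (dot_cvg u u) => h.
suff -> : (fun N => \sum_(n < N) nrm (u n) ^+ 2) = (fun N => re (\sum_(n < N) u n * (u n)^*)) by exact: h.
by apply/funext => N; rewrite re_sum; apply: eq_bigr => i _; rewrite mul_conj.
Qed.
Arguments sqn_cvg : clear implicits.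

Lemma sqn_summable u : sq_summable u (sqn u).
Proof.
move=> N; rewrite -(cvg_lim (@Rhausdorff R) (sqn_cvg u)); apply: nondecreasing_cvgn_le => //.
  exact: sq_sum_mono.
by apply: cvgP (sqn_cvg u).
Qed.

Lemma H2_inner : inner_product dot.
Proof.
split=> [a u v w|u v|u].
- apply: dot_lim.
  have := cvgCD (cvgCZ (a := a) (dot_cvg u w)) (dot_cvg v w) => h.
  suff -> : (fun N => \sum_(n < N) (a *: u + v) n * (w n)^*) =
    (fun N => a * (\sum_(n < N) u n * (w n)^*) + \sum_(n < N) v n * (w n)^*) by exact: h.
  apply/funext => N; rewrite mulr_sumr -big_split /=; apply: eq_bigr => i _.
  by rewrite mulrDl mulrA.
- apply: dot_lim.
  have := cvg_conj (dot_cvg u v) => h.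
  suff -> : (fun N => \sum_(n < N) v n * (u n)^*) =
     (fun N => (\sum_(n < N) u n * (v n)^*)^*) by exact: h.
  apply/funext => N; rewrite rmorph_sum /=; apply: eq_bigr => i _.
  by rewrite rmorphM /= conjCK mulrC.
- have e : (fun N => \sum_(n < N) u n * (u n)^*) = (fun N => toC (\sum_(n < N) nrm (u n) ^+ 2)).
    by apply/funext => N; rewrite toC_sum; apply: eq_bigr => i _; rewrite mul_conj.
  have -> : dot u u = toC (sqn u).
    apply: dot_lim; rewrite e; apply: cvgC_nrm.
    have := cvg_distR (sqn_cvg u) => h.
    suff -> : (fun n => nrm (toC (\sum_(n0 < n) nrm (u n0) ^+ 2) - toC (sqn u))) =
      (fun n => `|\sum_(n0 < n) nrm (u n0) ^+ 2 - sqn u|) by exact: h.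
    by apply/funext => n; rewrite -toCN -toCD nrm_toC.
  rewrite -toC0 toC_le; apply: le_trans (sqn_summable u 0); by rewrite big_ord0.
Qed.

Lemma nrm_coef_le u n : nrm (u n) ^+ 2 <= sqn u.
Proof.
apply: le_trans (sqn_summable u n.+1).
by rewrite big_ord_recr /= lerDr sumr_ge0 // => i _; rewrite sqr_ge0.
Qed.

(** From [t <= 1 + t^2], which spares a square root. *)
Lemma H2_bounded u : bounded_seq u (1 + sqn u).
Proof.
move=> n; have := nrm_coef_le u n; have := sqr_ge0 (nrm (u n) - 1).
by have := nrm_ge0 (u n); nra.
Qed.

Definition ev u z : C := ps_eval u z.

Lemma evD u v z : nrm z < 1 -> ev (u + v) z = ev u z + ev v z.
Proof. by move=> z1; apply: (ps_evalD (H2_bounded u) (H2_bounded v) z1). Qed.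
Lemma evZ a u z : nrm z < 1 -> ev (a *: u) z = a * ev u z.
Proof. by move=> z1; apply: (ps_evalZ a (H2_bounded u) z1). Qed.
Lemma evB u v z : nrm z < 1 -> ev (u - v) z = ev u z - ev v z.
Proof. by move=> z1; rewrite -scaleN1r evD // evZ // mulN1r. Qed.
Lemma ev0 z : nrm z < 1 -> ev 0 z = 0.
Proof. by move=> z1; have := evZ 0 0 z1; rewrite scale0r mul0r. Qed.
Lemma ev_sum I (r : seq I) (P : pred I) (F : I -> H2) z : nrm z < 1 ->
  ev (\sum_(i <- r | P i) F i) z = \sum_(i <- r | P i) ev (F i) z.
Proof.
move=> z1; apply: (big_morph (ev^~ z)) => [u v|]; [exact: evD|exact: ev0].
Qed.
Lemma ev_inj u v : (forall z, nrm z < 1 -> ev u z = ev v z) -> u = v.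
Proof.
by move=> h; apply/val_inj; apply: (ps_inj (H2_bounded u) (H2_bounded v)).
Qed.
End Hardy.
Arguments H2P {R} u.
Arguments dot_cvg {R} u v.
Arguments sqn_cvg {R} u.

(** * Multiplication by a finite Blaschke product *)

Section Operators.
Variable R : realType.
Local Notation C := (Cplx R).
Local Notation H2 := (H2 R).
Local Notation sqn u := (re (dot u u)).
Implicit Types (a z w : C) (f g : nat -> C) (u v : H2).

Lemma summable_hardy f B : sq_summable f B -> hardy f.
Proof. by move=> h; apply/hardyP; exists B. Qed.

Definition shift_seq f n := if n is m.+1 then f m else 0.

Lemma shift_summable f B : sq_summable f B -> sq_summable (shift_seq f) B.
Proof.
move=> h [|N]; first by rewrite big_ord0; have := h 0%N; rewrite big_ord0.
rewrite big_ord_recl /= nrm0 expr0n /= add0r; exact: h.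
Qed.

Lemma back_sum f N : \sum_(n < N.+1) nrm (f n) ^+ 2 =
  nrm (f 0%N) ^+ 2 + \sum_(n < N) nrm (back f n) ^+ 2 :> R.
Proof. by rewrite big_ord_recl. Qed.

Lemma back_summable f B : sq_summable f B -> sq_summable (back f) B.
Proof.
by move=> h N; apply: le_trans (h N.+1); rewrite back_sum lerDr sqr_ge0.
Qed.

Definition shiftH u : H2 := toH2 (summable_hardy (shift_summable (sqn_summable u))).
Definition backH u : H2 := toH2 (summable_hardy (back_summable (sqn_summable u))).

Lemma backHD a u v : backH (a *: u + v) = a *: backH u + backH v.
Proof. exact: H2_eq. Qed.

Lemma dot_shift u v : dot (shiftH u) (shiftH v) = dot u v.
Proof.
have h := dot_cvg (shiftH u) (shiftH v).
rewrite -(cvg_shiftS (fun N => \sum_(n < N) shiftH u n * (shiftH v n)^*)) in h.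
apply: limC_unique h _.
suff -> : (fun n => \sum_(n0 < n.+1) shiftH u n0 * (shiftH v n0)^*) =
  (fun N => \sum_(n < N) u n * (v n)^*) by exact: dot_cvg u v.
by apply/funext => n; rewrite big_ord_recl /= mul0r add0r.
Qed.

Lemma sqn_back u : sqn u = nrm (u 0%N) ^+ 2 + sqn (backH u).
Proof.
have h := sqn_cvg u.
rewrite -(cvg_shiftS (fun N => \sum_(n < N) nrm (u n) ^+ 2)) in h.
have h2 : (fun N => nrm (u 0%N) ^+ 2 + \sum_(n < N) nrm (backH u n) ^+ 2) @ \oo -->
  nrm (u 0%N) ^+ 2 + sqn (backH u).
  by apply: cvgD; [exact: cvg_cst|exact: sqn_cvg].
apply: (@cvg_unique _ (@Rhausdorff R) _ _ _ _ h).
suff -> : (fun n => \sum_(n0 < n.+1) nrm (u n0) ^+ 2) =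
  (fun N => nrm (u 0%N) ^+ 2 + \sum_(n < N) nrm (backH u n) ^+ 2) by exact: h2.
by apply/funext => n; rewrite back_sum.
Qed.

Lemma ev_shift u z : nrm z < 1 -> ev (shiftH u) z = z * ev u z.
Proof.
move=> z1; rewrite /ev (ps_evalS (H2_bounded (shiftH u)) z1) add0r.
by congr (_ * ps_eval _ _); apply/funext.
Qed.

(** Weight [(1 + |a|) / 2] in [nrm_convex]: [|a|^2] divided by it is at most [|a|]. The factor in
    front of [|x|^2] stays below 1, so sums of such terms can be absorbed on the other side. *)
Lemma nrm_sqr_contract a x y : nrm a < 1 ->
  nrm (a * x + y) ^+ 2 <= nrm a * nrm x ^+ 2 + 2 / (1 - nrm a) * nrm y ^+ 2.
Proof.
move=> a1; have a0 := nrm_ge0 a; set t := nrm a in a0 a1 *.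
have s : 0 < (1 + t) / 2 < 1 by apply/andP; split; lra.
apply: le_trans (nrm_convex _ _ s) _; rewrite nrmM -/t.
have -> : 1 - (1 + t) / 2 = (1 - t) / 2 by lra.
apply: lerD; last by rewrite invf_div mulrC.
rewrite ler_pdivrMr; last by lra.
have := sqr_ge0 (nrm x); rewrite exprMn; move: (nrm x ^+ 2) => X X0.
have : 0 <= t * (1 - t) * X by rewrite !mulr_ge0 //; lra.
by lra.
Qed.

(** Coefficients of [f(z) / (1 - a z)]. *)
Fixpoint resolvent_seq a f n := f n + (if n is m.+1 then a * resolvent_seq a f m else 0).

(** The sequence satisfies [u = a S u + f] with [S] the shift, which does not increase partial sums
    of squares. Hence [U <= |a| U + 2 / (1 - |a|) F] for the finite sums [U] and [F], and the first
    term is absorbed. *)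
Lemma resolvent_summable a f B : nrm a < 1 -> sq_summable f B ->
  sq_summable (resolvent_seq a f) (2 / (1 - nrm a) / (1 - nrm a) * B).
Proof.
move=> a1 fB; have a0 := nrm_ge0 a; set u := resolvent_seq a f.
have d0 : 0 < 1 - nrm a by rewrite subr_gt0.
have uE n : u n = a * shift_seq u n + f n by rewrite addrC; case: n => [|n] //=; rewrite mulr0.
move=> N.
have h : \sum_(n < N) nrm (u n) ^+ 2 <= nrm a * (\sum_(n < N) nrm (shift_seq u n) ^+ 2)
    + 2 / (1 - nrm a) * \sum_(n < N) nrm (f n) ^+ 2.
  rewrite !mulr_sumr -big_split /=; apply: ler_sum => i _.
  by rewrite [u i]uE; apply: nrm_sqr_contract.
have hs : \sum_(n < N) nrm (shift_seq u n) ^+ 2 <= \sum_(n < N) nrm (u n) ^+ 2.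
  case: (N) => [|M]; first by rewrite !big_ord0.
  rewrite big_ord_recl /= nrm0 expr0n add0r /=; exact: sq_sum_mono.
have := ler_wpM2l a0 hs; have k0 : 0 <= 2 / (1 - nrm a) by rewrite divr_ge0 // ltW.
have := ler_wpM2l k0 (fB N).
move: (\sum_(n < N) nrm (u n) ^+ 2) (\sum_(n < N) nrm (f n) ^+ 2) h => U F h h1 h2.
rewrite mulrAC ler_pdivlMr //; lra.
Qed.

Definition resolventH a u (a1 : nrm a < 1) : H2 :=
  toH2 (summable_hardy (resolvent_summable a1 (sqn_summable u))).

Lemma resolventHE a u (a1 : nrm a < 1) :
  u = resolventH u a1 - a *: shiftH (resolventH u a1).
Proof.
apply: H2_eq => -[|n].
  rewrite [RHS](_ : _ = resolvent_seq a u 0 - a * 0) //= ; by rewrite mulr0 subr0 addr0.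
rewrite [RHS](_ : _ = resolvent_seq a u n.+1 - a * resolvent_seq a u n) //=.
by rewrite addrK.
Qed.

(** Here the recursion [v n = a v n.+1 + f n.+1] looks forward, so a partial sum of [back v]
    contains one extra term [v N]. The uniform bound [D] on [v] controls it before the
    absorption. *)
Lemma diff_quot_summable a f B : nrm a < 1 -> sq_summable f B ->
  exists D, sq_summable (diff_quot a f) D.
Proof.
move=> a1 fB; have a0 := nrm_ge0 a; set v := diff_quot a f.
have d0 : 0 < 1 - nrm a by rewrite subr_gt0.
have fb : bounded_seq f (1 + B).
  move=> n; have : nrm (f n) ^+ 2 <= B.
    apply: le_trans (fB n.+1); rewrite big_ord_recr /= lerDr.
    by apply: sumr_ge0 => i _; exact: sqr_ge0.
  by have := sqr_ge0 (nrm (f n) - 1); have := nrm_ge0 (f n); nra.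
have vE n : v n = a * back v n + back f n.
  rewrite addrC /v /diff_quot /back.
  have mB : bounded_seq (fun m => f (n + m).+1) (1 + B) by move=> m; exact: fb.
  have -> : (fun m => f (n.+1 + m).+1) = back (fun m => f (n + m).+1).
    by apply/funext => m; rewrite /back addSnnS.
  by rewrite (ps_evalS mB a1) addn0.
set D := (1 + B) / (1 - nrm a).
have vb : bounded_seq v D by apply: diff_quot_bounded.
exists ((nrm a * D ^+ 2 + 2 / (1 - nrm a) * B) / (1 - nrm a)) => N.
have h : \sum_(n < N) nrm (v n) ^+ 2 <= nrm a * (\sum_(n < N) nrm (back v n) ^+ 2)
    + 2 / (1 - nrm a) * \sum_(n < N) nrm (back f n) ^+ 2.
  rewrite !mulr_sumr -big_split /=; apply: ler_sum => i _.
  by rewrite [v i]vE; apply: nrm_sqr_contract.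
have hs : \sum_(n < N) nrm (back v n) ^+ 2 <= \sum_(n < N) nrm (v n) ^+ 2 + D ^+ 2.
  have := back_sum v N; rewrite big_ord_recr /=.
  have : nrm (v N) ^+ 2 <= D ^+ 2.
    by rewrite ler_pXn2r ?nnegrE ?nrm_ge0 ?(bounded_seq_ge0 vb).
  by have := sqr_ge0 (nrm (v 0%N)); lra.
have k0 : 0 <= 2 / (1 - nrm a) by rewrite divr_ge0 // ltW.
have := ler_wpM2l a0 hs; have := ler_wpM2l k0 (back_summable fB N).
move: (\sum_(n < N) nrm (v n) ^+ 2) (\sum_(n < N) nrm (back f n) ^+ 2) h => U F h h1 h2.
rewrite ler_pdivlMr //; lra.
Qed.

Lemma ev_divide u a : nrm a < 1 ->
  exists v, forall z, nrm z < 1 -> ev u z = ev u a + (z - a) * ev v z.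
Proof.
move=> a1; have [D hD] := diff_quot_summable a1 (sqn_summable u).
exists (toH2 (summable_hardy hD)) => z z1.
exact: diff_quotE (H2_bounded u) a1 z1.
Qed.

(* The last clause is the splitting of [H2] into [b H2] and its orthogonal
   complement, obtained by hand so that no projection theorem is needed. *)
Definition inner_multiplier (b : C -> C) (T : H2 -> H2) :=
  [/\ forall u z, nrm z < 1 -> ev (T u) z = b z * ev u z,
      forall u v, dot (T u) (T v) = dot u v &
      forall u, exists t v, u = t + T v /\ forall x, dot t (T x) = 0].

(** Elements of [H2] are determined by their values, so the first clause already yields
    linearity. *)
Lemma inner_multiplier_linear b T : inner_multiplier b T ->
  forall a u v, T (a *: u + v) = a *: T u + T v.
Proof.
move=> [h _ _] a u v; apply: ev_inj => z z1.
by rewrite evD // evZ // !h // evD // evZ // mulrDr mulrCA.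
Qed.

Lemma inner_multiplier_cst c : nrm c = 1 -> inner_multiplier (fun=> c) (fun u => c *: u).
Proof.
move=> c1; have cc : c * c^* = 1 by rewrite mul_conj c1 expr1n.
split=> [u z z1|u v|u]; first exact: evZ.
  by rewrite (innerZl (H2_inner R)) (innerZr (H2_inner R)) mulrA cc mul1r.
exists 0, (c^* *: u); split; first by rewrite scalerA cc scale1r add0r.
by move=> w; rewrite (inner0l (H2_inner R)).
Qed.

(** Splitting along [T1], then the quotient along [T2], gives [t1 + T1 t2] as the component
    orthogonal to the range of [T1 \o T2]. *)
Lemma inner_multiplier_comp b1 b2 T1 T2 : inner_multiplier b1 T1 -> inner_multiplier b2 T2 ->
  inner_multiplier (fun z => b1 z * b2 z) (T1 \o T2).
Proof.
move=> h1 h2; have lin1 := inner_multiplier_linear h1.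
case: h1 h2 => [e1 i1 d1] [e2 i2 d2]; split=> [u z z1|u v|u] /=.
- by rewrite e1 // e2 // mulrA.
- by rewrite i1 i2.
have [t1 [v1 [-> o1]]] := d1 u; have [t2 [v2 [-> o2]]] := d2 v1.
exists (t1 + T1 t2), v2; split.
  by rewrite -addrA -[T1 t2 in RHS]scale1r -lin1 scale1r.
by move=> w; rewrite (innerDl (H2_inner R)) o1 i1 o2 addr0.
Qed.

Definition blaschke_factor a z : C := (z - a) / (1 - z * a^*).

Lemma blaschke_den_neq0 a z : nrm a < 1 -> nrm z < 1 -> 1 - z * a^* != 0.
Proof.
move=> a1 z1; rewrite subr_eq0; apply/eqP => h.
have : nrm (z * a^*) < 1.
  rewrite nrmM nrm_conj; have := nrm_ge0 a; have := nrm_ge0 z; nra.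
by rewrite -h nrm1 ltxx.
Qed.

(* [<(S - a) u, (S - a) v> = <(1 - a^* S) u, (1 - a^* S) v>] because the
   shift [S] is isometric. *)
Lemma inner_multiplier_blaschke a : nrm a < 1 ->
  exists T, inner_multiplier (blaschke_factor a) T.
Proof.
move=> a1; have ac1 : nrm a^* < 1 by rewrite nrm_conj.
have ip := H2_inner R.
pose T u := shiftH (resolventH u ac1) - a *: resolventH u ac1; exists T.
have evT u z : nrm z < 1 -> ev (T u) z = blaschke_factor a z * ev u z.
  move=> z1; rewrite [in RHS](resolventHE u ac1) /T; set r := resolventH u ac1.
  rewrite !evB // !evZ // !ev_shift // /blaschke_factor.
  have := blaschke_den_neq0 a1 z1; move: (ev r z) => x.
  by move=> h; field; exact: h.
have isoT u v : dot (T u) (T v) = dot u v.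
  rewrite [in RHS](resolventHE u ac1) [in RHS](resolventHE v ac1) /T.
  move: (resolventH u ac1) (resolventH v ac1) => r s.
  rewrite !(innerBl ip) !(innerBr ip) !(innerZl ip) !(innerZr ip) !dot_shift conjCK.
  by ring.
split=> // u.
(* [delta] is the constant function 1 and [k] the reproducing (Szego) kernel [1 / (1 - a^* z)] at
   [a]. *)
have d1 : sq_summable (fun n => (n == 0%N)%:R : C) 1.
  case=> [|N]; first by rewrite big_ord0.
  by rewrite big_ord_recl /= nrm1 expr1n big1 ?addr0 // => i _; rewrite nrm0 expr0n.
pose delta := toH2 (summable_hardy d1); pose k := resolventH delta ac1.
have kE n : k n = (a^*) ^+ n.
  elim: n => [|n ih]; first by rewrite /k /= addr0.
  by rewrite /k /= add0r -/(k n) exprS -ih.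
have evk x : dot x k = ev x a.
  apply: dot_lim; have := ps_cvg (H2_bounded x) a1 => h.
  suff -> : (fun N => \sum_(n < N) x n * (k n)^*) = (fun N => \sum_(n < N) x n * a ^+ n) by exact: h.
  by apply/funext => N; apply: eq_bigr => i _; rewrite kE rmorphXn /= conjCK.
have kev z : nrm z < 1 -> ev k z * (1 - z * a^*) = 1.
  move=> z1; have := congr1 (fun x => ev x z) (resolventHE delta ac1) => /=.
  rewrite -/k evB // evZ // ev_shift //.
  have -> : ev delta z = 1.
    rewrite /ev (ps_evalS (H2_bounded delta) z1) [X in _ * X](_ : _ = 0) ?mulr0 ?addr0 //.
    by apply: ps_lim; apply: cvg_near_cst; apply: nearW => N; rewrite big1 // => i _; rewrite mul0r.
  by move=> e; rewrite [RHS]e; ring.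
(* Since [k(a) = 1 / (1 - |a|^2)], this multiple of [k] takes the same value as [u] at [a]; then
   [u - t] is divisible by [z - a]. The sigma type keeps [t] opaque. *)
have [t tE] : {t | t = (ev u a * (1 - a * a^*)) *: k} by exists ((ev u a * (1 - a * a^*)) *: k).
have [g hg] := ev_divide (u - t) a1.
have ta : ev (u - t) a = 0.
  by rewrite evB // tE evZ // -mulrA [_ * ev k a]mulrC kev // mulr1 subrr.
(* [(z - a) g] is the Blaschke factor times [(1 - a^* z) g]. *)
exists t, (g - a^* *: shiftH g); split.
  apply: ev_inj => z z1; rewrite evD // evT // evB // evZ // ev_shift //.
  have := hg z z1; rewrite ta add0r evB // => /eqP; rewrite subr_eq addrC => /eqP ->.
  rewrite /blaschke_factor; have h := blaschke_den_neq0 a1 z1.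
  by move: (ev t z) (ev g z) => x y; field; exact: h.
move=> x; rewrite tE (innerZl ip) (inner_sym ip) evk evT // /blaschke_factor subrr.
by rewrite !mul0r conjC0 mulr0.
Qed.

(** [|1 - z a^*|^2 - |z - a|^2 = (1 - |z|^2) (1 - |a|^2)]. *)
Lemma nrm_blaschke_factor a z : nrm a < 1 -> nrm z < 1 -> nrm (blaschke_factor a z) < 1.
Proof.
move=> a1 z1; have d0 := blaschke_den_neq0 a1 z1.
rewrite nrmM nrmV ltr_pdivrMr ?nrm_gt0 // mul1r.
rewrite -(@ltr_pXn2r _ 2) ?nnegrE ?nrm_ge0 // !nrm_sqrD !nrmN nrm1 nrmM nrm_conj.
rewrite mul1r re_conj rmorphN mulrN !reN expr1n exprMn.
have za : nrm z ^+ 2 < 1 by rewrite exprn_ilt1 ?nrm_ge0.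
have aa : nrm a ^+ 2 < 1 by rewrite exprn_ilt1 ?nrm_ge0.
move: (nrm z ^+ 2) (nrm a ^+ 2) za aa => x y x1 y1.
have : 0 < (1 - x) * (1 - y) by rewrite mulr_gt0 // subr_gt0.
lra.
Qed.

Lemma inner_multiplier_blaschke_prod c (s : seq C) : nrm c = 1 -> (forall a, a \in s -> nrm a < 1) ->
  exists T, inner_multiplier (fun z => c * \prod_(a <- s) blaschke_factor a z) T.
Proof.
move=> c1; elim: s => [|a s ih] hs.
  have h := inner_multiplier_cst c1; exists (fun u => c *: u).
  suff -> : (fun z => c * \prod_(a <- [::]) blaschke_factor a z) = (fun=> c) by [].
  by apply/funext => z; rewrite big_nil mulr1.
have [T2 h2] : exists T, inner_multiplier (fun z => c * \prod_(a <- s) blaschke_factor a z) T.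
  by apply: ih => x xs; apply: hs; rewrite inE xs orbT.
have [T1 h1] := inner_multiplier_blaschke (hs a (mem_head _ _)).
exists (T1 \o T2); have := inner_multiplier_comp h1 h2.
suff -> : (fun z => c * \prod_(x <- a :: s) blaschke_factor x z) =
  (fun z => blaschke_factor a z * (c * \prod_(x <- s) blaschke_factor x z)) by [].
by apply/funext => z; rewrite big_cons mulrCA.
Qed.

Lemma nrm_blaschke_prod c (s : seq C) z : nrm c = 1 -> (forall a, a \in s -> nrm a < 1) ->
  (0 < size s)%N -> nrm z < 1 -> nrm (c * \prod_(a <- s) blaschke_factor a z) < 1.
Proof.
move=> c1 hs s0 z1; rewrite nrmM c1 mul1r.
elim: s hs s0 => // a s ih hs _; rewrite big_cons nrmM.
have h1 := nrm_blaschke_factor (hs a (mem_head _ _)) z1.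
have h2 : nrm (\prod_(x <- s) blaschke_factor x z) <= 1.
  case: s ih hs => [|b s] ih hs; first by rewrite big_nil nrm1.
  by apply/ltW/ih => // x xs; apply: hs; rewrite inE xs orbT.
have := nrm_ge0 (blaschke_factor a z).
have := nrm_ge0 (\prod_(x <- s) blaschke_factor x z); nra.
Qed.

Lemma inner_multiplier_ext b1 b2 T : (forall z, nrm z < 1 -> b1 z = b2 z) ->
  inner_multiplier b1 T -> inner_multiplier b2 T.
Proof. by move=> e [h1 h2 h3]; split=> // u z z1; rewrite -e // h1. Qed.

(** The strict bound [|b(z)| < 1], which needs at least one factor, makes power series in [b(z)]
    converge. *)
Lemma finite_blaschke_multiplier M b : (0 < M)%N -> finite_blaschke M b ->
  (exists T, inner_multiplier b T) /\ forall z, nrm z < 1 -> nrm (b z) < 1.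
Proof.
move=> M0 [c [a [c1 a1 bE]]].
have {}c1 : nrm c = 1 by apply: toC_inj; rewrite -nrmE c1.
pose s := [seq a l | l <- enum 'I_M].
have hs x : x \in s -> nrm x < 1.
  by move=> /mapP[l _ ->]; have := a1 l; rewrite /unit_disk /= nrm_lt1.
have eb z : nrm z < 1 -> c * \prod_(x <- s) blaschke_factor x z = b z.
  by rewrite -nrm_lt1 => /bE ->; rewrite big_map big_enum.
split.
  have [T hT] := inner_multiplier_blaschke_prod c1 hs.
  by exists T; apply: inner_multiplier_ext hT.
move=> z z1; rewrite -eb //; apply: nrm_blaschke_prod => //.
by rewrite size_map size_enum_ord.
Qed.

End Operators.

(** * Expansion along the model space *)

Lemma le_sum_one (R : numDomainType) (I : finType) (F : I -> R) i :
  (forall j, 0 <= F j) -> F i <= \sum_j F j.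
Proof. by move=> F0; rewrite (bigD1 i) //= lerDl sumr_ge0. Qed.

Section ModelSpace.
Variable R : realType.
Local Notation C := (Cplx R).
Local Notation H2 := (H2 R).
Local Notation sqn u := (re (dot u u)).
Variables (M : nat) (b : C -> C) (T : H2 -> H2) (e : 'I_M -> H2).
Hypothesis bT : inner_multiplier b T.
Hypothesis b1 : forall z, nrm z < 1 -> nrm (b z) < 1.
Hypothesis e_orth : forall j u, dot (e j) (T u) = 0.
Hypothesis e_on : forall i j, dot (e i) (e j) = (i == j)%:R.
Hypothesis e_span : forall u, exists v, u = \sum_j dot u (e j) *: e j + T v.
Implicit Types (u v : H2) (z : C).

Definition orbit_basis j n : H2 := iter n T (e j).

(** Pythagoras: the [e j] are orthonormal and orthogonal to the range of the isometry [T], so they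
    span a wandering subspace. *)
Lemma sqn_wandering (c : 'I_M -> C) u :
  sqn (\sum_j c j *: e j + T u) = \sum_j nrm (c j) ^+ 2 + sqn u.
Proof.
have ip := H2_inner R; rewrite (sqnD ip) (inner_suml ip).
have [_ -> _] := bT.
rewrite [X in 2 * re X](inner_suml ip) [X in 2 * re X]big1 => [|j _]; last first.
  by rewrite (innerZl ip) e_orth mulr0.
rewrite re0 mulr0 addr0 re_sum; congr (_ + _); apply: eq_bigr => j _.
rewrite (innerZl ip) (inner_sumr ip) (bigD1 j) //= big1 => [|i ij]; last first.
  by rewrite (innerZr ip) e_on eq_sym (negbTE ij) mulr0.
by rewrite (innerZr ip) e_on eqxx mulr1 addr0 mul_conj.
Qed.

(** Both claims iterate one step [u = sum_j <u, e_j> e_j + T u1]: the coefficients of [u] at [n.+1]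
    are those of [u1] at [n], and norms split exactly. The remainder [v] thus stays bounded by
    [u]. *)
Lemma bessel_orbit u N :
  \sum_(n < N) \sum_j nrm (dot u (orbit_basis j n)) ^+ 2 <= sqn u /\
  exists2 v, sqn v <= sqn u & forall z, nrm z < 1 -> ev u z =
    \sum_(n < N) b z ^+ n * (\sum_j dot u (orbit_basis j n) * ev (e j) z) + b z ^+ N * ev v z.
Proof.
have ip := H2_inner R; have [bev bdot _] := bT.
elim: N u => [|N ih] u.
  split; first by rewrite big_ord0 (sqn_ge0 ip).
  by exists u => // z z1; rewrite big_ord0 add0r mul1r.
have [u1 uE] := e_span u.
have dE j n : dot u (orbit_basis j n.+1) = dot u1 (orbit_basis j n).
  rewrite /orbit_basis iterS uE (innerDl ip) bdot (inner_suml ip) big1 ?add0r // => i _.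
  by rewrite (innerZl ip) e_orth mulr0.
have nE : sqn u = \sum_j nrm (dot u (e j)) ^+ 2 + sqn u1 by rewrite {1 2}uE sqn_wandering.
have [h1 [v h2 h3]] := ih u1.
split.
  rewrite big_ord_recl nE lerD //; apply: le_trans h1.
  by apply: ler_sum => n _; apply: ler_sum => j _; rewrite dE.
exists v => [|z z1].
  by rewrite nE (le_trans h2) // lerDr sumr_ge0 // => j _; rewrite sqr_ge0.
rewrite {1}uE evD // bev // ev_sum // h3 // big_ord_recl expr0 mul1r -addrA; congr (_ + _).
  by apply: eq_bigr => j _; rewrite evZ.
rewrite mulrDr mulr_sumr; congr (_ + _); last by rewrite exprS mulrA.
apply: eq_bigr => n _; rewrite exprS mulrA; congr (_ * _).
by apply: eq_bigr => j _; rewrite dE.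
Qed.

Lemma orbit_coef_bounded u j : bounded_seq (fun n => dot u (orbit_basis j n)) (1 + sqn u).
Proof.
move=> n; have [h _] := bessel_orbit u n.+1.
have : nrm (dot u (orbit_basis j n)) ^+ 2 <= sqn u.
  apply: (@le_trans _ _ (\sum_j nrm (dot u (orbit_basis j n)) ^+ 2)).
    by apply: (le_sum_one (F := fun j => nrm (dot u (orbit_basis j n)) ^+ 2)) => i; exact: sqr_ge0.
  apply: le_trans h; rewrite big_ord_recr /= lerDr.
  by apply: sumr_ge0 => i _; apply: sumr_ge0 => l _; exact: sqr_ge0.
have := sqr_ge0 (nrm (dot u (orbit_basis j n)) - 1).
by have := nrm_ge0 (dot u (orbit_basis j n)); nra.
Qed.

(** Norms of the remainders [b^N v] need not be shown to vanish: at a fixed [z] the factor [b(z)^N]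
    does, while [v(z)] is bounded uniformly in [N]. *)
Lemma orbit_expansion u z : nrm z < 1 ->
  ev u z = \sum_j ev (e j) z * ps_eval (fun n => dot u (orbit_basis j n)) (b z).
Proof.
move=> z1; have bz1 := b1 z1.
pose s N := \sum_(n < N) b z ^+ n * (\sum_j dot u (orbit_basis j n) * ev (e j) z).
have h1 : s @ \oo --> \sum_j ev (e j) z * ps_eval (fun n => dot u (orbit_basis j n)) (b z).
  have := cvg_sum (r := index_enum 'I_M) (fun j =>
    cvgCZ (a := ev (e j) z) (ps_cvg (orbit_coef_bounded u j) bz1)) => h.
  suff -> : s = (fun n => \sum_j ev (e j) z *
    \sum_(n0 < n) dot u (orbit_basis j n0) * b z ^+ n0) by exact: h.
  apply/funext => N; rewrite /s; under eq_bigr do rewrite mulr_sumr.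
  rewrite exchange_big /=; apply: eq_bigr => j _; rewrite mulr_sumr.
  by apply: eq_bigr => n _; ring.
apply: limC_unique _ h1; apply: cvgC_nrm.
have h0 : (fun N => (1 + sqn u) / (1 - nrm z) * nrm (b z) ^+ N) @ \oo --> (0 : R).
  rewrite -(mulr0 ((1 + sqn u) / (1 - nrm z))); apply: cvgMr; apply: cvg_geom.
  by rewrite nrm_ge0.
apply: squeeze0 h0 => N; rewrite nrm_ge0 /=.
have [_ [v vu ->]] := bessel_orbit u N => //; rewrite -/(s N) nrmC addrC addKr.
rewrite nrmM nrmX mulrC ler_wpM2r ?exprn_ge0 ?nrm_ge0 //.
apply: le_trans (ps_bound (H2_bounded v) z1) _.
by rewrite ler_wpM2r ?lerD2l // invr_ge0 subr_ge0 ltW.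
Qed.

(** Horner's scheme in [T]: the combination is the [n = 0] layer plus [T] of the combination with
    shifted coefficients. *)
Lemma orbit_partial_sum (k : 'I_M -> nat -> C) N :
  exists2 u, sqn u = \sum_(n < N) \sum_j nrm (k j n) ^+ 2 &
    forall z, nrm z < 1 ->
      ev u z = \sum_j ev (e j) z * \sum_(n < N) k j n * b z ^+ n.
Proof.
have ip := H2_inner R; have [bev bdot _] := bT.
elim: N k => [|N ih] k.
  exists 0 => [|z z1]; first by rewrite (inner0l ip) big_ord0.
  by rewrite ev0 // big1 // => j _; rewrite big_ord0 mulr0.
have [u uE ue] := ih (fun j n => k j n.+1).
exists (\sum_j k j 0%N *: e j + T u) => [|z z1].
  by rewrite sqn_wandering uE big_ord_recl.
rewrite evD // bev // ue // ev_sum // mulr_sumr -big_split /=; apply: eq_bigr => j _.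
rewrite evZ // big_ord_recl expr0 mulr1 mulrDr mulrC; congr (_ + _).
rewrite mulrCA; congr (_ * _); rewrite mulr_sumr; apply: eq_bigr => n _.
by rewrite exprS mulrCA.
Qed.

(** The norm of [h] is bounded from a pointwise expansion alone. The finite combinations have norm
    at most [D] in total and converge pointwise to [h], hence coefficientwise by [coef_cvg]; a Fatou
    argument on finitely many coefficients concludes. *)
Lemma orbit_synthesis_bound p (h : 'I_p -> H2) (k : 'I_p -> 'I_M -> nat -> C) D :
  (forall N, \sum_(n < N) \sum_i \sum_j nrm (k i j n) ^+ 2 <= D) ->
  (forall i z, nrm z < 1 -> ev (h i) z = \sum_j ev (e j) z * ps_eval (k i j) (b z)) ->
  forall m, \sum_(n < m) \sum_i nrm (h i n) ^+ 2 <= D.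
Proof.
move=> kD hE m.
have term i j n : nrm (k i j n) ^+ 2 <= D.
  have s0 i' n' : 0 <= \sum_j nrm (k i' j n') ^+ 2 by apply: sumr_ge0 => j' _; exact: sqr_ge0.
  apply: (@le_trans _ _ (\sum_j nrm (k i j n) ^+ 2)).
    by apply: (le_sum_one (F := fun j => nrm (k i j n) ^+ 2)) => j'; exact: sqr_ge0.
  apply: (@le_trans _ _ (\sum_i \sum_j nrm (k i j n) ^+ 2)).
    exact: (le_sum_one (F := fun i => \sum_j nrm (k i j n) ^+ 2)).
  apply: le_trans (kD n.+1); rewrite big_ord_recr /= lerDr.
  by apply: sumr_ge0 => n' _; apply: sumr_ge0.
have kb i j : bounded_seq (k i j) (1 + D).
  move=> n; have := term i j n; have := sqr_ge0 (nrm (k i j n) - 1).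
  by have := nrm_ge0 (k i j n); nra.
have ex (iN : 'I_p * nat) : exists u, sqn u = \sum_(n < iN.2) \sum_j nrm (k iN.1 j n) ^+ 2 /\
    forall z, nrm z < 1 -> ev u z = \sum_j ev (e j) z * \sum_(n < iN.2) k iN.1 j n * b z ^+ n.
  by have [u h1 h2] := orbit_partial_sum (k iN.1) iN.2; exists u.
have [G GE] := choice ex.
have GD i N : sqn (G (i, N)) <= D.
  rewrite (GE (i, N)).1 /=; apply: le_trans (kD N); apply: ler_sum => n _.
  apply: (le_sum_one (F := fun i => \sum_j nrm (k i j n) ^+ 2)) => i'.
  by apply: sumr_ge0 => j' _; exact: sqr_ge0.
have cv i n : (fun N => G (i, N) n) @ \oo --> h i n.
  have Bg N : bounded_seq (G (i, N)) (1 + D + sqn (h i)).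
    move=> l; apply: le_trans (H2_bounded _ l) _.
    have := GD i N; have := sqn_ge0 (H2_inner R) (h i); lra.
  have Bh : bounded_seq (h i) (1 + D + sqn (h i)).
    move=> l; apply: le_trans (H2_bounded _ l) _.
    have := le_trans (sqn_ge0 (H2_inner R) _) (GD i 0%N); lra.
  apply: (@coef_cvg _ (fun N => G (i, N)) (h i) _ Bg Bh) => z /andP[_ z1].
  have := cvg_sum (r := index_enum 'I_M) (fun j =>
    cvgCZ (a := ev (e j) z) (ps_cvg (kb i j) (b1 z1))) => hc.
  rewrite -/(ev (h i) z) hE //.
  suff -> : (fun N => ps_eval (G (i, N)) z) = (fun n => \sum_j ev (e j) z *
    \sum_(n0 < n) k i j n0 * b z ^+ n0) by exact: hc.
  by apply/funext => N; apply: (GE (i, N)).2.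
have cvm : (fun N => \sum_(n < m) \sum_i nrm (G (i, N) n) ^+ 2) @ \oo -->
    \sum_(n < m) \sum_i nrm (h i n) ^+ 2.
  apply: cvg_sumR => n; apply: cvg_sumR => i; rewrite expr2.
  under eq_fun do rewrite expr2.
  by apply: cvgM; apply: cvg_nrm; exact: cv.
apply: (cvgn_le_cst cvm); apply: nearW => N; apply: le_trans (kD N).
rewrite exchange_big /= [leRHS]exchange_big /=; apply: ler_sum => i _.
by apply: le_trans (sqn_summable _ _) _; rewrite (GE (i, N)).1.
Qed.
End ModelSpace.

Section ModelSpaceBasis.
Variable R : realType.
Local Notation C := (Cplx R).
Variables (M : nat) (b : C -> C) (T : H2 R -> H2 R) (e : 'I_M -> nat -> C).
Hypothesis bT : inner_multiplier b T.
Hypothesis eV : orthonormal_basis (model_space b) e.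

Lemma model_spaceP (u : H2 R) : model_space b u <-> forall x, dot u (T x) = 0.
Proof.
have [bev _ _] := bT; split=> [[_ h] x|h].
  apply: h; split; first exact: H2P.
  by exists x; [exact: H2P|move=> z; rewrite /unit_disk /= nrm_lt1; exact: bev].
split; first exact: H2P.
move=> f [hf [g hg fg]].
have e1 : T (toH2 hg) = toH2 hf.
  apply: ev_inj => z z1; rewrite bev //; symmetry; apply: fg.
  by rewrite /unit_disk /= nrm_lt1.
by have := h (toH2 hg); rewrite e1.
Qed.

Lemma basis_hardy j : hardy (e j).
Proof. by case: eV => /(_ j)[]. Qed.

Arguments basis_hardy : clear implicits.
Definition basisH j : H2 R := toH2 (basis_hardy j).

Lemma basisH_orth j u : dot (basisH j) (T u) = 0.
Proof. by case: eV => h _ _; exact: (model_spaceP (basisH j)).1 (h j) u. Qed.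

Lemma basisH_on i j : dot (basisH i) (basisH j) = (i == j)%:R.
Proof. by case: eV => _ h _; exact: h. Qed.

(** The component of [u] off the range of [T] lies in the model space. Its coordinates are inner
    products with [u] itself because [T v] is orthogonal to every [e j]. *)
Lemma basisH_span u : exists v, u = \sum_j dot u (basisH j) *: basisH j + T v.
Proof.
have ip := H2_inner R; have [_ _ sp] := eV; have [_ _ dec] := bT.
have [t [v [uE tT]]] := dec u; exists v.
have [c tE] := sp t ((model_spaceP t).2 tT).
have {}tE : t = \sum_j c j *: basisH j.
  apply: H2_eq => n; rewrite tE; apply: (big_ind2 (fun (x : C) (y : H2 R) => x = y n)) => //.
  by move=> x1 y1 x2 y2 -> ->.
rewrite {1}uE; congr (_ + _); rewrite tE; apply: eq_bigr => j _; congr (_ *: _).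
rewrite uE (innerDl ip) [dot (T v) _](inner_sym ip) basisH_orth conjC0 addr0 tE.
rewrite (inner_suml ip) (bigD1 j) //= big1 => [|i ij]; last first.
  by rewrite (innerZl ip) basisH_on (negbTE ij) mulr0.
by rewrite (innerZl ip) basisH_on eqxx mulr1 addr0.
Qed.
End ModelSpaceBasis.

(** * Realization of a contraction *)

Section ColumnNorm.
Variable R : realType.
Local Notation C := (Cplx R).

Definition cdot n (x y : 'cV[C]_n) : C := \sum_i x i 0 * (y i 0)^*.
(** Real-valued and free of square roots; [cvnorm_le] links it to [cvnorm]. *)
Definition cvsq n (x : 'cV[C]_n) : R := \sum_i nrm (x i 0) ^+ 2.

Lemma cdot_inner n : inner_product (@cdot n).
Proof.
split=> [a u v w|u v|u].
- rewrite /cdot mulr_sumr -big_split /=; apply: eq_bigr => i _.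
  by rewrite !mxE mulrDl mulrA.
- rewrite /cdot rmorph_sum /=; apply: eq_bigr => i _.
  by rewrite rmorphM /= conjCK mulrC.
- by apply: sumr_ge0 => i _; rewrite mul_conjC_ge0.
Qed.

Lemma cdotxx n (x : 'cV[C]_n) : cdot x x = toC (cvsq x).
Proof. by rewrite toC_sum; apply: eq_bigr => i _; rewrite mul_conj. Qed.

Lemma cvsqE n (x : 'cV[C]_n) : cvsq x = re (cdot x x).
Proof. by rewrite cdotxx re_toC. Qed.

Lemma cvsq_ge0 n (x : 'cV[C]_n) : 0 <= cvsq x.
Proof. by apply: sumr_ge0 => i _; exact: sqr_ge0. Qed.

Lemma cvsqD n (x y : 'cV[C]_n) : cvsq (x + y) = cvsq x + cvsq y + 2 * re (cdot x y).
Proof. by rewrite !cvsqE (sqnD (cdot_inner n)). Qed.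

Lemma cvsqZ n a (x : 'cV[C]_n) : cvsq (a *: x) = nrm a ^+ 2 * cvsq x.
Proof. by rewrite !cvsqE (sqnZ (cdot_inner n)). Qed.

Lemma cv_delta_sum n (x : 'cV[C]_n) : x = \sum_i x i 0 *: delta_mx i 0.
Proof. by rewrite [LHS]matrix_sum_delta; apply: eq_bigr => i _; rewrite big_ord1. Qed.

Lemma cvsq_delta n (i : 'I_n) : cvsq (delta_mx i 0 : 'cV[C]_n) = 1.
Proof.
rewrite /cvsq (bigD1 i) //= big1 => [|j ji]; last first.
  by rewrite mxE (negbTE ji) nrm0 expr0n.
by rewrite mxE !eqxx nrm1 expr1n addr0.
Qed.
End ColumnNorm.

(* Realization of a contraction [K] into a space carrying a backward shift
   [B] with [|v|^2 = |E v|^2 + |B v|^2].  With [A = (1 - K K^* ) B], the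
   coefficients [E A^n K] and [K^* B A^n K] are those of a Schur function. *)
Section Realization.
Variables (R : realType) (V : lmodType (Cplx R)) (r q : nat).
Local Notation C := (Cplx R).
Variable dot : V -> V -> C.
Hypothesis ip : inner_product dot.
Local Notation sqn u := (re (dot u u)).
Variables (B : V -> V) (E : V -> 'cV[C]_r) (K : 'cV[C]_q -> V).
Hypothesis linB : forall a u v, B (a *: u + v) = a *: B u + B v.
Hypothesis linE : forall a u v, E (a *: u + v) = a *: E u + E v.
Hypothesis linK : forall a u v, K (a *: u + v) = a *: K u + K v.
Hypothesis sqnB : forall v, sqn v = cvsq (E v) + sqn (B v).
Hypothesis contrK : forall x, sqn (K x) <= cvsq x.

(** The adjoint of [K], given by coordinates since the domain of [K] is C^q. *)
Definition adjK v : 'cV[C]_q := \col_k dot v (K (delta_mx k 0)).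

Lemma lin_sum (U W : lmodType C) (f : U -> W) :
  (forall a u v, f (a *: u + v) = a *: f u + f v) ->
  forall I (s : seq I) (c : I -> C) (F : I -> U),
    f (\sum_(i <- s) c i *: F i) = \sum_(i <- s) c i *: f (F i).
Proof.
move=> lf I s c F; elim: s => [|i s ih]; last by rewrite !big_cons lf ih.
rewrite !big_nil; have := lf (-1) 0 0.
by rewrite scaler0 addr0 => {1}->; rewrite scaleN1r addNr.
Qed.

Lemma adjKE v x : dot v (K x) = cdot (adjK v) x.
Proof.
rewrite {1}[x]cv_delta_sum (lin_sum linK) (inner_sumr ip).
by apply: eq_bigr => k _; rewrite (innerZr ip) mxE mulrC.
Qed.

Lemma adjK_lin a u v : adjK (a *: u + v) = a *: adjK u + adjK v.
Proof. by apply/matrixP => i j; rewrite !mxE (inner_linear ip). Qed.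

Lemma additiveK x y : K (x + y) = K x + K y.
Proof. by rewrite -[x]scale1r linK !scale1r. Qed.

(** Expand [0 <= |v - K K^* v|^2 = |v|^2 - 2 |K^* v|^2 + |K K^* v|^2] and bound the last term by
    contractivity of [K]. *)
Lemma adjK_contr v : cvsq (adjK v) <= sqn v.
Proof.
have := sqn_ge0 ip (v - K (adjK v)); rewrite (sqnD ip) (sqnN ip) (innerNr ip) reN (adjKE v) -cvsqE.
by have := contrK (adjK v); lra.
Qed.

(** With [y = K^* v] and [u = x - z y], the cross term of [z v] and [K u] equals that of [z y] and
    [u], which also occurs in [|x|^2 = |z y + u|^2]; it cancels. *)
Lemma feedback_energy z v x :
  sqn (z *: v + K (x - z *: adjK v)) <= nrm z ^+ 2 * (sqn v - cvsq (adjK v)) + cvsq x.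
Proof.
rewrite (sqnD ip) (sqnZ ip) (innerZl ip) (adjKE v) -(innerZl (cdot_inner R q)).
set y := adjK v; set u := x - z *: y.
have -> : cvsq x = cvsq (z *: y + u) by rewrite /u addrC subrK.
by rewrite cvsqD cvsqZ; have := contrK u; lra.
Qed.

Definition stepA v := B v - K (adjK (B v)).

Lemma stepAE v : stepA v = B v + K (- adjK (B v)).
Proof.
have K0 : K 0 = 0 by have := lin_sum linK [::] (fun=> 0) (fun _ : 'I_1 => 0); rewrite !big_nil.
rewrite /stepA; congr (_ + _); apply/eqP; rewrite eq_sym -subr_eq0 opprK -additiveK.
by rewrite addNr K0.
Qed.

Lemma stepA_lin a u v : stepA (a *: u + v) = a *: stepA u + stepA v.
Proof.
by rewrite /stepA linB adjK_lin linK scalerBr opprD addrACA.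
Qed.

Lemma stepA_energy v : sqn (stepA v) <= sqn (B v) - cvsq (adjK (B v)).
Proof.
have := feedback_energy 1 (B v) 0; rewrite !scale1r sub0r -stepAE nrm1 expr1n mul1r.
have -> : cvsq (0 : 'cV[C]_q) = 0.
  by rewrite /cvsq big1 // => i _; rewrite mxE nrm0 expr0n.
by rewrite addr0.
Qed.

Definition state n x := iter n stepA (K x).

Lemma stateS n x : state n.+1 x = stepA (state n x). Proof. by []. Qed.

Lemma state_lin n a x y : state n (a *: x + y) = a *: state n x + state n y.
Proof. by elim: n => [|n ih]; [exact: linK|rewrite !stateS ih stepA_lin]. Qed.

Lemma state_le n x : sqn (state n x) <= cvsq x.
Proof.
elim: n => [|n ih]; first exact: contrK.
have h := stepA_energy (state n x); have := sqnB (state n x).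
have := cvsq_ge0 (E (state n x)); have := cvsq_ge0 (adjK (B (state n x))).
by rewrite stateS; lra.
Qed.

Definition out1 n : 'M[C]_(r, q) := \matrix_(i, k) E (state n (delta_mx k 0)) i 0.
Definition out2 n : 'M[C]_q := \matrix_(i, k) adjK (B (state n (delta_mx k 0))) i 0.

Lemma mx_of_lin m (f : 'cV[C]_q -> 'cV[C]_m) :
  (forall a u v, f (a *: u + v) = a *: f u + f v) ->
  forall x, (\matrix_(i, k) f (delta_mx k 0) i 0) *m x = f x.
Proof.
move=> lf x; rewrite [in RHS](cv_delta_sum x) (lin_sum lf).
apply/matrixP => i j; rewrite ord1 !mxE summxE; apply: eq_bigr => k _.
by rewrite !mxE mulrC.
Qed.

Lemma out1E n x : out1 n *m x = E (state n x).
Proof.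
by apply: (mx_of_lin (f := fun x => E (state n x))) => a u v; rewrite state_lin linE.
Qed.

Lemma out2E n x : out2 n *m x = adjK (B (state n x)).
Proof.
by apply: (mx_of_lin (f := fun x => adjK (B (state n x)))) => a u v; rewrite state_lin linB adjK_lin.
Qed.

Lemma out_contr n x : cvsq (out1 n *m x) + cvsq (out2 n *m x) <= cvsq x.
Proof.
rewrite out1E out2E; apply: le_trans (state_le n x); rewrite sqnB lerD2l.
exact: adjK_contr.
Qed.

(** Substitute [B = A + K K^* B] repeatedly in [B^n K]. Applying [E] to the result yields the
    coefficients of [K = s_1 + z K s_2]. *)
Lemma state_telescope n x :
  iter n B (K x) = state n x + \sum_(i < n) iter i B (K (out2 (n - i.+1)%N *m x)).
Proof.
elim: n => [|n ih]; first by rewrite big_ord0 addr0.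
rewrite iterS ih -[state n x]scale1r linB scale1r big_ord_recl /= subn1 /=.
have -> : B (state n x) = state n.+1 x + K (out2 n *m x).
  by rewrite out2E stateS /stepA subrK.
rewrite -addrA; congr (_ + (_ + _)).
have BD u v : B (u + v) = B u + B v by rewrite -[u]scale1r linB !scale1r.
have B0 : B 0 = 0 by have := lin_sum linB [::] (fun=> 0) (fun _ : 'I_1 => 0); rewrite !big_nil.
by rewrite (big_morph B BD B0).
Qed.

Lemma mulmx_cv_inj m (A D : 'M[C]_(m, q)) :
  (forall x : 'cV_q, A *m x = D *m x) -> A = D.
Proof.
move=> h; apply/matrixP => i j; have /matrixP /(_ i 0) := h (delta_mx j 0).
by rewrite -!colE !mxE.
Qed.

Lemma out_recurrence n (k : nat -> 'M[C]_(r, q)) :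
  (forall n x, k n *m x = E (iter n B (K x))) ->
  k n = out1 n + \sum_(i < n) k i *m out2 (n - i.+1)%N.
Proof.
move=> hk.
have ED u v : E (u + v) = E u + E v by rewrite -[u]scale1r linE !scale1r.
have E0 : E 0 = 0 by have := lin_sum linE [::] (fun=> 0) (fun _ : 'I_1 => 0); rewrite !big_nil.
suff h (x : 'cV_q) : k n *m x = (out1 n + \sum_(i < n) k i *m out2 (n - i.+1)%N) *m x.
  exact: mulmx_cv_inj h.
rewrite hk state_telescope ED mulmxDl out1E; congr (_ + _).
rewrite (big_morph E ED E0) mulmx_suml; apply: eq_bigr => i _.
by rewrite -mulmxA hk.
Qed.

(** The witness [s N] is the energy of [X N], a partial sum of [(1 - z A)^-1 K x]. From [X N.+1 = z
    B (X N) + K (x - z K^* B (X N))], [feedback_energy] bounds the next energy, and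
    [|X|^2 = |E X|^2 + |B X|^2] isolates the outputs; [|z| < 1] and [adjK_contr] give the sign of
    what is left over. *)
Lemma out_partial_energy z x : nrm z < 1 ->
  exists2 s : nat -> R, forall N, 0 <= s N &
    forall N, cvsq ((\sum_(n < N) z ^+ n *: out1 n) *m x)
      + cvsq ((\sum_(n < N) z ^+ n *: out2 n) *m x) <= cvsq x + s N - s N.+1.
Proof.
move=> z1; pose X N := \sum_(n < N) z ^+ n *: state n x.
exists (fun N => sqn (X N)) => N; first exact: sqn_ge0.
have -> : (\sum_(n < N) z ^+ n *: out1 n) *m x = E (X N).
  rewrite mulmx_suml (lin_sum linE); apply: eq_bigr => i _.
  by rewrite -scalemxAl out1E.
have -> : (\sum_(n < N) z ^+ n *: out2 n) *m x = adjK (B (X N)).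
  rewrite mulmx_suml (lin_sum linB) (lin_sum adjK_lin); apply: eq_bigr => i _.
  by rewrite -scalemxAl out2E.
have XS : X N.+1 = z *: B (X N) + K (x - z *: adjK (B (X N))).
  have -> : X N.+1 = K x + z *: stepA (X N).
    rewrite /X big_ord_recl expr0 scale1r; congr (_ + _).
    rewrite (lin_sum stepA_lin) scaler_sumr; apply: eq_bigr => i _.
    by rewrite scalerA -exprS.
  rewrite [x - _]addrC -scaleNr linK /stepA scalerBr scaleNr.
  by rewrite addrC addrA.
have := feedback_energy z (B (X N)) x; rewrite -XS.
have := sqnB (X N); have := adjK_contr (B (X N)).
have z2 : nrm z ^+ 2 <= 1 by rewrite exprn_ile1 ?nrm_ge0 ?ltW.
have := sqr_ge0 (nrm z).
move: (nrm z ^+ 2) (sqn (X N)) (sqn (X N.+1)) (sqn (B _)) (cvsq _) (cvsq x) (cvsq _) z2 => t a b c d e f.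
by nra.
Qed.
End Realization.

(** * The maximum principle and Taylor coefficients of Schur functions *)

Section MaximumPrinciple.
Variable R : realType.
Local Notation C := (Cplx R).
Implicit Types (z w h : C) (f g : C -> C) (p : {poly C}).

Lemma continuous_complex (psi : C -> R) (x : R * R) :
  (forall e, 0 < e -> exists2 d, 0 < d & forall w,
     nrm (w - Complex x.1 x.2) < d -> `|psi w - psi (Complex x.1 x.2)| < e) ->
  (fun y : R * R => psi (Complex y.1 y.2)) @ x --> psi (Complex x.1 x.2).
Proof.
move=> h; apply/cvgrPdist_lt => e /h[d d0 hd].
have d20 : 0 < d / 2 by rewrite divr_gt0.
exists (ball x.1 (d / 2), ball x.2 (d / 2)).
  by split; apply: nbhsx_ballx.
move=> [a b] /= [ha hb]; rewrite distrC; apply: hd.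
apply: le_lt_trans (nrm_le_re_im _) _; rewrite /re /im /= -/(_ - x.1) -/(_ - x.2).
by move: ha hb; rewrite /ball /= /ball_ [`|a - _|]distrC [`|b - _|]distrC; lra.
Qed.

Lemma nrm_sqr_dist (z w : C) :
  `|nrm z ^+ 2 - nrm w ^+ 2| <= nrm (z - w) * (2 * nrm w + nrm (z - w)).
Proof.
have h1 := nrmD (z - w) w; have h2 := nrmD (w - z) z; rewrite !subrK in h1 h2; rewrite [nrm (w - z)]nrmC in h2.
have := nrm_ge0 z; have := nrm_ge0 w; have := nrm_ge0 (z - w).
move: (nrm z) (nrm w) (nrm (z - w)) h1 h2 => a b t h1 h2 t0 b0 a0.
have ab0 : 0 <= a + b by exact: addr_ge0.
have k1 : (b - a) * (a + b) <= t * (a + b) by rewrite ler_wpM2r //; lra.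
have k2 : (a - b) * (a + b) <= t * (a + b) by rewrite ler_wpM2r //; lra.
have k3 : t * (a + b) <= t * (2 * b + t) by rewrite ler_wpM2l //; lra.
by rewrite ler_norml; apply/andP; split; lra.
Qed.

(** The disk is compact as a closed part of the square [[-r, r]^2] in [R * R]; continuity is phrased
    with epsilon and delta for the transfer there. *)
Lemma disk_max (psi : C -> R) r : 0 <= r ->
  (forall z, nrm z <= r -> forall e, 0 < e -> exists2 d, 0 < d & forall w,
     nrm (w - z) < d -> `|psi w - psi z| < e) ->
  exists2 z, nrm z <= r & forall w, nrm w <= r -> psi w <= psi z.
Proof.
move=> r0 cpsi.
pose A := [set x : R * R | nrm (Complex x.1 x.2 : C) <= r].
have A0 : A !=set0 by exists (0, 0); rewrite /A /= (_ : Complex 0 0 = 0 :> C) ?nrm0.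
have cA : compact A.
  have cS := compact_setX (@segment_compact R (- r) r) (@segment_compact R (- r) r).
  apply: (subclosed_compact _ cS); last first.
    move=> [a b] /= hab; rewrite !in_itv /= -!ler_norml; split.
      exact: le_trans (re_le_nrm (Complex a b : C)) hab.
    exact: le_trans (im_le_nrm (Complex a b : C)) hab.
  apply: (@closed_comp _ _ (fun x : R * R => nrm (Complex x.1 x.2 : C)) [set x | x <= r]); last exact: closed_le.
  move=> x _; apply: (continuous_complex (psi := @nrm R)) => e e0; exists e => // w; apply: le_lt_trans.
  have h1 := nrmD (w - Complex x.1 x.2) (Complex x.1 x.2).
  have h2 := nrmD (Complex x.1 x.2 - w) w.
  rewrite !subrK in h1 h2; rewrite ler_norml; apply/andP; split; last by lra.
  by rewrite nrmC; lra.
have cf : {within A, continuous (fun x : R * R => psi (Complex x.1 x.2))}.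
  apply/subspace_continuousP => x Ax; apply: cvg_within_filter.
  by apply: continuous_complex; apply: cpsi.
have [c cA' hc] := compact_EVT_max A0 cA cf.
exists (Complex c.1 c.2); first by move: cA'; rewrite inE.
move=> w wr; have -> : w = Complex (re w) (im w) by case: (w).
by apply: (hc (re w, im w)); rewrite inE /A /=; case: (w) wr.
Qed.

(* Unlike the power series of [analytic_at], order-[N] approximations at a
   point are stable under products and inverses without any convergence
   argument; order 3 is enough for the maximum principle. *)
Definition jet_at N f z p := exists2 d : R, 0 < d & exists B : R,
  forall h, nrm h < d -> nrm (f (z + h) - p.[h]) <= B * nrm h ^+ N.

Lemma horner_bound p : exists2 B : R, 0 <= B & forall h, nrm h <= 1 -> nrm p.[h] <= B.
Proof.
exists (\sum_(i < size p) nrm p`_i) => [|h h1]; first by apply: sumr_ge0 => i _; exact: nrm_ge0.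
rewrite horner_coef; apply: le_trans (nrm_sum _ _ _) _; apply: ler_sum => i _.
by rewrite nrmM nrmX ler_piMr ?nrm_ge0 ?exprn_ile1 ?nrm_ge0.
Qed.

Lemma jet_at_norm N f z p : jet_at N f z p -> exists2 d : R, 0 < d <= 1 & exists2 B : R, 0 <= B &
  forall h, nrm h < d -> nrm (f (z + h) - p.[h]) <= B * nrm h ^+ N.
Proof.
move=> [d d0 [B hB]]; exists (Num.min d 1).
  by rewrite lt_min d0 ltr01 ge_min lexx orbT.
exists `|B| => // h; rewrite lt_min => /andP[hd _]; apply: le_trans (hB h hd) _.
by rewrite ler_wpM2r ?exprn_ge0 ?nrm_ge0 // ler_norm.
Qed.

Lemma jet_atD N f g z p q : jet_at N f z p -> jet_at N g z q ->
  jet_at N (fun w => f w + g w) z (p + q).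
Proof.
move=> /jet_at_norm[d /andP[d0 _] [B B0 hB]] /jet_at_norm[d' /andP[d0' _] [B' B0' hB']].
exists (Num.min d d'); first by rewrite lt_min d0.
exists (B + B') => h; rewrite lt_min => /andP[hd hd'].
rewrite hornerD mulrDl opprD addrACA; apply: le_trans (nrmD _ _) _.
by rewrite lerD ?hB ?hB'.
Qed.

Lemma jet_atM N f g z p q : jet_at N f z p -> jet_at N g z q ->
  jet_at N (fun w => f w * g w) z (p * q).
Proof.
move=> /jet_at_norm[d /andP[d0 d1] [B B0 hB]] /jet_at_norm[d' /andP[d0' d1'] [B' B0' hB']].
have [P P0 hP] := horner_bound p; have [Q Q0 hQ] := horner_bound q.
exists (Num.min d d'); first by rewrite lt_min d0.
exists (B * (Q + B') + P * B') => h; rewrite lt_min => /andP[hd hd'].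
have h1 : nrm h <= 1 by exact: le_trans (ltW hd) d1.
have hN : nrm h ^+ N <= 1 by rewrite exprn_ile1 ?nrm_ge0.
have hN0 : 0 <= nrm h ^+ N by rewrite exprn_ge0 ?nrm_ge0.
rewrite hornerM.
have -> : f (z + h) * g (z + h) - p.[h] * q.[h] =
  (f (z + h) - p.[h]) * g (z + h) + p.[h] * (g (z + h) - q.[h]) by ring.
have gb : nrm (g (z + h)) <= Q + B'.
  have := nrmD (g (z + h) - q.[h]) q.[h]; rewrite subrK => hh; apply: le_trans hh _.
  rewrite addrC lerD ?hQ //; apply: le_trans (hB' h hd') _; exact: ler_piMr.
apply: le_trans (nrmD _ _) _; rewrite !nrmM mulrDl; apply: lerD.
  by rewrite mulrAC ler_pM ?nrm_ge0 // hB.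
by rewrite -mulrA ler_pM ?nrm_ge0 ?hP // hB'.
Qed.

Lemma jet_at_poly N p z : jet_at N (fun w => p.[w]) z (p \Po ('X + z%:P)).
Proof.
exists 1 => //; exists 0 => h _.
by rewrite horner_comp hornerD hornerX hornerC [h + z]addrC subrr nrm0 mul0r.
Qed.

Lemma jet_at_cst N c z : jet_at N (fun=> c) z c%:P.
Proof. by exists 1 => //; exists 0 => h _; rewrite hornerC subrr nrm0 mul0r. Qed.

Lemma jet_at_scale N f w z p : nrm w = 1 -> jet_at N f (w * z) p ->
  jet_at N (fun x => f (w * x)) z (p \Po (w *: 'X)).
Proof.
move=> w1 [d d0 [B hB]]; exists d => //; exists B => h hd.
rewrite horner_comp hornerZ hornerX mulrDr -[nrm h]mul1r -w1 -nrmM; apply: hB.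
by rewrite nrmM w1 mul1r.
Qed.

Lemma jet_at_sum N I (s : seq I) (F : I -> C -> C) (p : I -> {poly C}) z :
  (forall i, jet_at N (F i) z (p i)) ->
  jet_at N (fun w => \sum_(i <- s) F i w) z (\sum_(i <- s) p i).
Proof.
move=> h; elim: s => [|i s ih].
  under [X in jet_at _ X]funext do rewrite big_nil.
  by rewrite big_nil; exact: jet_at_cst.
under [X in jet_at _ X]funext do rewrite big_cons.
by rewrite big_cons; exact: jet_atD.
Qed.

(** Truncated geometric series: [(z + h) p(h) = 1 - (- h / z)^N] exactly. For [|h| < |z| / 2] the
    factor [1 / (z + h)] is at most [2 / |z|]. *)
Lemma jet_at_inv N z : z != 0 -> exists p, jet_at N (fun w => w^-1) z p.
Proof.
move=> z0; have nz : 0 < nrm z by rewrite nrm_gt0.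
pose p := \poly_(j < N) ((-1) ^+ j * z^-1 ^+ j.+1); exists p.
have pE h : (z + h) * p.[h] = 1 - (- h / z) ^+ N.
  have -> : (z + h) * p.[h] = (1 - (- h / z)) * \sum_(j < N) (- h / z) ^+ j.
    rewrite horner_poly !mulr_sumr; apply: eq_bigr => i _.
    rewrite [(- h / z) ^+ i](_ : _ = (-1) ^+ i * h ^+ i * z^-1 ^+ i); last by rewrite -!exprMn mulN1r.
    by rewrite exprS; move: ((-1) ^+ i) (h ^+ i) (z^-1 ^+ i) => a b c; field.
  by rewrite -[1 - _]opprB mulNr -subrX1 opprB.
exists (nrm z / 2); first by rewrite divr_gt0.
exists (2 / nrm z / nrm z ^+ N) => h hz.
have zh : nrm z / 2 <= nrm (z + h).
  by have := nrmB (z + h) h; rewrite addrK; lra.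
have zhn0 : z + h != 0 by rewrite -nrm_gt0; lra.
have -> : (z + h)^-1 - p.[h] = (z + h)^-1 * (- h / z) ^+ N.
  by apply: (mulfI zhn0); rewrite mulrBr pE mulVKf // divff // subKr.
rewrite nrmM nrmX nrmV nrmM nrmV nrmN expr_div_n.
have -> : 2 / nrm z / nrm z ^+ N * nrm h ^+ N = 2 / nrm z * (nrm h ^+ N / nrm z ^+ N) by ring.
rewrite ler_wpM2r ?divr_ge0 ?exprn_ge0 ?nrm_ge0 //.
by rewrite -[2 / _]invf_div lef_pV2 ?posrE ?divr_gt0 //; lra.
Qed.

Lemma jet_at_value N f z p : (0 < N)%N -> jet_at N f z p -> f z = p.[0].
Proof.
move=> N0 [d d0 [B]] /(_ 0); rewrite nrm0 expr0n (gtn_eqF N0) mulr0 addr0 => /(_ d0).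
move=> h; apply/eqP; rewrite -subr_eq0 -nrm_eq0 eq_le h nrm_ge0 //.
Qed.

Lemma jet_at_take N M f z p : (N <= M)%N -> jet_at M f z p -> jet_at N f z (take_poly N p).
Proof.
move=> NM /jet_at_norm[d /andP[d0 d1] [B B0 hB]].
have [D D0 hD] := horner_bound (drop_poly N p).
exists d => //; exists (B + D) => h hd.
have h1 : nrm h <= 1 by exact: le_trans (ltW hd) d1.
have -> : f (z + h) - (take_poly N p).[h] = (f (z + h) - p.[h]) + (drop_poly N p).[h] * h ^+ N.
  by rewrite -[in p.[h]](poly_take_drop N p) hornerD hornerM hornerXn; ring.
apply: le_trans (nrmD _ _) _; rewrite mulrDl; apply: lerD.
  apply: le_trans (hB h hd) _; rewrite ler_wpM2l //.
  by rewrite ler_wiXn2l ?nrm_ge0.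
by rewrite nrmM nrmX ler_wpM2r ?exprn_ge0 ?nrm_ge0 ?hD.
Qed.

Lemma jet_at_cont N f z p : (0 < N)%N -> jet_at N f z p ->
  forall e, 0 < e -> exists2 d, 0 < d & forall w, nrm (w - z) < d -> nrm (f w - f z) < e.
Proof.
move=> N0 jf e e0; have [d /andP[d0 d1] [B B0 hB]] := jet_at_norm (jet_at_take N0 jf).
exists (Num.min d (e / (B + 1))); first by rewrite lt_min d0 divr_gt0 // ltr_wpDl.
move=> w; rewrite lt_min => /andP[wd we].
have pc : take_poly 1 p = (f z)%:P.
  rewrite (jet_at_value N0 jf) horner_coef0; apply/polyP => i.
  by rewrite coef_take_poly coefC; case: i.
have := hB _ wd; rewrite [z + _]addrC subrK pc hornerC expr1 => h; apply: le_lt_trans h _.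
have : (B + 1) * nrm (w - z) < e by rewrite mulrC -ltr_pdivlMr // ltr_wpDl.
by have := nrm_ge0 (w - z); nra.
Qed.

(** The fourth roots of unity and their squares both sum to 0: an exact mean value property in
    degree at most 2. *)
Lemma quad_sum p h (i : C) : i * i = -1 -> (size p <= 3)%N ->
  p.[h] + p.[- h] + p.[i * h] + p.[- (i * h)] = 4 * p.[0].
Proof.
move=> ii sp.
have pE w : p.[w] = p`_0 + p`_1 * w + p`_2 * (w * w).
  by rewrite (horner_coef_wide _ sp) !big_ord_recr big_ord0 /= add0r expr0 mulr1 expr1 expr2.
rewrite !pE !mulrNN [i * h * _]mulrACA ii; move: p`_0 p`_1 p`_2 => a b c; ring.
Qed.

(* At an interior maximum of [|f|^2 + eps |z|^2], averaging over the four
   points [z + i^k s] kills the terms of order 1 and 2 of [f], while the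
   second summand gains [eps s^2]. *)
Lemma max_principle f r B : 0 < r ->
  (forall z, nrm z <= r -> exists p, jet_at 3 f z p) ->
  (forall z, nrm z = r -> nrm (f z) <= B) ->
  forall z, nrm z <= r -> nrm (f z) <= B.
Proof.
move=> r0 jf fB z1 z1r; rewrite leNgt; apply/negP => Bz.
have B0 : 0 <= B by apply: le_trans (nrm_ge0 (f (toC r))) (fB _ _); rewrite nrm_toC gtr0_norm.
(* Half the excess of [|f(z1)|^2] over [B^2], scaled by [r^2]: the perturbation is too small to move
   the maximum of [psi] to the boundary. *)
pose eps := (nrm (f z1) ^+ 2 - B ^+ 2) / (2 * r ^+ 2).
have gap : 0 < nrm (f z1) ^+ 2 - B ^+ 2.
  by rewrite subr_gt0 ltr_pXn2r ?nnegrE ?nrm_ge0.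
have r20 : 0 < r ^+ 2 by rewrite exprn_gt0.
have eps0 : 0 < eps by rewrite divr_gt0 // mulr_gt0.
have epsr : eps * r ^+ 2 < nrm (f z1) ^+ 2 - B ^+ 2.
  have -> : eps * r ^+ 2 = (nrm (f z1) ^+ 2 - B ^+ 2) / 2 by rewrite /eps; field; rewrite gt_eqF.
  lra.
pose psi z := nrm (f z) ^+ 2 + eps * nrm z ^+ 2.
have [zs zsr hmax] : exists2 z, nrm z <= r & forall w, nrm w <= r -> psi w <= psi z.
  apply: disk_max => [|z zr e e0]; first exact: ltW.
  have [p jp] := jf z zr.
  have bnd a (b : R) : 0 <= a -> 0 < b -> exists2 t, 0 < t & forall x y : C, nrm y = a ->
      nrm (x - y) < t -> `|nrm x ^+ 2 - nrm y ^+ 2| < b.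
    move=> a0 b0; exists (Num.min 1 (b / (2 * a + 1))).
      by rewrite lt_min ltr01 divr_gt0 // ltr_wpDl // mulr_ge0.
    move=> x y ya; rewrite lt_min ltr_pdivlMr ?ltr_wpDl ?mulr_ge0 // => /andP[t1 tb].
    apply: le_lt_trans (nrm_sqr_dist _ _) _; rewrite ya; apply: le_lt_trans tb.
    by rewrite ler_wpM2l ?nrm_ge0 // lerD2l ltW.
  have [t t0 ht] := bnd _ _ (nrm_ge0 (f z)) (divr_gt0 e0 (ltr0Sn _ 1)).
  have [t' t0' ht'] := bnd _ _ (nrm_ge0 z) (divr_gt0 (divr_gt0 e0 (ltr0Sn _ 1)) eps0).
  have [d d0 hd] := jet_at_cont (ltn0Sn 2) jp t0.
  exists (Num.min d t'); first by rewrite lt_min d0.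
  move=> w; rewrite lt_min => /andP[/hd/(ht _ _ erefl) h1 /(ht' _ _ erefl)].
  rewrite ltr_pdivlMr // => h2.
  have -> : psi w - psi z = (nrm (f w) ^+ 2 - nrm (f z) ^+ 2) + (nrm w ^+ 2 - nrm z ^+ 2) * eps.
    by rewrite /psi; ring.
  by apply: le_lt_trans (ler_normD _ _) _; rewrite normrM (gtr0_norm eps0); lra.
have zslt : nrm zs < r.
  rewrite lt_neqAle zsr andbT; apply/eqP => e.
  have := hmax _ z1r; rewrite /psi e.
  have : 0 <= eps * nrm z1 ^+ 2 by rewrite mulr_ge0 ?sqr_ge0 // ltW.
  have : nrm (f zs) ^+ 2 <= B ^+ 2 by rewrite ler_pXn2r ?nnegrE ?nrm_ge0 ?fB.
  by lra.
have [p jp] := jf _ zsr.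
have [d /andP[d0 d1] [D D0 hD]] := jet_at_norm (jet_at_take (leqnn 3) jp).
set q := take_poly 3 p in hD; have sq : (size q <= 3)%N by exact: size_take_poly.
have fq : f zs = q.[0].
  have /jet_at_value -> // : jet_at 3 f zs q by exact: jet_at_take jp.
pose m := nrm (f zs); have m0 : 0 <= m := nrm_ge0 _.
(* The four points must lie in the range of the jet and in the disk, and the cubic error [2 D m s^3]
   must lose against the gain [eps s^2]. *)
have [s s0 [sd sr sD]] : exists2 s : R, 0 < s & [/\ s < d, s <= r - nrm zs & 2 * D * m * s < eps].
  have k0 : 0 < 2 * D * m + 1 by rewrite ltr_wpDl // !mulr_ge0.
  pose s := Num.min (d / 2) (Num.min (r - nrm zs) (eps / (2 * D * m + 1))).
  have s0 : 0 < s by rewrite !lt_min divr_gt0 // subr_gt0 zslt divr_gt0.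
  have : s <= s by []; rewrite {2}/s !le_min => /andP[s1 /andP[s2 s3]].
  exists s => //; split=> //; first by lra.
  by move: s3; rewrite ler_pdivlMr //; lra.
pose i : C := Complex 0 1.
have ii : i * i = -1 by rewrite -[i * i]expr2; exact: sqr_i.
have ni : nrm i = 1.
  by apply/eqP; rewrite -(@eqrXn2 _ 2) ?nrm_ge0 // nrm_sqr /re /im /= expr0n /= add0r.
pose h := toC s; have nh : nrm h = s by rewrite nrm_toC gtr0_norm.
have nih : nrm (i * h) = s by rewrite nrmM ni mul1r.
pose dl k := f (zs + k) - q.[k].
(* Maximality at [zs], with the nonnegative square of the increment of [f] discarded. *)
have low k : nrm k = s ->
    m ^+ 2 + 2 * re ((dl k + (q.[k] - q.[0])) * (f zs)^*) +
    eps * (nrm zs ^+ 2 + s ^+ 2 + 2 * re (zs * k^*)) <= m ^+ 2 + eps * nrm zs ^+ 2.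
  move=> ks; have kr : nrm (zs + k) <= r by have := nrmD zs k; rewrite ks; lra.
  apply: le_trans (hmax _ kr); rewrite /psi [nrm (zs + k) ^+ 2]nrm_sqrD ks lerD2r.
  have -> : f (zs + k) = f zs + (dl k + (q.[k] - q.[0])) by rewrite /dl fq; ring.
  rewrite nrm_sqrD -/m -[f zs * _]conjCK rmorphM /= conjCK re_conj [(f zs)^* * _]mulrC.
  by have := sqr_ge0 (nrm (dl k + (q.[k] - q.[0]))); lra.
have l1 := low h nh; have l2 := low (- h) (etrans (nrmN h) nh).
have l3 := low (i * h) nih; have l4 := low (- (i * h)) (etrans (nrmN (i * h)) nih).
have dlb k : nrm k = s -> nrm (dl k) <= D * s ^+ 3 by move=> ks; rewrite -ks; apply: hD; rewrite ks.
pose S := dl h + dl (- h) + dl (i * h) + dl (- (i * h)).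
have Sb : nrm S <= 4 * (D * s ^+ 3).
  have := dlb h nh; have := dlb (- h) (etrans (nrmN h) nh).
  have := dlb (i * h) nih; have := dlb (- (i * h)) (etrans (nrmN (i * h)) nih).
  have := nrmD (dl h + dl (- h) + dl (i * h)) (dl (- (i * h))).
  have := nrmD (dl h + dl (- h)) (dl (i * h)); have := nrmD (dl h) (dl (- h)).
  by rewrite /S; lra.
have Sre : - (4 * (D * s ^+ 3) * m) <= re (S * (f zs)^*).
  have := re_le_nrm (S * (f zs)^*); rewrite nrmM nrm_conj -/m ler_norml => /andP[h1 _].
  by apply: le_trans h1; rewrite lerN2 ler_wpM2r.
have Ssum : re ((dl h + (q.[h] - q.[0])) * (f zs)^*) + re ((dl (- h) + (q.[- h] - q.[0])) * (f zs)^*) +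
  re ((dl (i * h) + (q.[i * h] - q.[0])) * (f zs)^*) +
  re ((dl (- (i * h)) + (q.[- (i * h)] - q.[0])) * (f zs)^*) = re (S * (f zs)^*).
  rewrite -!reD; congr re; rewrite -!mulrDl; congr (_ * _).
  apply/eqP; rewrite -subr_eq0; apply/eqP.
  transitivity (q.[h] + q.[- h] + q.[i * h] + q.[- (i * h)] - 4 * q.[0]).
    rewrite /S; move: (dl h) (dl (- h)) (dl (i * h)) (dl (- (i * h))) q.[h] q.[- h] q.[i * h] q.[- (i * h)] q.[0] => *.
    by ring.
  by rewrite quad_sum // subrr.
have e1 : re (zs * (- h)^*) = - re (zs * h^*) by rewrite rmorphN mulrN reN.
have e2 : re (zs * (- (i * h))^*) = - re (zs * (i * h)^*) by rewrite rmorphN mulrN reN.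
have key : eps * s ^+ 2 <= 2 * D * m * s * s ^+ 2.
  have -> : 2 * D * m * s * s ^+ 2 = 2 * (D * s ^+ 3 * m) by ring.
  by rewrite e1 in l2; rewrite e2 in l4; lra.
by move: key; rewrite ler_pM2r ?exprn_gt0 //; lra.
Qed.
End MaximumPrinciple.

(** * Taylor polynomials, division by powers of [z], and averages over roots of unity *)

Section TaylorCoefficients.
Variable R : realType.
Local Notation C := (Cplx R).
Implicit Types (z w h : C) (f g F P : C -> C) (p rho : {poly C}).

Lemma jet_at_ext N f g z p (d : R) : 0 < d -> (forall h, nrm h < d -> f (z + h) = g (z + h)) ->
  jet_at N f z p -> jet_at N g z p.
Proof.
move=> d0 fg [d' d0' [B hB]]; exists (Num.min d d'); first by rewrite lt_min d0.
by exists B => h; rewrite lt_min => /andP[hd hd']; rewrite -fg // hB.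
Qed.

Lemma jet_at_mono N M f z p : (N <= M)%N -> jet_at M f z p -> jet_at N f z p.
Proof.
move=> NM /jet_at_norm[d /andP[d0 d1] [B B0 hB]]; exists d => //; exists B => h hd.
apply: le_trans (hB h hd) _; rewrite ler_wpM2l // ler_wiXn2l ?nrm_ge0 //.
exact: le_trans (ltW hd) d1.
Qed.

Lemma jet_at_invX N m z : z != 0 -> exists p, jet_at N (fun w => w^-1 ^+ m) z p.
Proof.
move=> z0; have [p jp] := jet_at_inv N z0; elim: m => [|m [q jq]].
  by exists 1%:P; exact: jet_at_cst.
exists (p * q); under [X in jet_at _ X]funext do rewrite exprS.
exact: jet_atM.
Qed.

Lemma max_principle_div F m rho r B : 0 < r ->
  (forall z, nrm z <= r -> exists p, jet_at 3 F z p) ->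
  jet_at (m + 3) F 0 ('X^m * rho) ->
  (forall z, nrm z = r -> nrm (F z) <= B) ->
  nrm rho.[0] <= B / r ^+ m /\ forall z, nrm z <= r -> nrm (F z) <= B * (nrm z / r) ^+ m.
Proof.
move=> r0 jF j0 FB; pose h z := if z == 0 then rho.[0] else F z * z^-1 ^+ m.
have hn0 z : z != 0 -> h z = F z * z^-1 ^+ m by move=> /negbTE z0; rewrite /h z0.
have rm0 : 0 < r ^+ m by rewrite exprn_gt0.
have jh z : nrm z <= r -> exists p, jet_at 3 h z p.
  move=> zr; have [->|z0] := eqVneq z 0.
    exists rho; have /jet_at_norm[d /andP[d0 d1] [D D0 hD]] := j0.
    exists d => //; exists D => k kd; rewrite add0r.
    have [->|k0] := eqVneq k 0.
      by rewrite /h eqxx subrr nrm0 expr0n mulr0.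
    have km0 : 0 < nrm k ^+ m by rewrite exprn_gt0 // nrm_gt0.
    rewrite -(ler_pM2r km0) hn0 // -nrmX -nrmM mulrBl -mulrA -exprMn mulVf // expr1n mulr1.
    have := hD k kd; rewrite add0r hornerM hornerXn [k ^+ m * _]mulrC => h1.
    by apply: le_trans h1 _; rewrite exprD nrmX -mulrA [nrm k ^+ m * _]mulrC.
  have [p jp] := jF z zr; have [q jq] := jet_at_invX 3 m z0.
  exists (p * q); apply: jet_at_ext (jet_atM jp jq).
    by rewrite -nrm_gt0 in z0; exact: z0.
  move=> k kz; rewrite hn0 //; apply/eqP => e.
  have : nrm z = nrm k by rewrite -nrmN; congr nrm; apply/eqP; rewrite eq_sym -addr_eq0 addrC e.
  by move=> e2; rewrite e2 ltxx in kz.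
have hb z : nrm z = r -> nrm (h z) <= B / r ^+ m.
  move=> zr; have z0 : z != 0 by rewrite -nrm_gt0 zr.
  rewrite hn0 // nrmM nrmX nrmV zr exprVn; apply: ler_wpM2r; [by rewrite invr_ge0 ltW|exact: FB].
have mp := max_principle r0 jh hb; split.
  by have := mp 0; rewrite /h eqxx nrm0 => ->//; exact: ltW.
move=> z zr; have [->|z0] := eqVneq z 0.
  have h0 := jet_at_value _ j0; rewrite h0 ?addn3 // hornerM hornerXn nrmM nrmX nrm0 mul0r expr0n.
  case: (eqVneq m 0%N) mp => [->|_] mp; last by rewrite mul0r mulr0.
  rewrite mul1r mulr1; have := mp 0.
  by rewrite /h eqxx nrm0 expr0 divr1 => ->//; exact: ltW.
have := mp z zr; rewrite hn0 // nrmM nrmX nrmV exprVn ler_pdivrMr ?exprn_gt0 ?nrm_gt0 //.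
by rewrite expr_div_n [_ / _ * _]mulrAC mulrA.
Qed.

(** Convergence at distance [s = r / 2] bounds [|a n| s^n]; for [|h| < s / 2] the terms from [N] on
    are dominated by a geometric series of ratio [1/2]. *)
Lemma analytic_jet f z (r : C) (a : nat -> C) N : 0 < r ->
  (forall w, `|w - z| < r -> series (fun n => a n * (w - z) ^+ n) @ \oo --> f w) ->
  jet_at N f z (\poly_(j < N) a j).
Proof.
move=> r0 ha; have rE := ge0_toC (ltW r0); set t := re r in rE.
have t0 : 0 < t by rewrite -toC_lt toC0 -rE.
pose s := t / 2; have s0 : 0 < s by rewrite divr_gt0.
have [B hB] : exists B, forall n, nrm (a n) * s ^+ n <= B.
  have [w wz] : {w | w - z = toC s} by exists (z + toC s); rewrite addrC addKr.
  have wr : `|w - z| < r by rewrite wz nrmE rE toC_lt nrm_toC gtr0_norm // /s; lra.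
  have := nrm_cvgC (ha w wr); rewrite wz => h.
  have [N0 _ hN0] : \forall n \near \oo, nrm (series (fun n => a n * toC s ^+ n) n - f w) <= 1.
    move/cvgrPdist_lt: h => /(_ 1 ltr01); apply: filterS => n.
    by rewrite sub0r normrN ger0_norm ?nrm_ge0 // => /ltW.
  (* From [N0] on, consecutive partial sums are both within 1 of the limit, so a term is at most
     2. *)
  exists (2 + \sum_(i < N0) nrm (a i) * s ^+ i) => n.
  have S0 : 0 <= \sum_(i < N0) nrm (a i) * s ^+ i.
    by apply: sumr_ge0 => i _; rewrite mulr_ge0 ?nrm_ge0 ?exprn_ge0 // ltW.
  have [nN|Nn] := ltnP n N0.
    have := @le_sum_one R _ (fun i : 'I_N0 => nrm (a i) * s ^+ i) (Ordinal nN).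
    move=> /= hh; apply: le_trans (hh _) _ => [j|]; last by lra.
    by rewrite mulr_ge0 ?nrm_ge0 ?exprn_ge0 // ltW.
  have h1 := hN0 n Nn; have h2 := hN0 n.+1 (leqW Nn).
  have -> : nrm (a n) * s ^+ n = nrm (a n * toC s ^+ n) by rewrite nrmM nrmX nrm_toC gtr0_norm.
  rewrite !seriesE in h1 h2; rewrite big_ord_recr /= in h2.
  set x := \sum_(i < n) _ in h1 h2; set y := a n * _ in h2 *; set v := f _ in h1 h2.
  have := nrmB (x + y - v) (x - v).
  have -> : x + y - v - (x - v) = y by ring.
  by lra.
exists (s / 2); first by rewrite divr_gt0.
exists (2 * B / s ^+ N) => h hs; have h0 := nrm_ge0 h.
have hz : `|z + h - z| < r by rewrite addrC addKr nrmE rE toC_lt; rewrite /s in hs; lra.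
have cv := ha _ hz; have eh : z + h - z = h by rewrite addrC addKr.
rewrite eh in cv.
have B0 : 0 <= B by apply: le_trans (hB 0%N); rewrite mulr_ge0 ?nrm_ge0 ?exprn_ge0 // ltW.
have sN0 : 0 < s ^+ N by rewrite exprn_gt0.
have term n : nrm (a n * h ^+ n) <= B * (nrm h / s) ^+ n.
  have sn0 : 0 < s ^+ n by rewrite exprn_gt0.
  rewrite nrmM nrmX expr_div_n.
  have -> : nrm (a n) * nrm h ^+ n = nrm (a n) * s ^+ n * (nrm h ^+ n / s ^+ n).
    by field; rewrite gt_eqF.
  by apply: ler_wpM2r (hB n); rewrite divr_ge0 ?exprn_ge0 // ltW.
have part n : (N <= n)%N -> nrm (series (fun n => a n * h ^+ n) n - (\poly_(j < N) a j).[h])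
    <= 2 * B / s ^+ N * nrm h ^+ N.
  move=> Nn; rewrite seriesE horner_poly -(subnKC Nn) big_split_ord /= [X in nrm X]addrAC subrr add0r.
  apply: le_trans (nrm_sum _ _ _) _.
  apply: (@le_trans _ _ (\sum_(i < n - N) B * (nrm h / s) ^+ N * (1 / 2) ^+ i)).
    apply: ler_sum => i _; apply: le_trans (term _) _; rewrite exprD mulrA ler_wpM2l //.
      by rewrite mulr_ge0 ?exprn_ge0 ?divr_ge0 // ltW.
    have hs2 : nrm h / s <= 1 / 2 by rewrite ler_pdivrMr //; lra.
    by apply: lerXn2r; rewrite // nnegrE divr_ge0 // ltW.
  have half : 0 <= (1 / 2 : R) < 1 by apply/andP; split; lra.
  rewrite -mulr_sumr; apply: le_trans (ler_wpM2l _ (geom_sum_le _ half)) _.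
    by rewrite mulr_ge0 ?exprn_ge0 ?divr_ge0 // ltW.
  rewrite le_eqVlt; apply/orP; left; apply/eqP; rewrite expr_div_n; field.
  by rewrite gt_eqF.
have cv2 : (fun n => nrm (series (fun n => a n * h ^+ n) n - (\poly_(j < N) a j).[h])) @ \oo
   --> nrm (f (z + h) - (\poly_(j < N) a j).[h]).
  by apply: cvg_nrm; apply: cvgCB cv (@cvg_cstC _ _).
by apply: (cvgn_le_cst cv2); exists N.
Qed.

Lemma analytic_jets f z : analytic_at f z -> forall N, exists p, jet_at N f z p.
Proof. by move=> [r [r0 [a ha]]] N; exists (\poly_(j < N) a j); exact: analytic_jet r0 ha. Qed.

(** [X^L - 1] splits and is separable, and [L] distinct [L]-th roots of unity include a primitive
    one. *)
Lemma prim_root_exists L : (0 < L)%N -> exists x : C, L.-primitive_root x.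
Proof.
move=> L0; pose p : {poly C} := 'X^L - 1; have [s Dp] := closed_field_poly_normal p.
rewrite (monicP _) ?monicXnsubC // scale1r in Dp.
have s1 : all L.-unity_root s by apply/allP => z; rewrite -root_prod_XsubC -Dp.
have sz : (L < (size s).+1)%N by rewrite -(size_prod_XsubC s id) -Dp size_XnsubC.
have us : uniq s by rewrite -separable_prod_XsubC -Dp separable_Xn_sub_1 // pnatr_eq0 -lt0n.
by have /hasP[x _ hx] := has_prim_root L0 s1 us sz; exists x.
Qed.

Section RootsOfUnity.
Variables (L : nat) (x : C).
Hypothesis px : L.-primitive_root x.

Lemma nrm_prim_root : nrm x = 1.
Proof.
have L0 := prim_order_gt0 px; apply/eqP; rewrite -(@eqrXn2 _ L) ?nrm_ge0 //.
by rewrite -nrmX (prim_expr_order px) nrm1 expr1n.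
Qed.

Lemma root_sum (j m : nat) :
  \sum_(k < L) (x ^+ k) ^+ j * ((x ^+ k) ^+ m)^* = if (j == m %[mod L])%N then L%:R else 0.
Proof.
have xc : x * x^* = 1 by rewrite mul_conj nrm_prim_root expr1n.
pose y := x ^+ j * (x ^+ m)^*.
have -> : \sum_(k < L) (x ^+ k) ^+ j * ((x ^+ k) ^+ m)^* = \sum_(k < L) y ^+ k.
  apply: eq_bigr => k _; rewrite /y exprMn -!rmorphXn /= -!exprM.
  by rewrite [(k * j)%N]mulnC [(k * m)%N]mulnC.
have xmc : (x ^+ m)^* * x ^+ m = 1 by rewrite rmorphXn /= -exprMn mulrC xc expr1n.
have yE : (y == 1) = (j == m %[mod L])%N.
  rewrite -(eq_prim_root_expr px); apply/eqP/eqP => [e|e]; last by rewrite /y e mulrC.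
  by rewrite -[LHS]mulr1 -xmc mulrA -/y e mul1r.
rewrite -yE; case: eqP => [->|/eqP y1].
  by under eq_bigr do rewrite expr1n; rewrite sumr_const card_ord.
have yL : y ^+ L = 1.
  rewrite /y exprMn -rmorphXn /= -!exprM mulnC exprM (prim_expr_order px) expr1n mul1r.
  by rewrite mulnC exprM (prim_expr_order px) expr1n conjC1.
have := subrX1 y L; rewrite yL subrr => /esym/eqP; rewrite mulf_eq0 subr_eq0 (negbTE y1) /=.
by move/eqP.
Qed.

Lemma discrete_parseval (c : nat -> C) :
  \sum_(k < L) nrm (\sum_(n < L) c n * (x ^+ k) ^+ n) ^+ 2 = L%:R * \sum_(n < L) nrm (c n) ^+ 2.
Proof.
apply: toC_inj; rewrite toC_sum toCM toC_sum.
under eq_bigr do rewrite -mul_conj rmorph_sum /= mulr_suml.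
rewrite exchange_big /= mulr_sumr; apply: eq_bigr => n _.
under eq_bigr do rewrite mulr_sumr.
rewrite exchange_big /= (bigD1 n) //= [X in _ + X]big1 => [|m mn]; last first.
  under eq_bigr => k _ do rewrite rmorphM mulrACA.
  rewrite -mulr_sumr root_sum !modn_small // ifN ?mulr0 //.
  by move: mn; rewrite eq_sym.
under eq_bigr => k _ do rewrite rmorphM mulrACA.
rewrite -mulr_sumr root_sum eqxx addr0 mul_conj mulrC; congr (_ * _).
by rewrite toC_nat.
Qed.
End RootsOfUnity.

(* The mean of [x^(-k m) P(x^k z)] over the [L]-th roots of unity is
   [p_m z^m + O(z^(m + L))], to which the maximum principle applies. *)
Lemma coef_extract L (x : C) P m p r D : L.-primitive_root x -> (3 <= L)%N -> (m < L)%N -> 0 < r ->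
  (forall z, nrm z <= r -> exists p, jet_at 3 P z p) -> jet_at (m + L) P 0 p ->
  (forall z, nrm z = r -> \sum_(k < L) nrm (P (x ^+ k * z)) <= L%:R * D) ->
  nrm p`_m <= D / r ^+ m.
Proof.
move=> px L3 mL r0 jP j0 PB.
have L0 : (0 < L)%N by exact: prim_order_gt0 px.
have LR0 : 0 < L%:R :> R by rewrite ltr0n.
have nx k : nrm (x ^+ k) = 1 by rewrite nrmX (nrm_prim_root px) expr1n.
pose F z := L%:R^-1 * \sum_(k < L) ((x ^+ k) ^+ m)^* * P (x ^+ k * z).
have jetF N z (pk : 'I_L -> {poly C}) : (forall k : 'I_L, jet_at N P (x ^+ k * z) (pk k)) ->
    jet_at N F z ((L%:R^-1)%:P * \sum_(k < L) ((((x ^+ k) ^+ m)^*)%:P * (pk k \Po (x ^+ k *: 'X)))).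
  move=> hk; apply: jet_atM; first exact: jet_at_cst.
  apply: jet_at_sum => k; apply: jet_atM; first exact: jet_at_cst.
  by apply: jet_at_scale.
have jF z : nrm z <= r -> exists q, jet_at 3 F z q.
  move=> zr; have ex (k : 'I_L) : exists q, jet_at 3 P (x ^+ k * z) q.
    by apply: jP; rewrite nrmM nx mul1r.
  have [pk hpk] := choice ex.
  by eexists; apply: jetF hpk.
(* The average keeps the degrees congruent to [m] modulo [L]. As [m < L], the only one below [m + L]
   is [m] itself. *)
have jF0 : jet_at (m + 3) F 0 ('X^m * (p`_m)%:P).
  apply: (@jet_at_mono _ (m + L)); first by rewrite leq_add2l.
  have := jetF (m + L)%N 0 (fun=> take_poly (m + L) p); set q := (_ * _).
  suff -> : q = 'X^m * (p`_m)%:P.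
    by apply=> k; rewrite mulr0; apply: jet_at_take j0.
  apply/polyP => j; rewrite /q coefCM coef_sum.
  under eq_bigr => k _ do rewrite coefCM.
  have coefk (k : 'I_L) : (take_poly (m + L) p \Po (x ^+ k *: 'X))`_j = (take_poly (m + L) p)`_j * (x ^+ k) ^+ j.
    rewrite comp_polyE coef_sum.
    have e (i : nat) : (x ^+ k *: 'X) ^+ i = ((x ^+ k) ^+ i)%:P * 'X^i :> {poly C}.
      by rewrite exprZn mul_polyC.
    under eq_bigr => i _ do rewrite coefZ e coefCM coefXn.
    have [js|sj] := ltnP j (size (take_poly (m + L) p)).
      rewrite (bigD1 (Ordinal js)) //= eqxx mulr1 big1 ?addr0 // => i ij.
      by rewrite eq_sym (_ : (val i == j) = false) ?mulr0 ?mulr0 //; apply: negbTE ij.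
    rewrite nth_default // mul0r big1 // => i _.
    by rewrite gtn_eqF ?mulr0 ?mulr0 // (leq_trans _ sj).
  under eq_bigr => k _ do rewrite coefk mulrCA [_^* * _]mulrC.
  rewrite -mulr_sumr (root_sum px) coef_take_poly coefMC coefXn.
  have [jmL|] := ltnP j (m + L); last first.
    move=> mLj; rewrite mul0r mulr0 gtn_eqF ?mul0r //.
    by apply: leq_trans mLj; rewrite -addn1 leq_add2l.
  case: (eqVneq j m) => [->|jm].
    by rewrite eqxx mul1r mulrC mulfK // pnatr_eq0 -lt0n.
  rewrite mul0r ifN ?mulr0 ?mulr0 //; apply: contra jm.
  have [jl|Lj] := ltnP j L; first by rewrite !modn_small.
  have jLm : (j - L < m)%N by rewrite ltn_subLR // addnC.
  rewrite -(subnK Lj) modnDr !modn_small //; last exact: ltn_trans jLm mL.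
  by rewrite ltn_eqF.
have FB z : nrm z = r -> nrm (F z) <= D.
  move=> zr; rewrite nrmM nrmV.
  have -> : nrm (L%:R : C) = L%:R :> R.
    by rewrite -toC_nat nrm_toC gtr0_norm.
  rewrite mulrC ler_pdivrMr // mulrC; apply: le_trans (PB z zr).
  apply: le_trans (nrm_sum _ _ _) _; apply: ler_sum => k _.
  by rewrite nrmM nrm_conj nrmX nx expr1n mul1r.
by have [] := max_principle_div r0 jF jF0 FB; rewrite hornerC.
Qed.
End TaylorCoefficients.

(** Bernoulli's inequality at [r = 1 - d], with [m d] at most [(1 - x) / 2]. It replaces letting [r]
    tend to 1. *)
Lemma near_one_pow (R : realType) (m : nat) (x : R) : x < 1 -> exists2 r : R, 0 < r < 1 & x < r ^+ m.
Proof.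
move=> x1; have k0 : 0 < 2 * (m.+1)%:R :> R by rewrite mulr_gt0.
pose d := Num.min (1 / 2) ((1 - x) / (2 * (m.+1)%:R)).
have d0 : 0 < d by rewrite lt_min divr_gt0 //= divr_gt0 // subr_gt0.
have : d <= d by []; rewrite {2}/d le_min => /andP[d1 d2]; move: d2; rewrite ler_pdivlMr // => d2.
have low n : 1 - n%:R * d <= (1 - d) ^+ n.
  elim: n => [|n ih]; first by rewrite mul0r subr0 expr0.
  rewrite exprS -natr1; apply: le_trans (_ : (1 - d) * (1 - n%:R * d) <= _).
    have : 0 <= n%:R * d * d by rewrite !mulr_ge0 // ltW.
    by lra.
  by rewrite ler_wpM2l //; lra.
exists (1 - d); first by apply/andP; split; lra.
apply: lt_le_trans (low m); move: d2.
have -> : (m.+1)%:R = m%:R + 1 :> R by rewrite natr1.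
have : 0 <= m%:R * d by rewrite mulr_ge0 // ltW.
by lra.
Qed.

(** * Schur functions and their Taylor coefficients *)

Section SchurTaylor.
Variable R : realType.
Local Notation C := (Cplx R).

Lemma cvnorm_le m n (x : 'cV[C]_m) (y : 'cV[C]_n) : (cvnorm x <= cvnorm y) = (cvsq x <= cvsq y).
Proof.
have e l (v : 'cV[C]_l) : \sum_(i < l) `|v i 0| ^+ 2 = toC (cvsq v).
  by rewrite toC_sum; apply: eq_bigr => i _; rewrite nrmE toCX.
by rewrite /cvnorm !e ler_sqrtC ?qualifE /= -?toC0 ?toC_le ?cvsq_ge0.
Qed.

Variables (m q : nat) (s : C -> 'M[C]_(m, q)).
Hypothesis sS : schur_function s.

Lemma schur_contr z x : nrm z < 1 -> cvsq (s z *m x) <= cvsq x.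
Proof. by rewrite -nrm_lt1 => /sS[_ /(_ x)]; rewrite cvnorm_le. Qed.

Lemma schur_jets i j z N : nrm z < 1 -> exists p, jet_at N (fun w => s w i j) z p.
Proof. by rewrite -nrm_lt1 => /sS[/(_ i j) h _]; exact: analytic_jets h N. Qed.

(** Jets of all orders at 0, which say nothing yet about convergence away from 0; that is
    [schur_taylor]. *)
Definition taylor_coefs (S : nat -> 'M[C]_(m, q)) :=
  forall N i j, jet_at N (fun w => s w i j) 0 (\poly_(n < N) S n i j).

Lemma schur_coefs : exists S, taylor_coefs S.
Proof.
have z0 : unit_disk (0 : C) by rewrite /unit_disk /= normr0.
have [h _] := sS z0.
have ex (ij : 'I_m * 'I_q) : exists a : nat -> C, forall N,
    jet_at N (fun w => s w ij.1 ij.2) 0 (\poly_(n < N) a n).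
  by have [r [r0 [a ha]]] := h ij.1 ij.2; exists a => N; exact: analytic_jet r0 ha.
have [a ha] := choice ex.
exists (fun n => \matrix_(i, j) a (i, j) n) => N i j.
have := ha (i, j) N; congr jet_at.
by apply/polyP => k; rewrite !coef_poly mxE.
Qed.

Variable S : nat -> 'M[C]_(m, q).
Hypothesis hS : taylor_coefs S.

(* Pair [s U] with its own first Taylor coefficients: with
   [P = sum_i Qr_i (s U)_i], [Qr_i] the reversed conjugate Taylor polynomial,
   the coefficient of [P] of order [N] is the sum to be bounded, and
   on circles [2 |P| <= |Qr|^2 + |U|^2]. *)
Lemma toeplitz_contraction (u : nat -> 'cV[C]_q) N :
  \sum_(n < N) cvsq (\sum_(k < n.+1) S k *m u (n - k)%N) <= \sum_(n < N) cvsq (u n).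
Proof.
case: N => [|N]; first by rewrite !big_ord0.
(* [L > N] makes Parseval over the [L]-th roots of unity exact for polynomials of degree at most
   [N]; [L >= 3] is the order the maximum principle needs. *)
pose L := (N + 3)%N; have L3 : (3 <= L)%N by rewrite /L leq_addl.
have NL : (N < L)%N by rewrite /L -addn1 leq_add2l.
have N1L : (N < N + L)%N by rewrite -addn1 leq_add2l (leq_trans _ L3).
have [x px] := prim_root_exists R (leq_trans (ltn0Sn 2) L3).
have nx k : nrm (x ^+ k) = 1 by rewrite nrmX (nrm_prim_root px) expr1n.
pose U j : {poly C} := \poly_(n < N.+1) u n j 0.
pose G i : {poly C} := \sum_j (\poly_(n < N + L) S n i j) * U j.
pose g i z := \sum_j s z i j * (U j).[z].
pose Qr i : {poly C} := \poly_(n < N.+1) ((G i)`_(N - n))^*.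
pose P z := \sum_i (Qr i).[z] * g i z.
have GE i n : (n < N.+1)%N -> (G i)`_n = (\sum_(k < n.+1) S k *m u (n - k)%N) i 0.
  move=> nN; rewrite coef_sum summxE.
  under eq_bigr do rewrite coefM.
  rewrite exchange_big /=; apply: eq_bigr => k _; rewrite mxE; apply: eq_bigr => j _.
  rewrite !coef_poly (leq_ltn_trans (leq_subr _ _) nN).
  by rewrite (leq_trans (ltn_ord k) (leq_trans nN N1L)).
pose gam := \sum_(n < N.+1) \sum_i nrm ((G i)`_n) ^+ 2.
have -> : \sum_(n < N.+1) cvsq (\sum_(k < n.+1) S k *m u (n - k)%N) = gam.
  by apply: eq_bigr => n _; apply: eq_bigr => i _; rewrite GE.
pose ups := \sum_(n < N.+1) cvsq (u n).
have jg M i z : nrm z < 1 -> exists p, jet_at M (g i) z p.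
  move=> z1; have ex j : exists p, jet_at M (fun w => s w i j * (U j).[w]) z p.
    have [p jp] := schur_jets i j M z1.
    by eexists; apply: jet_atM jp (jet_at_poly _ _ _).
  have [pj hp] := choice ex.
  by eexists; apply: (jet_at_sum (index_enum 'I_q) hp).
have jP z : nrm z < 1 -> exists p, jet_at 3 P z p.
  move=> z1; have ex i : exists p, jet_at 3 (fun w => (Qr i).[w] * g i w) z p.
    have [p jp] := jg 3%N i z z1.
    by eexists; apply: jet_atM (jet_at_poly _ _ _) jp.
  have [pj hp] := choice ex.
  by eexists; apply: (jet_at_sum (index_enum 'I_m) hp).
have jP0 : jet_at (N + L) P 0 (\sum_i Qr i * G i).
  have jp p : jet_at (N + L) (fun w => p.[w]) 0 p.
    by have := jet_at_poly (N + L) p 0; rewrite polyC0 addr0 comp_polyXr.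
  apply: jet_at_sum => i; apply: jet_atM; first exact: jp.
  by apply: jet_at_sum => j; apply: jet_atM; [exact: hS|exact: jp].
have coefP : (\sum_i Qr i * G i)`_N = toC gam.
  rewrite coef_sum toC_sum [RHS](eq_bigr (fun n : 'I_N.+1 => \sum_i toC (nrm (G i)`_n ^+ 2))); last first.
    by move=> n _; rewrite toC_sum.
  rewrite [RHS]exchange_big /=; apply: eq_bigr => i _; rewrite coefMr.
  apply: eq_bigr => k _; rewrite coef_poly ltnS leq_subr subKn ?leq_ord //.
  by rewrite mulrC mul_conj.
have bound r z : 0 < r < 1 -> nrm z = r ->
    \sum_(k < L) nrm (P (x ^+ k * z)) <= L%:R * ((gam + ups) / 2).
  move=> /andP[r0 r1] zr.
  have nz k : nrm (x ^+ k * z) < 1 by rewrite nrmM nx mul1r zr.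
  have pars (c : nat -> C) : \sum_(k < L) nrm ((\poly_(n < N.+1) c n).[x ^+ k * z]) ^+ 2
      <= L%:R * \sum_(n < N.+1) nrm (c n) ^+ 2.
    pose c' n := (if (n < N.+1)%N then c n else 0) * z ^+ n.
    have -> : \sum_(k < L) nrm ((\poly_(n < N.+1) c n).[x ^+ k * z]) ^+ 2 =
       \sum_(k < L) nrm (\sum_(n < L) c' n * (x ^+ k) ^+ n) ^+ 2.
      apply: eq_bigr => k _; congr (nrm _ ^+ 2).
      have sL : (size (\poly_(n < N.+1) c n) <= L)%N.
        by apply: leq_trans (size_poly _ _) _.
      rewrite (horner_coef_wide _ sL); apply: eq_bigr => n _.
      by rewrite coef_poly exprMn /c' -mulrA [z ^+ n * _]mulrC.
    rewrite (discrete_parseval px) ler_wpM2l // -(subnKC NL) big_split_ord /=.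
    rewrite [X in _ + X]big1 ?addr0 => [|n _]; last first.
      by rewrite /c' ifN ?mul0r ?nrm0 ?expr0n // -leqNgt leq_addr.
    apply: ler_sum => n _; rewrite /c' ltn_ord nrmM exprMn ler_piMr ?sqr_ge0 //.
    by rewrite exprn_ile1 ?nrm_ge0 // nrmX exprn_ile1 ?nrm_ge0 // zr ltW.
  have step k : 2 * nrm (P (x ^+ k * z)) <=
      \sum_i nrm ((Qr i).[x ^+ k * z]) ^+ 2 + \sum_j nrm ((U j).[x ^+ k * z]) ^+ 2.
    set w := x ^+ k * z.
    apply: (@le_trans _ _ (\sum_i nrm ((Qr i).[w]) ^+ 2 + \sum_i nrm (g i w) ^+ 2)).
      rewrite -big_split /= -ler_pdivlMl //; apply: le_trans (nrm_sum _ _ _) _.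
      rewrite mulr_sumr; apply: ler_sum => i _; rewrite nrmM.
      by have := sqr_ge0 (nrm ((Qr i).[w]) - nrm (g i w)); lra.
    rewrite lerD2l; have := schur_contr (\col_j (U j).[w]) (nz k).
    have -> : cvsq (s w *m \col_j (U j).[w]) = \sum_i nrm (g i w) ^+ 2.
      apply: eq_bigr => i _; rewrite mxE /g; congr (nrm _ ^+ 2).
      by apply: eq_bigr => j _; rewrite mxE.
    by rewrite /cvsq; under [X in _ <= X -> _]eq_bigr do rewrite mxE.
  have h1 : \sum_(k < L) \sum_i nrm ((Qr i).[x ^+ k * z]) ^+ 2 <= L%:R * gam.
    rewrite exchange_big /= /gam [X in _ <= _ * X]exchange_big /= mulr_sumr; apply: ler_sum => i _.
    apply: le_trans (pars _) _; rewrite ler_wpM2l // le_eqVlt; apply/orP; left; apply/eqP.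
    rewrite (reindex_inj rev_ord_inj) /=; apply: eq_bigr => n _.
    by rewrite nrm_conj subSS subKn // leq_ord.
  have h2 : \sum_(k < L) \sum_j nrm ((U j).[x ^+ k * z]) ^+ 2 <= L%:R * ups.
    rewrite exchange_big /= /ups [X in _ <= _ * X]exchange_big /= mulr_sumr; apply: ler_sum => j _.
    exact: pars.
  have h3 : 2 * \sum_(k < L) nrm (P (x ^+ k * z)) <= L%:R * gam + L%:R * ups.
    rewrite mulr_sumr; apply: le_trans (lerD h1 h2); rewrite -big_split /=.
    by apply: ler_sum => k _; exact: step.
  by lra.
have gam0 : 0 <= gam by apply: sumr_ge0 => n _; apply: sumr_ge0 => i _; exact: sqr_ge0.
have key r : 0 < r < 1 -> gam * r ^+ N <= (gam + ups) / 2.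
  move=> r01; have /andP[r0 r1] := r01.
  have jPr z : nrm z <= r -> exists p, jet_at 3 P z p by move=> zr; apply: jP; lra.
  have := coef_extract px L3 NL r0 jPr jP0 (fun z zr => bound r z r01 zr).
  by rewrite coefP nrm_toC ger0_norm // ler_pdivlMr ?exprn_gt0.
(* As [r] tends to 1, [key] would give [gam <= (gam + ups) / 2], so [gam <= ups]; one [r] close
   enough to 1 yields the contradiction. *)
rewrite -/ups leNgt; apply/negP => lt.
have gp : 0 < gam by apply: le_lt_trans lt; apply: sumr_ge0 => n _; exact: cvsq_ge0.
have [r r01 hr] : exists2 r, 0 < r < 1 & (gam + ups) / 2 / gam < r ^+ N.
  by apply: near_one_pow; rewrite ltr_pdivrMr // mul1r; lra.
by have := key r r01; move: hr; rewrite ltr_pdivrMr // mulrC; lra.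
Qed.

(** An input concentrated at index 0 produces the outputs [S n *m x]. *)
Lemma schur_coef_contr n x : cvsq (S n *m x) <= cvsq x.
Proof.
have c0 l : cvsq (0 : 'cV[C]_l) = 0 by rewrite /cvsq big1 // => i _; rewrite mxE nrm0 expr0n.
have e l : \sum_(k < l.+1) S k *m (if (l - k)%N == 0%N then x else 0) = S l *m x.
  rewrite big_ord_recr /= subnn eqxx big1 ?add0r // => k _.
  by rewrite subn_eq0 leqNgt ltn_ord mulmx0.
have h := toeplitz_contraction (fun k => if k == 0%N then x else 0) n.+1.
rewrite [X in _ <= X]big_ord_recl [X in _ <= _ + X]big1 ?addr0 in h => [|i _]; last exact: c0.
apply: le_trans h; rewrite big_ord_recr /= e lerDr.
by apply: sumr_ge0 => i _; exact: cvsq_ge0.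
Qed.

Lemma cv_coef_le l (y : 'cV[C]_l) i : nrm (y i 0) ^+ 2 <= cvsq y.
Proof. by apply: (le_sum_one (F := fun i => nrm (y i 0) ^+ 2)) => j; exact: sqr_ge0. Qed.

Lemma contr_entry_le (A : 'M[C]_(m, q)) : (forall x, cvsq (A *m x) <= cvsq x) ->
  forall i j, nrm (A i j) <= 1.
Proof.
move=> hA i j; rewrite -(@ler_pXn2r _ 2) ?nnegrE ?nrm_ge0 // expr1n.
have := hA (delta_mx j 0); rewrite cvsq_delta -colE; apply: le_trans.
by have := cv_coef_le (col j A) i; rewrite mxE.
Qed.

(** Subtracting the Taylor polynomial of length [N] leaves a zero of order [N] at 0 and, on
    [|w| = r], a bound [1 + N] since all entries have modulus at most 1. With [|z| < r < 1],
    [max_principle_div] bounds the difference at [z] by [(1 + N) (|z| / r)^N]. *)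
Lemma schur_taylor i j z : nrm z < 1 -> s z i j = ps_eval (fun n => S n i j) z.
Proof.
move=> z1; symmetry; apply: ps_lim; apply: cvgC_nrm.
pose r := (1 + nrm z) / 2; have z0 := nrm_ge0 z.
have r0 : 0 < r by rewrite /r; lra.
have r1 : r < 1 by rewrite /r; lra.
have zr : nrm z < r by rewrite /r; lra.
have t01 : 0 <= nrm z / r < 1 by apply/andP; split; [rewrite divr_ge0 // ltW|rewrite ltr_pdivrMr // mul1r].
have c1 n : nrm (S n i j) <= 1 by apply: contr_entry_le; exact: schur_coef_contr.
have s1 w : nrm w < 1 -> nrm (s w i j) <= 1.
  by move=> w1; apply: contr_entry_le => x; exact: schur_contr.
have key N : nrm (\sum_(n < N) S n i j * z ^+ n - s z i j) <= (1 + N%:R) * (nrm z / r) ^+ N.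
  pose T : {poly C} := \poly_(n < N) S n i j.
  pose F w := s w i j + - 1 * T.[w].
  have jF M w : nrm w < 1 -> exists p, jet_at M F w p.
    move=> w1; have [p jp] := schur_jets i j M w1.
    eexists; apply: jet_atD jp _; apply: jet_atM; [exact: jet_at_cst|exact: jet_at_poly].
  have jF0 : jet_at (N + 3) F 0 ('X^N * \poly_(k < 3) S (N + k)%N i j).
    have := jet_atD (hS (N + 3) i j) (jet_atM (jet_at_cst (N + 3) (-1) 0) (jet_at_poly (N + 3) T 0)).
    rewrite polyC0 addr0 comp_polyXr; congr jet_at; apply/polyP => k.
    rewrite coefD coefCM !coef_poly coefXnM coef_poly mulN1r.
    have [kN|Nk] := ltnP k N; first by rewrite (leq_trans kN) ?leq_addr // subrr.
    by rewrite subr0 -ltn_subLR ?subnKC // ltn_subLR.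
  have FB w : nrm w = r -> nrm (F w) <= 1 + N%:R.
    move=> wr; have w1 : nrm w < 1 by rewrite wr.
    apply: le_trans (nrmD _ _) _; apply: lerD; first exact: s1.
    rewrite nrmM nrmN nrm1 mul1r horner_poly; apply: le_trans (nrm_sum _ _ _) _.
    rewrite -[N in leRHS]card_ord -sum1_card natr_sum; apply: ler_sum => n _.
    rewrite nrmM nrmX -[1]mulr1; apply: ler_pM; rewrite ?nrm_ge0 ?exprn_ge0 ?nrm_ge0 //.
    by rewrite exprn_ile1 ?nrm_ge0 // ltW.
  have jFr w : nrm w <= r -> exists p, jet_at 3 F w p by move=> wr; apply: jF; lra.
  have [_ /(_ z (ltW zr))] := max_principle_div r0 jFr jF0 FB.
  by rewrite /F mulN1r horner_poly nrmC.
have h0 : (fun N => (nrm z / r) ^+ N + N%:R * (nrm z / r) ^+ N) @ \oo --> (0 : R).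
  by rewrite -[0]addr0; apply: cvgD; [exact: cvg_geom|exact: cvg_mul_geom].
by apply: squeeze0 h0 => N; rewrite nrm_ge0 /=; have := key N; rewrite mulrDl mul1r.
Qed.
End SchurTaylor.

(** * The case [b(z) = z] *)

Section MatrixLimits.
Variable R : realType.
Local Notation C := (Cplx R).

Lemma cvg_mxP m n (F : nat -> 'M[C]_(m, n)) (l : 'M[C]_(m, n)) :
  F @ \oo --> l <-> forall i j, (fun N => F N i j) @ \oo --> l i j.
Proof.
split=> [h i j P Pl|h A [B lB BA]].
  apply: (h [set X : 'M[C]_(m, n) | P (X i j)]).
  exists (fun i' j' => [set x | i' = i /\ j' = j -> P x]) => [i' j'|X /= hX].
    have [[-> ->]|ne] := pselect (i' = i /\ j' = j).
      by apply: filterS Pl => x Px _.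
    by apply: filterS filterT => x _ /ne.
  exact: hX.
have : \forall N \near \oo, forall ij : 'I_m * 'I_n, B ij.1 ij.2 (F N ij.1 ij.2).
  by apply: filter_forall => -[i j]; apply: h; exact: lB.
by apply: filterS => N hN; apply: BA => i j; exact: (hN (i, j)).
Qed.

Lemma mx_limit_entry m n (F : nat -> 'M[C]_(m, n)) (l : 'M[C]_(m, n)) :
  (forall i j, (fun N => F N i j) @ \oo --> l i j) -> limn F = l.
Proof.
move=> /cvg_mxP h; have /cvg_mxP h2 : F @ \oo --> limn F by exact: cvgP h.
by apply/matrixP => i j; apply: limC_unique (h2 i j) _; move: h => /cvg_mxP.
Qed.

Lemma mxps_evalE m n (H : nat -> 'M[C]_(m, n)) B z : nrm z < 1 ->
  (forall i j, bounded_seq (fun k => H k i j) B) ->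
  mxps_eval H z = \matrix_(i, j) ps_eval (fun k => H k i j) z.
Proof.
move=> z1 HB; apply: mx_limit_entry => i j; rewrite mxE.
have h := ps_cvg (HB i j) z1.
suff -> : (fun N => series (fun k => z ^+ k *: H k) N i j) =
  (fun N => \sum_(k < N) H k i j * z ^+ k) by exact: h.
apply/funext => N; rewrite seriesE summxE; apply: eq_bigr => k _.
by rewrite mxE mulrC.
Qed.

Lemma cvsq0P n (x : 'cV[C]_n) : cvsq x = 0 -> x = 0.
Proof.
move=> x0; apply/matrixP => i j; rewrite ord1 mxE; apply/eqP.
rewrite -nrm_eq0 -sqrf_eq0 eq_le sqr_ge0 andbT -x0.
exact: cv_coef_le.
Qed.

(** A kernel vector satisfies [x = z A x], so [|x|^2 <= |z|^2 |x|^2]. The transposes are there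
    because [kermx] is made of row vectors. *)
Lemma resolvent_unitmx n (A : 'M[C]_n) z : nrm z < 1 ->
  (forall x, cvsq (A *m x) <= cvsq x) -> 1%:M - z *: A \in unitmx.
Proof.
move=> z1 hA; rewrite -unitmx_tr -row_free_unit -kermx_eq0.
apply/eqP/row_matrixP => i; rewrite row0; set u := row i _.
have : u *m (1%:M - z *: A)^T = 0 by rewrite -row_mul mulmx_ker row0.
move=> /(congr1 trmx); rewrite trmx_mul trmxK trmx0 mulmxBl mul1mx => /eqP.
rewrite subr_eq0 -scalemxAl => /eqP e.
have x0 : cvsq u^T = 0.
  have h := hA u^T; have := cvsqZ z (A *m u^T); rewrite -e => e2.
  have z2 : nrm z ^+ 2 < 1 by rewrite exprn_ilt1 ?nrm_ge0.
  have := cvsq_ge0 u^T; have := cvsq_ge0 (A *m u^T).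
  move: (nrm z ^+ 2) (cvsq u^T) (cvsq (A *m u^T)) (sqr_ge0 (nrm z)) z2 e2 h => t a b t0 t1 e2 h b0 a0.
  by apply/eqP; rewrite eq_le a0 andbT; nra.
by rewrite -[u]trmxK (cvsq0P x0) trmx0.
Qed.

Lemma cvsq_col_mx m n (x : 'cV[C]_m) (y : 'cV[C]_n) : cvsq (col_mx x y) = cvsq x + cvsq y.
Proof.
rewrite /cvsq big_split_ord /=; congr (_ + _); apply: eq_bigr => i _.
  by rewrite col_mxEu.
by rewrite col_mxEd.
Qed.

End MatrixLimits.

Section Causal.
Variable T : Type.

(** Entry [n] of the iterates is constant from the iterate [n.+1] on. This solves feedback equations
    between power series coefficient by coefficient. *)
Lemma causal_fixpoint (t0 : T) (Phi : (nat -> T) -> nat -> T) :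
  (forall u v n, (forall k, (k < n)%N -> u k = v k) -> Phi u n = Phi v n) ->
  exists u, forall n, u n = Phi u n.
Proof.
move=> cPhi; pose u n := iter n.+1 Phi (fun=> t0) n.
have stable n k k' : (n < k)%N -> (n < k')%N ->
    iter k Phi (fun=> t0) n = iter k' Phi (fun=> t0) n.
  elim/ltn_ind: n k k' => n ih [//|k] [//|k'] nk nk' /=.
  by apply: cPhi => l ln; apply: ih => //; exact: leq_trans ln _.
exists u => n; rewrite {1}/u iterS; apply: cPhi => k kn; rewrite /u.
exact: stable.
Qed.
End Causal.

(** * Convolution of matrix sequences and feedback equations *)

Section Convolution.
Variable R : realType.
Local Notation C := (Cplx R).

Lemma triangle_sum (V : zmodType) n (F : nat -> nat -> V) :
  \sum_(i < n.+1) \sum_(j < i.+1) F j (i - j)%N =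
  \sum_(j < n.+1) \sum_(l < (n - j).+1) F j l.
Proof.
elim: n => [|n ih]; first by rewrite !big_ord1.
rewrite big_ord_recr /= ih [RHS]big_ord_recr /= subnn big_ord1.
rewrite [X in _ + X]big_ord_recr /= subnn addrA; congr (_ + _).
rewrite -big_split /=; apply: eq_bigr => j _.
have jn : (j <= n)%N by rewrite -ltnS.
by rewrite (subSn jn) [RHS]big_ord_recr.
Qed.

Definition mxconv m n l (a : nat -> 'M[C]_(m, n)) (b : nat -> 'M[C]_(n, l)) k :=
  \sum_(i < k.+1) a i *m b (k - i)%N.

Lemma mxconvA m n l o (a : nat -> 'M[C]_(m, n)) (b : nat -> 'M[C]_(n, l))
    (c : nat -> 'M[C]_(l, o)) k :
  mxconv (mxconv a b) c k = mxconv a (mxconv b c) k.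
Proof.
rewrite /mxconv.
have -> : \sum_(i < k.+1) (\sum_(j < i.+1) a j *m b (i - j)%N) *m c (k - i)%N =
    \sum_(i < k.+1) \sum_(j < i.+1) (a j *m b (i - j)%N *m c (k - (j + (i - j)))%N).
  apply: eq_bigr => i _; rewrite mulmx_suml; apply: eq_bigr => j _.
  by rewrite subnKC // -ltnS.
rewrite (triangle_sum k (fun j l => a j *m b l *m c (k - (j + l))%N)).
apply: eq_bigr => j _; rewrite mulmx_sumr; apply: eq_bigr => i _.
by rewrite mulmxA subnDA.
Qed.

(** Multiplication by [z], on coefficients. *)
Definition delay m n (a : nat -> 'M[C]_(m, n)) k := if k is k'.+1 then a k' else 0.

Lemma mxconv_delayl m n l (a : nat -> 'M[C]_(m, n)) (b : nat -> 'M[C]_(n, l)) k :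
  mxconv (delay a) b k = delay (mxconv a b) k.
Proof.
case: k => [|k]; first by rewrite /mxconv big_ord1 mul0mx.
by rewrite /mxconv big_ord_recl mul0mx add0r.
Qed.

Lemma mxconv_delayr m n l (a : nat -> 'M[C]_(m, n)) (b : nat -> 'M[C]_(n, l)) k :
  mxconv a (delay b) k = delay (mxconv a b) k.
Proof.
case: k => [|k]; first by rewrite /mxconv big_ord1 mulmx0.
rewrite /mxconv big_ord_recr /= subnn mulmx0 addr0; apply: eq_bigr => i _.
by rewrite subSn // -ltnS.
Qed.

Lemma mxconv_delay_sum m n l (a : nat -> 'M[C]_(m, n)) (b : nat -> 'M[C]_(n, l)) k :
  delay (mxconv a b) k = \sum_(i < k) a i *m b (k - i.+1)%N.
Proof. by case: k => [|k]; [rewrite big_ord0|]. Qed.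

(* [k = S1 + z k S2] and [U = 1 + z S2 U] give [k U = S1 U + z k S2 U] and
   [k U = k + z k S2 U]. *)
Lemma feedback_conv r q (S1 k : nat -> 'M[C]_(r, q)) (S2 U : nat -> 'M[C]_q) :
  (forall n, k n = S1 n + delay (mxconv k S2) n) ->
  (forall n, U n = (n == 0%N)%:R%:M + delay (mxconv S2 U) n) ->
  forall n, k n = mxconv S1 U n.
Proof.
move=> hk hU n.
have e1 : mxconv k U n = mxconv S1 U n + delay (mxconv (mxconv k S2) U) n.
  rewrite -mxconv_delayl /mxconv -big_split /=; apply: eq_bigr => i _.
  by rewrite -mulmxDl -hk.
have e2 : mxconv k U n = k n + delay (mxconv k (mxconv S2 U)) n.
  rewrite -mxconv_delayr /mxconv.
  have -> : \sum_(i < n.+1) k i *m U (n - i)%N =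
    \sum_(i < n.+1) (k i *m ((n - i)%N == 0%N)%:R%:M + k i *m delay (mxconv S2 U) (n - i)%N).
    by apply: eq_bigr => i _; rewrite -mulmxDr -hU.
  rewrite big_split /=; congr (_ + _).
  rewrite big_ord_recr /= subnn eqxx mulmx1 big1 ?add0r // => i _.
  by rewrite subn_eq0 leqNgt ltn_ord /= raddf0 mulmx0.
have e3 : delay (mxconv (mxconv k S2) U) n = delay (mxconv k (mxconv S2 U)) n.
  by case: (n) => // n'; exact: mxconvA.
by apply: (addIr (delay (mxconv k (mxconv S2 U)) n)); rewrite -e2 e1 e3.
Qed.

(** The relation [k = S1 + z k S2] is passed to values through partial sums, with one term fewer for
    the product because of the factor [z]; each entry of the product is a Cauchy product covered by
    [conv_cvg]. *)
Lemma feedback_eval r q (S1 k : nat -> 'M[C]_(r, q)) (S2 : nat -> 'M[C]_q) B z :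
  (forall n, k n = S1 n + delay (mxconv k S2) n) ->
  (forall i j, bounded_seq (fun n => S1 n i j) B) ->
  (forall i j, bounded_seq (fun n => S2 n i j) B) ->
  (forall i j, bounded_seq (fun n => k n i j) B) -> nrm z < 1 ->
  (\matrix_(i, j) ps_eval (fun n => k n i j) z) *m
    (1%:M - z *: \matrix_(i, j) ps_eval (fun n => S2 n i j) z) =
  \matrix_(i, j) ps_eval (fun n => S1 n i j) z.
Proof.
move=> hk b1 b2 bk z1; rewrite mulmxBr mulmx1 -scalemxAr; apply/eqP; rewrite subr_eq.
apply/eqP/matrixP => i j; rewrite !mxE.
apply: ps_lim.
have cS := ps_cvg (b1 i j) z1; rewrite -(cvg_shiftS (fun N => \sum_(n < N) S1 n i j * z ^+ n)) in cS.
have cc := cvg_sum (r := index_enum 'I_q) (fun l => conv_cvg (bk i l) (b2 l j) z1).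
have h := cvgCD cS (cvgCZ (a := z) cc).
rewrite -(cvg_shiftS (fun N => \sum_(n < N) k n i j * z ^+ n)).
have -> : \sum_k0 (\matrix_(i0, j0) ps_eval (fun n => k n i0 j0) z) i k0 *
    (\matrix_(i0, j0) ps_eval (fun n => S2 n i0 j0) z) k0 j =
  \sum_l ps_eval (fun n => k n i l) z * ps_eval (fun n => S2 n l j) z.
  by apply: eq_bigr => l _; rewrite !mxE.
suff -> : (fun N => \sum_(n < N.+1) k n i j * z ^+ n) = (fun n =>
  \sum_(n0 < n.+1) S1 n0 i j * z ^+ n0 +
  z * \sum_l \sum_(n0 < n) conv (fun n => k n i l) (fun n => S2 n l j) n0 * z ^+ n0) by exact: h.
apply/funext => N.
rewrite exchange_big /= [in RHS]big_ord_recl [in LHS]big_ord_recl -addrA; congr (_ + _).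
  by rewrite hk /= addr0.
rewrite mulr_sumr -big_split /=; apply: eq_bigr => n _.
rewrite hk /= mxE mulrDl; congr (_ + _).
rewrite /mxconv summxE exprS mulrCA; congr (_ * _); rewrite -mulr_suml; congr (_ * _).
rewrite /conv exchange_big /=; apply: eq_bigr => a _.
by rewrite mxE.
Qed.
End Convolution.

(** * The Gram matrix as a quadratic form *)

Section Gram.
Variable R : realType.
Local Notation C := (Cplx R).
Variables (p q : nat) (H : nat -> 'M[C]_(p, q)).
Hypothesis hH : mxhardy H.

Lemma trace_gram n : \tr ((H n)^t* *m H n) = toC (\sum_i \sum_j nrm (H n i j) ^+ 2).
Proof.
rewrite /mxtrace exchange_big /= toC_sum; apply: eq_bigr => j _.
rewrite mxE toC_sum; apply: eq_bigr => i _.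
by rewrite !mxE mulrC mul_conj.
Qed.

Lemma entry_hardy i j : hardy (fun n => H n i j).
Proof.
have hl := cvg_re hH; set l := re _ in hl.
have h : (fun N => \sum_(n < N) \sum_i \sum_j nrm (H n i j) ^+ 2) @ \oo --> l.
  suff -> : (fun N => \sum_(n < N) \sum_i \sum_j nrm (H n i j) ^+ 2) =
    (fun N => re (series (fun n => \tr ((H n)^t* *m H n)) N)) by exact: hl.
  by apply/funext => N; rewrite seriesE re_sum; apply: eq_bigr => n _; rewrite trace_gram.
have e0 n i' : 0 <= \sum_j nrm (H n i' j) ^+ 2.
  by apply: sumr_ge0 => j' _; exact: sqr_ge0.
apply/hardyP; exists l => N; apply: (@le_trans _ _ (\sum_(n < N) \sum_i \sum_j nrm (H n i j) ^+ 2)).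
  apply: ler_sum => n _; apply: (@le_trans _ _ (\sum_j nrm (H n i j) ^+ 2)).
    by apply: (le_sum_one (F := fun j => nrm (H n i j) ^+ 2)) => j'; exact: sqr_ge0.
  exact: (le_sum_one (F := fun i => \sum_j nrm (H n i j) ^+ 2)).
rewrite -(cvg_lim (@Rhausdorff R) h).
apply: (nondecreasing_cvgn_le (u_ := fun N => \sum_(n < N) \sum_i \sum_j nrm (H n i j) ^+ 2)).
  apply/nondecreasing_seqP => n; rewrite big_ord_recr lerDl; apply: sumr_ge0 => i' _.
  exact: e0.
by apply: cvgP h.
Qed.
Arguments entry_hardy : clear implicits.

Definition entryH i j : H2 R := toH2 (entry_hardy i j).
Definition rowH (x : 'cV[C]_q) i : H2 R := \sum_j x j 0 *: entryH i j.

Lemma H2_sumE I (s : seq I) (F : I -> H2 R) n : (\sum_(i <- s) F i) n = \sum_(i <- s) F i n.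
Proof. by apply: (big_morph (fun u : H2 R => u n)). Qed.

Lemma gramE i j : gram H i j = \sum_k dot (entryH k j) (entryH k i).
Proof.
have -> : gram H = \matrix_(i, j) \sum_k dot (entryH k j) (entryH k i); last by rewrite mxE.
apply: mx_limit_entry => i' j'; rewrite mxE.
have h := cvg_sum (r := index_enum 'I_p) (fun k => dot_cvg (entryH k j') (entryH k i')).
suff -> : (fun N => series (fun n => (H n)^t* *m H n) N i' j') =
  (fun n => \sum_k \sum_(n0 < n) entryH k j' n0 * (entryH k i' n0)^*) by exact: h.
apply/funext => N; rewrite seriesE summxE exchange_big /=; apply: eq_bigr => n _.
by rewrite mxE; apply: eq_bigr => k _; rewrite !mxE mulrC.
Qed.

Lemma gram_form (x : 'cV[C]_q) :
  (x^t* *m gram H *m x) 0 0 = toC (\sum_i re (dot (rowH x i) (rowH x i))).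
Proof.
have ip := H2_inner R.
rewrite toC_sum -mulmxA mxE.
have e k : (x^t*) 0 k * (gram H *m x) k 0 =
    \sum_i \sum_j (x k 0)^* * x j 0 * dot (entryH i j) (entryH i k).
  rewrite !mxE mulr_sumr exchange_big /=; apply: eq_bigr => j _.
  rewrite gramE mulr_suml mulr_sumr; apply: eq_bigr => i _.
  by ring.
under eq_bigr do rewrite e.
rewrite exchange_big /=; apply: eq_bigr => i _.
rewrite -(inner_sqn ip) /rowH (inner_suml ip) exchange_big /=; apply: eq_bigr => j _.
rewrite (innerZl ip) (inner_sumr ip) mulr_sumr; apply: eq_bigr => k _.
by rewrite (innerZr ip); ring.
Qed.

(** [x^* [H, H] x] is the squared norm of [H x], so the matrix inequality says that [x |-> H x] is a
    contraction. Only this form is used afterwards. *)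
Lemma loewner_gramP : loewner_le (gram H) 1%:M <->
  forall x, \sum_i re (dot (rowH x i) (rowH x i)) <= cvsq x.
Proof.
have formE (x : 'cV[C]_q) : (x^t* *m (1%:M - gram H) *m x) 0 0 =
    toC (cvsq x - \sum_i re (dot (rowH x i) (rowH x i))).
  rewrite mulmxBr mulmxBl mulmx1 toCD toCN -gram_form.
  have -> : toC (cvsq x) = (x^t* *m x) 0 0; last by rewrite mxE; congr (_ + _); rewrite mxE.
  by rewrite -cdotxx mxE; apply: eq_bigr => i _; rewrite !mxE mulrC.
split=> [[_ h] x|h].
  by have := h x; rewrite formE -toC0 toC_le subr_ge0.
split; last by move=> x; rewrite formE -toC0 toC_le subr_ge0.
apply/is_hermitianmxP; rewrite expr0 scale1r; apply/matrixP => i j; rewrite !mxE.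
rewrite rmorphB /= !gramE rmorph_sum /= rmorph_nat eq_sym; congr (_ - _).
by apply: eq_bigr => k _; rewrite -(inner_sym (H2_inner R)).
Qed.
End Gram.

Section Blocks.
Variable R : realType.
Local Notation C := (Cplx R).

Lemma mxvec_sum M p (V : zmodType) (F : 'I_(M * p) -> V) :
  \sum_a F a = \sum_i \sum_j F (mxvec_index j i).
Proof.
rewrite exchange_big pair_big /=; have := curry_mxvec_bij M p => hb.
by rewrite (reindex _ hb) /=; apply: eq_bigr => -[j i] _.
Qed.

(** Row [mxvec_index j i] of [K] is row [i] of its [j]-th block, so the right-hand side of the
    theorem is read off entrywise from [usubmx s *m A]. *)
Lemma block_feedback M p q (c : 'I_M -> C) (s : 'M[C]_(M * p + q, q))
    (A : 'M[C]_q) (K : 'M[C]_(M * p, q)) : K = usubmx s *m A ->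
  (\sum_(j < M) c j *: top_block s j) *m A =
  \matrix_(i, k) \sum_(j < M) c j * K (mxvec_index j i) k.
Proof.
move=> ->; apply/matrixP => i k; rewrite mulmx_suml summxE mxE; apply: eq_bigr => j _.
rewrite -scalemxAl mxE; congr (_ * _); rewrite !mxE; apply: eq_bigr => l _.
by rewrite mxE.
Qed.
End Blocks.

(** * Contractive power series and Schur functions *)

Section Feedback.
Variable R : realType.
Local Notation C := (Cplx R).
Variables (r q : nat).
Implicit Types K : nat -> 'M[C]_(r, q).

(** [[K, K] <= 1] in terms of partial sums, so that square summability is a consequence and not a
    prerequisite. *)
Definition contractive_coefs K :=
  forall x N, \sum_(n < N) cvsq (K n *m x) <= cvsq x.

Lemma contractive_coefs_entry K N i j : contractive_coefs K ->
  \sum_(n < N) nrm (K n i j) ^+ 2 <= 1.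
Proof.
move=> hK; have := hK (delta_mx j 0) N; rewrite cvsq_delta; apply: le_trans.
apply: ler_sum => n _; rewrite -colE.
by have := cv_coef_le (col j (K n)) i; rewrite mxE.
Qed.

Lemma schur_realization K : contractive_coefs K ->
  exists s : C -> 'M[C]_(r + q, q), schur_function s /\
    forall w, nrm w < 1 -> \matrix_(i, j) ps_eval (fun n => K n i j) w =
      usubmx (s w) *m invmx (1%:M - w *: dsubmx (s w)).
Proof.
move=> hK; have ip := H2_inner R.
have Ksum a k : sq_summable (fun n => K n a k) 1.
  by move=> N; exact: contractive_coefs_entry.
pose KH a k : H2 R := toH2 (summable_hardy (Ksum a k)).
(* The space of [r]-tuples in [H2]: [B] shifts each component backward, [E] reads the constant
   terms. *)
pose V : lmodType C := {ffun 'I_r -> H2 R}.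
pose dV (u v : V) : C := \sum_a dot (u a) (v a).
have ipV : inner_product dV.
  split=> [a u v w|u v|u].
  - rewrite /dV mulr_sumr -big_split /=; apply: eq_bigr => i _.
    by rewrite !ffunE (inner_linear ip).
  - by rewrite /dV rmorph_sum /=; apply: eq_bigr => i _; rewrite (inner_sym ip).
  - by apply: sumr_ge0 => i _; exact: (inner_ge0 ip).
pose B (v : V) : V := [ffun a => backH (v a)].
pose E (v : V) : 'cV[C]_r := \col_a v a 0%N.
pose KV (x : 'cV[C]_q) : V := [ffun a => \sum_k x k 0 *: KH a k].
have linB a u v : B (a *: u + v) = a *: B u + B v.
  by apply/ffunP => i; rewrite !ffunE backHD.
have linE a u v : E (a *: u + v) = a *: E u + E v.
  by apply/matrixP => i j; rewrite !mxE !ffunE.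
have linK a u v : KV (a *: u + v) = a *: KV u + KV v.
  apply/ffunP => i; rewrite !ffunE scaler_sumr -big_split /=; apply: eq_bigr => k _.
  by rewrite !mxE scalerDl scalerA.
have sqnB v : re (dV v v) = cvsq (E v) + re (dV (B v) (B v)).
  rewrite !re_sum -big_split /=; apply: eq_bigr => i _.
  by rewrite sqn_back mxE ffunE.
have KVE x a n : KV x a n = (K n *m x) a 0.
  by rewrite ffunE H2_sumE mxE; apply: eq_bigr => k _; rewrite mulrC.
have contrK x : re (dV (KV x) (KV x)) <= cvsq x.
  have h : (fun N => \sum_(n < N) cvsq (K n *m x)) @ \oo --> re (dV (KV x) (KV x)).
    rewrite re_sum; have h := cvg_sumR (r := index_enum 'I_r) (fun a => sqn_cvg (KV x a)).
    suff -> : (fun N => \sum_(n < N) cvsq (K n *m x)) =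
      (fun n => \sum_a \sum_(n0 < n) nrm (KV x a n0) ^+ 2) by exact: h.
    apply/funext => N; rewrite exchange_big /=; apply: eq_bigr => n _.
    by apply: eq_bigr => a _; rewrite KVE.
  by apply: (cvgn_le_cst h); apply: nearW => N; exact: hK.
have KE n x : K n *m x = E (iter n B (KV x)).
  have -> : iter n B (KV x) = [ffun a => iter n (@backH R) (KV x a)].
    by apply/ffunP => a; rewrite [RHS]ffunE; elim: n => //= n ih; rewrite [LHS]ffunE ih.
  apply/matrixP => i j; rewrite ord1 !mxE ffunE -[RHS]/(iter n (@backH R) (KV x i) 0%N).
  have it u m l : iter m (@backH R) u l = u (l + m)%N.
    by elim: m l => [|m ih] l; rewrite ?addn0 //= /back ih addSnnS.
  by rewrite it KVE mxE.
pose S1 := out1 dV B E KV; pose S2 := out2 dV B KV.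
have rec n : K n = S1 n + delay (mxconv K S2) n.
  by rewrite mxconv_delay_sum; apply: (out_recurrence ipV linB linE linK).
have Scontr n x : cvsq (S1 n *m x) + cvsq (S2 n *m x) <= cvsq x.
  exact: (out_contr ipV linB linE linK sqnB contrK).
have S1b i j : bounded_seq (fun n => S1 n i j) 1.
  move=> n; apply: contr_entry_le => x; apply: le_trans (Scontr n x).
  by rewrite lerDl cvsq_ge0.
have S2b i j : bounded_seq (fun n => S2 n i j) 1.
  move=> n; apply: contr_entry_le => x; apply: le_trans (Scontr n x).
  by rewrite lerDr cvsq_ge0.
have Kb i j : bounded_seq (fun n => K n i j) 1.
  move=> n; apply: contr_entry_le => x; apply: le_trans (hK x n.+1).
  by rewrite big_ord_recr /= lerDr; apply: sumr_ge0 => *; exact: cvsq_ge0.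
pose s1 w := \matrix_(i, j) ps_eval (fun n => S1 n i j) w.
pose s2 w := \matrix_(i, j) ps_eval (fun n => S2 n i j) w.
have sC w x : nrm w < 1 -> cvsq (s1 w *m x) + cvsq (s2 w *m x) <= cvsq x.
  (* The outputs converge with the power series; [telescope_limit] removes the stored energy [t]. *)
  move=> w1; have [t t0 ht] := out_partial_energy ipV linB linE linK sqnB contrK x w1.
  have cv m (S : nat -> 'M[C]_(m, q)) : (forall i j, bounded_seq (fun n => S n i j) 1) ->
      (fun N => cvsq ((\sum_(n < N) w ^+ n *: S n) *m x)) @ \oo -->
      cvsq ((\matrix_(i, j) ps_eval (fun n => S n i j) w) *m x).
    move=> Sb; apply: cvg_sumR => i.
    have h : (fun N => ((\sum_(n < N) w ^+ n *: S n) *m x) i 0) @ \oo -->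
        ((\matrix_(i, j) ps_eval (fun n => S n i j) w) *m x) i 0.
      have h := cvg_sum (r := index_enum 'I_q) (fun k => cvgCZ (a := x k 0) (ps_cvg (Sb i k) w1)).
      rewrite mxE; have -> : \sum_j (\matrix_(i0, j0) ps_eval (fun n => S n i0 j0) w) i j * x j 0 =
        \sum_k x k 0 * ps_eval (fun n => S n i k) w.
        by apply: eq_bigr => k _; rewrite mxE mulrC.
      suff -> : (fun N => ((\sum_(n < N) w ^+ n *: S n) *m x) i 0) =
        (fun n => \sum_k x k 0 * \sum_(n0 < n) S n0 i k * w ^+ n0) by exact: h.
      apply/funext => N; rewrite mxE; apply: eq_bigr => k _; rewrite summxE mulrC.
      by congr (_ * _); apply: eq_bigr => n _; rewrite mxE mulrC.
    by have hn := cvg_nrm h; apply: (cvgM hn hn).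
  have h := cvgD (cv _ S1 S1b) (cv _ S2 S2b).
  apply: (@telescope_limit _ (fun N => cvsq ((\sum_(n < N) w ^+ n *: S1 n) *m x) +
    cvsq ((\sum_(n < N) w ^+ n *: S2 n) *m x)) t (cvsq x)) => //; exact: h.
exists (fun w => col_mx (s1 w) (s2 w)); split=> [z|w w1].
  rewrite /unit_disk /= nrm_lt1 => z1; split=> [i j|x].
    case: (split_ordP i) => i' ->.
    - under [X in analytic_at X]funext do rewrite col_mxEu mxE.
      exact: ps_analytic (S1b i' j) z1.
    under [X in analytic_at X]funext do rewrite col_mxEd mxE.
    exact: ps_analytic (S2b i' j) z1.
  by rewrite cvnorm_le mul_col_mx cvsq_col_mx sC.
rewrite col_mxKu col_mxKd.
have u : 1%:M - w *: s2 w \in unitmx.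
  apply: resolvent_unitmx => // x; apply: le_trans (sC w x w1).
  by rewrite lerDr cvsq_ge0.
by rewrite /s1 -(feedback_eval rec S1b S2b Kb w1) mulmxK.
Qed.

Lemma schur_feedback (s : C -> 'M[C]_(r + q, q)) : schur_function s ->
  exists K, contractive_coefs K /\
    forall w, nrm w < 1 -> \matrix_(i, j) ps_eval (fun n => K n i j) w =
      usubmx (s w) *m invmx (1%:M - w *: dsubmx (s w)).
Proof.
move=> sS; have [S hS] := schur_coefs sS.
pose S1 n := usubmx (S n); pose S2 n := dsubmx (S n).
have [U hU] : exists U : nat -> 'M[C]_q,
    forall n, U n = (n == 0%N)%:R%:M + delay (mxconv S2 U) n.
  apply: (causal_fixpoint 0 (Phi := fun U n => (n == 0%N)%:R%:M + delay (mxconv S2 U) n)).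
  move=> u v [|n] uv //=; congr (_ + _); apply: eq_bigr => i _; congr (_ *m _).
  by apply: uv; rewrite ltnS leq_subr.
have [K hK] : exists K, forall n, K n = S1 n + delay (mxconv K S2) n.
  apply: (causal_fixpoint 0 (Phi := fun K n => S1 n + delay (mxconv K S2) n)).
  move=> u v [|n] uv //=; congr (_ + _); apply: eq_bigr => i _; congr (_ *m _).
  by apply: uv.
have KU := feedback_conv hK hU.
have Kc : contractive_coefs K.
  move=> x N; have := toeplitz_contraction sS hS (fun n => U n *m x) N.
  have U0 : U 0%N *m x = x by rewrite hU /= addr0 mul1mx.
  (* The lower block of [s u] is [(u - x) / z], hence the index [n.+1]. *)
  have e n : \sum_(k < n.+1) S k *m (U (n - k)%N *m x) = col_mx (K n *m x) (U n.+1 *m x).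
    have -> : \sum_(k < n.+1) S k *m (U (n - k)%N *m x) = mxconv S U n *m x.
      by rewrite /mxconv mulmx_suml; apply: eq_bigr => k _; rewrite mulmxA.
    rewrite -mul_col_mx; congr (_ *m _); rewrite KU [U n.+1]hU /= raddf0 add0r.
    rewrite -[LHS]vsubmxK /mxconv !raddf_sum /=; congr col_mx; apply: eq_bigr => k _.
      by rewrite -mul_usub_mx.
    by rewrite -mul_dsub_mx.
  under [X in X <= _ -> _]eq_bigr do rewrite e cvsq_col_mx.
  rewrite big_split /=.
  (* Truncated energies of [u] and of its backward shift differ by [|x|^2 - |U_N x|^2]. *)
  have : cvsq x + \sum_(i < N) cvsq (U i.+1 *m x) = \sum_(i < N) cvsq (U i *m x) + cvsq (U N *m x).
    transitivity (\sum_(i < N.+1) cvsq (U i *m x)); last by rewrite big_ord_recr.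
    by rewrite big_ord_recl U0.
  by have := cvsq_ge0 (U N *m x); lra.
exists K; split=> // w w1.
have Sb i j : bounded_seq (fun n => S n i j) 1.
  by move=> n; apply: contr_entry_le => x; exact: (schur_coef_contr sS hS).
have S1b i j : bounded_seq (fun n => S1 n i j) 1 by move=> n; rewrite mxE; exact: Sb.
have S2b i j : bounded_seq (fun n => S2 n i j) 1 by move=> n; rewrite mxE; exact: Sb.
have Kb i j : bounded_seq (fun n => K n i j) 1.
  move=> n; apply: contr_entry_le => x; apply: le_trans (Kc x n.+1).
  by rewrite big_ord_recr /= lerDr; apply: sumr_ge0 => *; exact: cvsq_ge0.
have e1 : usubmx (s w) = \matrix_(i, j) ps_eval (fun n => S1 n i j) w.
  apply/matrixP => i j; rewrite !mxE (schur_taylor sS hS _ _ w1).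
  by congr ps_eval; apply/funext => n; rewrite mxE.
have e2 : dsubmx (s w) = \matrix_(i, j) ps_eval (fun n => S2 n i j) w.
  apply/matrixP => i j; rewrite !mxE (schur_taylor sS hS _ _ w1).
  by congr ps_eval; apply/funext => n; rewrite mxE.
have u : 1%:M - w *: dsubmx (s w) \in unitmx.
  apply: resolvent_unitmx => // x; have := schur_contr sS x w1.
  apply: le_trans; rewrite -[s w in leRHS]vsubmxK mul_col_mx cvsq_col_mx.
  by rewrite lerDr cvsq_ge0.
by rewrite e1 -(feedback_eval hK S1b S2b Kb w1) -e2 mulmxK.
Qed.
End Feedback.

(** * The equivalence for a finite Blaschke product *)

Theorem theorem5p1 (R : realType) (M p q : nat) (b : Cplx R -> Cplx R)
    (e : 'I_M -> nat -> Cplx R) (H : nat -> 'M[Cplx R]_(p, q)) :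
  (0 < M)%N -> (0 < p)%N -> (0 < q)%N ->
  finite_blaschke M b ->
  orthonormal_basis (model_space b) e ->
  mxhardy H ->
  loewner_le (gram H) 1%:M
  <->
  exists s : Cplx R -> 'M[Cplx R]_(M * p + q, q),
    schur_function s /\
    forall z, unit_disk z ->
      mxps_eval H z =
        (\sum_(j < M) ps_eval (e j) z *: top_block (s (b z)) j)
          *m invmx (1%:M - b z *: bottom_block (s (b z))).
Proof.
move=> M0 p0 q0 bB eV hH.
have [[T bT] b1] := finite_blaschke_multiplier M0 bB.
pose eH := basisH eV; have ip := H2_inner R.
have eo := basisH_orth bT eV; have eon := basisH_on eV; have esp := basisH_span bT eV.
have evE j z : ps_eval (e j) z = ev (eH j) z by [].
have HE z : nrm z < 1 -> mxps_eval H z = \matrix_(i, k) ev (entryH hH i k) z.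
  move=> z1.
  apply: (mxps_evalE (B := \sum_i \sum_k (1 + re (dot (entryH hH i k) (entryH hH i k))))) => // i k n.
  have s0 i' k' : 0 <= 1 + re (dot (entryH hH i' k') (entryH hH i' k')).
    by rewrite addr_ge0 ?(sqn_ge0 ip).
  apply: le_trans (H2_bounded (entryH hH i k) n) _.
  apply: (@le_trans _ _ (\sum_k (1 + re (dot (entryH hH i k) (entryH hH i k))))).
    exact: (le_sum_one (F := fun k => 1 + re (dot (entryH hH i k) (entryH hH i k)))).
  apply: (le_sum_one (F := fun i => \sum_k (1 + re (dot (entryH hH i k) (entryH hH i k))))) => i'.
  by apply: sumr_ge0.
rewrite (loewner_gramP hH); split=> [hle|[s [sS sE]]].
  pose E j n := orbit_basis T eH j n.
  (* Stacked coefficients of the entries of [H] along [e_j b^n], in the row-major order of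
     [top_block]. *)
  pose K n : 'M[Cplx R]_(M * p, q) :=
    \matrix_(a, k) mxvec (\matrix_(j, i) dot (entryH hH i k) (E j n)) 0 a.
  have KE n j i k : K n (mxvec_index j i) k = dot (entryH hH i k) (E j n).
    by rewrite mxE mxvecE mxE.
  have KxE n x j i : (K n *m x) (mxvec_index j i) 0 = dot (rowH hH x i) (E j n).
    rewrite mxE (inner_suml ip); apply: eq_bigr => k _.
    by rewrite KE (innerZl ip) mulrC.
  have Kc : contractive_coefs K.
    (* Bessel's inequality for each row of [H x]. *)
    move=> x N; apply: le_trans (hle x).
    rewrite (eq_bigr (fun n : 'I_N => \sum_i \sum_j nrm (dot (rowH hH x i) (E j n)) ^+ 2)); last first.
      move=> n _; rewrite /cvsq mxvec_sum; apply: eq_bigr => i _; apply: eq_bigr => j _.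
      by rewrite KxE.
    rewrite exchange_big /=; apply: ler_sum => i _.
    by have [] := bessel_orbit bT eo eon esp (rowH hH x i) N.
  have [s [sS sE]] := schur_realization Kc.
  exists s; split=> // z; rewrite /unit_disk /= nrm_lt1 => z1.
  rewrite (HE z z1) (block_feedback _ (sE _ (b1 z z1))).
  apply/matrixP => i k; rewrite !mxE (orbit_expansion bT b1 eo eon esp) //.
  apply: eq_bigr => j _; rewrite evE !mxE; congr (_ * ps_eval _ _).
  by apply/funext => n; rewrite KE.
have [K [Kc KE]] := schur_feedback sS.
have Kb a k : bounded_seq (fun n => K n a k) 1.
  move=> n; apply: contr_entry_le => x; apply: le_trans (Kc x n.+1).
  by rewrite big_ord_recr /= lerDr; apply: sumr_ge0 => *; exact: cvsq_ge0.
move=> x.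
(* Coefficients along [e_j b^n] of a series with the same values as row [i] of [H x]. They are not
   identified with inner products; [orbit_synthesis_bound] works from the values. *)
pose c i j n := (K n *m x) (mxvec_index j i) 0.
have cE N : \sum_(n < N) \sum_i \sum_j nrm (c i j n) ^+ 2 <= cvsq x.
  apply: le_trans (Kc x N); rewrite le_eqVlt; apply/orP; left; apply/eqP.
  by apply: eq_bigr => n _; rewrite [RHS]mxvec_sum.
have psc i j w : nrm w < 1 -> ps_eval (c i j) w =
    \sum_k x k 0 * ps_eval (fun n => K n (mxvec_index j i) k) w.
  move=> w1; apply: ps_lim.
  have h := cvg_sum (r := index_enum 'I_q) (fun k => cvgCZ (a := x k 0) (ps_cvg (Kb (mxvec_index j i) k) w1)).
  suff -> : (fun N => \sum_(n < N) c i j n * w ^+ n) =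
    (fun n => \sum_k x k 0 * \sum_(n0 < n) K n0 (mxvec_index j i) k * w ^+ n0) by exact: h.
  apply/funext => N; under [RHS]eq_bigr do rewrite mulr_sumr.
  rewrite [RHS]exchange_big /=; apply: eq_bigr => n _; rewrite /c mxE mulr_suml.
  by apply: eq_bigr => k _; ring.
have hE i z : nrm z < 1 -> ev (rowH hH x i) z = \sum_j ev (eH j) z * ps_eval (c i j) (b z).
  move=> z1; have zD : unit_disk z by rewrite /unit_disk /= nrm_lt1.
  have := sE z zD; rewrite (HE z z1) (block_feedback _ (KE _ (b1 z z1))) => /matrixP he.
  rewrite ev_sum //; transitivity (\sum_k \sum_j x k 0 * (ev (eH j) z *
      ps_eval (fun n => K n (mxvec_index j i) k) (b z))).
    apply: eq_bigr => k _; have := he i k; rewrite !mxE evZ // => ->.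
    by rewrite mulr_sumr; apply: eq_bigr => j _; rewrite evE mxE.
  rewrite exchange_big /=; apply: eq_bigr => j _; rewrite psc ?b1 // mulr_sumr.
  by apply: eq_bigr => k _; rewrite mulrCA.
have bound := orbit_synthesis_bound bT b1 eo eon cE hE.
have hl : (fun m => \sum_(n < m) \sum_i nrm (rowH hH x i n) ^+ 2) @ \oo -->
    \sum_i re (dot (rowH hH x i) (rowH hH x i)).
  have h := cvg_sumR (r := index_enum 'I_p) (fun i => sqn_cvg (rowH hH x i)).
  suff -> : (fun m => \sum_(n < m) \sum_i nrm (rowH hH x i n) ^+ 2) =
    (fun n => \sum_i \sum_(n0 < n) nrm (rowH hH x i n0) ^+ 2) by exact: h.
  by apply/funext => m; rewrite exchange_big.
by apply: (cvgn_le_cst hl); apply: nearW => m; exact: bound.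
Qed.
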